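(* Let $n\ge1$ and $k\in\{1,\ldots,n\}$. For any $u\in S(\mathbb{R}^n_{k,+})$, $$\int_{\mathbb{R}^n_{k,+}}|\nabla u(x)|^2dx+\int_{\mathbb{R}^n_{k,+}}|x|^2|u(x)|^2dx-(n+2k)\int_{\mathbb{R}^n_{k,+}}|u(x)|^2dx\;\ge\;2\inf_{c\in\mathbb{R}}\int_{\mathbb{R}^n_{k,+}}\left|u(x)-c\Big(\prod_{i=n-k+1}^{n}x_i\Big)e^{-\frac12|x|^2}\right|^2dx.$$ The constant $2$ on the right-hand side is sharp, and equality holds if and only if $u$ is of the form $$u(x)=\Bigg(\prod_{i=n-k+1}^{n}x_i\Bigg)e^{-\frac{|x|^2}{2}}\Bigg(\sum_{i=1}^{n-k}b_ix_i+b\Bigg),\qquad b_1,\ldots,b_{n-k},b\in\mathbb{R}.$$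
   Context: $\mathbb{R}^n_{k,+}:=\mathbb{R}^{n-k}\times(0,\infty)^k$. $S(\mathbb{R}^n_{k,+})$ is the completion of $C_c^\infty(\mathbb{R}^n_{k,+})$ (smooth functions with compact support in the open orthant) under the norm $\left(\int_{\mathbb{R}^n_{k,+}}|\nabla u|^2dx\right)^{1/2}+\left(\int_{\mathbb{R}^n_{k,+}}|x|^2|u|^2dx\right)^{1/2}$. Functions are real-valued.
   Formalization: Sharpness of the constant 2 is stated only for k < n: for k = n it is false, since the inequality then holds with 4 in place of 2 (e.g. n = k = 1, where -d²/dx²+x² on (0,∞) has Dirichlet spectrum 3, 7, 11, …). *)

(* Defs.v *)
From HB Require Import structures.
From mathcomp Require Import all_boot all_order all_algebra.
From mathcomp Require Import all_classical all_reals all_analysis.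
Set Implicit Arguments.
Unset Strict Implicit.
Unset Printing Implicit Defensive.
Import Order.TTheory GRing.Theory Num.Theory.
Import numFieldNormedType.Exports.
Local Open Scope classical_set_scope.
Local Open Scope ring_scope.

(** The product sigma-algebra on row vectors, generated by the coordinates, as
    the library does for [n.-tuple T]. *)
Section measurable_rV.
Context {d : measure_display} {T : measurableType d} {n : nat}.

Let coord (i : 'I_n) (x : 'rV[T]_n) : T := x 0 i.

Let rV_set0 : g_sigma_preimage coord set0.
Proof. exact: sigma_algebra0. Qed.

Let rV_setC A : g_sigma_preimage coord A -> g_sigma_preimage coord (~` A).
Proof. exact: sigma_algebraC. Qed.

Let rV_bigcup (F : _^nat) : (forall i, g_sigma_preimage coord (F i)) ->
  g_sigma_preimage coord (\bigcup_i (F i)).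
Proof. exact: sigma_algebra_bigcup. Qed.

HB.instance Definition _ := @isMeasurable.Build (measure_tuple_display d)
  'rV[T]_n (g_sigma_preimage coord) rV_set0 rV_setC rV_bigcup.

Lemma measurable_coord_rV (i : 'I_n) :
  measurable_fun [set: 'rV[T]_n] (fun x => x 0 i).
Proof.
move=> _ Y mY; rewrite setTI; apply: sub_sigma_algebra => /=.
rewrite -bigcup_seq/=; exists i => /=; first by rewrite mem_index_enum.
by exists Y => //; rewrite setTI.
Qed.

Lemma measurable_fun_rVP d' (T' : measurableType d') (f : T' -> 'rV[T]_n) :
  (forall i, measurable_fun [set: T'] (fun t => f t 0 i)) ->
  measurable_fun [set: T'] f.
Proof.
move=> mf _ A mA; rewrite setTI.
have : preimage_set_system setT f (g_sigma_preimage coord) (f @^-1` A).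
  by exists A => //; rewrite setTI.
rewrite -g_sigma_preimage_comp; apply: smallest_sub.
  exact: sigma_algebra_measurable.
rewrite -bigcup_seq/= => B [i _] [Y mY <-].
by rewrite setTI; have := mf i measurableT Y mY; rewrite setTI.
Qed.

End measurable_rV.

Definition cons_rV (T : Type) (n : nat) (p : T * 'rV[T]_n) : 'rV[T]_n.+1 :=
  \row_i oapp (fun j => p.2 0 j) p.1 (unlift ord0 i).

Section lebesgue_rV.
Context {R : realType}.
Local Open Scope ereal_scope.

Let consR n : measurableTypeR R * 'rV[R]_n -> 'rV[R]_n.+1 := @cons_rV R n.

Let measurable_consR n : measurable_fun setT (@consR n).
Proof.
apply: measurable_fun_rVP => i.
case: (unliftP ord0 i) => [j ->|->].
  apply: (@eq_measurable_fun _ _ _ _ _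
    (fun p : measurableTypeR R * 'rV[R]_n => p.2 0%R j)).
    by move=> p _; rewrite /consR mxE liftK.
  by apply: (measurableT_comp (measurable_coord_rV j)).
move=> _ Y mY.
rewrite (_ : (fun t => _) = fst); first exact: measurable_fst.
by apply/funext => p; rewrite /consR mxE unlift_none.
Qed.

Let uncons n (x : 'rV[R]_n.+1) : measurableTypeR R * 'rV[R]_n :=
  (x 0%R ord0, \row_j x 0%R (lift ord0 j)).

Let measurable_uncons n : measurable_fun setT (@uncons n).
Proof.
apply/measurable_fun_pairP; split.
  exact: (@measurable_coord_rV _ R n.+1 ord0).
apply: measurable_fun_rVP => i.
apply: (@eq_measurable_fun _ _ _ _ _
  (fun x : 'rV[R]_n.+1 => x 0%R (lift ord0 i))).
  by move=> x _; rewrite /= mxE.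
exact: measurable_coord_rV.
Qed.

Let consRK n : cancel (@consR n) (@uncons n).
Proof.
move=> [a x]; rewrite /uncons /consR /cons_rV mxE unlift_none /=.
by congr pair; apply/rowP => j; rewrite !mxE liftK.
Qed.

Section step.
Context {n : nat} (m : {sigma_finite_measure set 'rV[R]_n -> \bar R}).

Definition lebesgue_rV_step : set 'rV[R]_n.+1 -> \bar R :=
  pushforward ((@lebesgue_measure R) \x m) (@consR n).

Let step0 : lebesgue_rV_step set0 = 0.
Proof. by rewrite /lebesgue_rV_step /pushforward preimage_set0 measure0. Qed.

Let step_ge0 A : 0 <= lebesgue_rV_step A.
Proof. by rewrite /lebesgue_rV_step /pushforward; exact: measure_ge0. Qed.

Let step_sigma_additive : semi_sigma_additive lebesgue_rV_step.
Proof.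
have [f fE] : exists f : {measure set 'rV[R]_n.+1 -> \bar R},
  f = lebesgue_rV_step :> (set _ -> _).
  by exists (measure_function_pushforward__canonical__measure_function_Measure
    ((@lebesgue_measure R) \x m)%E (@measurable_consR n)).
by rewrite -fE; exact: measure_semi_sigma_additive.
Qed.

HB.instance Definition _ := isMeasure.Build _ _ _
  lebesgue_rV_step step0 step_ge0 step_sigma_additive.

Let step_sigma_finite : sigma_finite setT lebesgue_rV_step.
Proof.
have /sigma_finiteP[F [FT ndF Foo]] := sigma_finiteT (@lebesgue_measure R).
have /sigma_finiteP[G [GT ndG Goo]] := sigma_finiteT m.
exists (fun k => @uncons n @^-1` (F k `*` G k)) => [|k].
  rewrite -preimage_bigcup; apply/esym/seteqP; split => // x _ /=.
  have: (\bigcup_k F k) (uncons x).1 by rewrite -FT.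
  have: (\bigcup_k G k) (uncons x).2 by rewrite -GT.
  move=> [j _ Gj] [i _ Fi]; exists (maxn i j) => //; split.
    by move: Fi; exact/subsetPset/ndF/leq_maxl.
  by move: Gj; exact/subsetPset/ndG/leq_maxr.
have [mFk Fk] := Foo k; have [mGk Gk] := Goo k; split.
  rewrite -[X in measurable X]setTI; apply: measurable_uncons => //.
  exact: measurableX.
rewrite /lebesgue_rV_step /pushforward (_ : _ @^-1` _ = F k `*` G k).
  by rewrite product_measure1E// lte_mul_pinfty// ge0_fin_numE.
by rewrite -comp_preimage (_ : _ \o _ = id) ?preimage_id//; exact/funext/consRK.
Qed.

HB.instance Definition _ := Measure_isSigmaFinite.Build _ _ _
  lebesgue_rV_step step_sigma_finite.

End step.

(** The n-dimensional Lebesgue measure, as an iterated product. *)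
Fixpoint lebesgue_rV (n : nat) :
    {sigma_finite_measure set 'rV[R]_n -> \bar R} :=
  if n is n'.+1 then lebesgue_rV_step (lebesgue_rV n')
  else dirac (0%R : 'rV[R]_0).

Lemma lebesgue_rV_box (n : nat) (A : 'I_n -> set (measurableTypeR R)) :
  (forall i, measurable (A i)) ->
  lebesgue_rV n [set x | forall i, A i (x 0%R i)] =
  \prod_(i < n) lebesgue_measure (A i).
Proof.
elim: n A => [|n IHn] A mA.
  by rewrite big_ord0 /= diracE mem_set//= => -[].
rewrite big_ord_recl -IHn//= -product_measure1E//; last first.
  rewrite [X in measurable X](_ : _ =
    \bigcap_(i in [set: 'I_n]) (fun x : 'rV[R]_n => x 0%R i) @^-1` A (lift ord0 i)).
    apply: fin_bigcap_measurable => // i _.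
    rewrite -[X in measurable X]setTI.
    exact: (measurable_coord_rV i measurableT (mA (lift ord0 i))).
  by apply/seteqP; split => x /= Ax i; [move=> _|]; exact: Ax.
rewrite /lebesgue_rV_step /pushforward; congr (_ _).
apply/seteqP; split => -[a x] /=.
  move=> Aax; split => [|i].
    by have := Aax ord0; rewrite /consR mxE unlift_none.
  by have := Aax (lift ord0 i); rewrite /consR mxE liftK.
move=> [Aa Ax] i; rewrite /consR mxE.
by case: (unliftP ord0 i) => [j ->|->] //=; exact: Ax.
Qed.

End lebesgue_rV.
Arguments lebesgue_rV {R} n.

Section orthant.
Context {R : realType} {n : nat}.
Implicit Types (u : 'rV[R]_n -> R) (g : 'rV[R]_n -> 'rV[R]_n).

(** R^(n-k) x (0, +oo)^k; coordinates are numbered from 0. *)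
Definition orthant (k : nat) : set 'rV[R]_n :=
  [set x | forall i : 'I_n, (n - k <= i)%N -> 0 < x 0 i].

(** The squared Euclidean norm (the library norm `|x| on 'rV[R]_n is the sup
    norm). *)
Definition sqnorm (x : 'rV[R]_n) : R := \sum_(i < n) x 0 i ^+ 2.

Definition partial (i : 'I_n) u : 'rV[R]_n -> R :=
  fun x => 'D_(delta_mx 0 i) u x.

Definition gradient u : 'rV[R]_n -> 'rV[R]_n := fun x => \row_i partial i u x.

Definition iter_partial (s : seq 'I_n) u : 'rV[R]_n -> R := foldr partial u s.

Definition smooth u : Prop :=
  forall s : seq 'I_n, continuous (iter_partial s u) /\
    forall (i : 'I_n) (x : 'rV[R]_n),
      derivable (iter_partial s u) x (delta_mx 0 i).

Definition supp u : set 'rV[R]_n := closure [set x | u x != 0].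

(** C_c^oo of the open orthant, its elements being extended by zero to R^n. *)
Definition test_function (k : nat) u : Prop :=
  [/\ smooth u, compact (supp u) & supp u `<=` orthant k].

Definition grad_int (k : nat) g : \bar R :=
  (\int[lebesgue_rV n]_(x in orthant k) (sqnorm (g x))%:E)%E.

Definition moment_int (k : nat) u : \bar R :=
  (\int[lebesgue_rV n]_(x in orthant k) (sqnorm x * u x ^+ 2)%:E)%E.

Definition sq_int (k : nat) u : \bar R :=
  (\int[lebesgue_rV n]_(x in orthant k) (u x ^+ 2)%:E)%E.

(** The norm defining S, with the gradient as a separate argument. *)
Definition S_norm (k : nat) u g : \bar R :=
  (sqrte (grad_int k g) + sqrte (moment_int k u))%E.

(** [in_S k u g]: u belongs to the completion S and g is its gradient.  Since
    phi |-> (phi, gradient phi) embeds the test functions isometrically into the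
    complete space L^2(|x|^2 dx) x L^2(dx)^n, their completion is the closure of
    the image; g is determined a.e. by u, as distributional gradient.  Only the
    values of u and g on the orthant matter. *)
Definition in_S (k : nat) u g : Prop :=
  [/\ measurable_fun (orthant k) u,
      forall i : 'I_n, measurable_fun (orthant k) (fun x => g x 0 i) &
      exists phi : nat -> 'rV[R]_n -> R,
        (forall j, test_function k (phi j)) /\
        (fun j => S_norm k (u \- phi j) (g \- gradient (phi j))) @ \oo --> 0%E].

(** The product of the last k coordinates times exp(- |x|^2 / 2). *)
Definition ground_state (k : nat) : 'rV[R]_n -> R := fun x =>
  (\prod_(i < n | (n - k <= i)%N) x 0 i) * expR (- (sqnorm x / 2)).

(** Only the first n - k components of b are used. *)
Definition extremal (k : nat) (b : 'rV[R]_n) (b0 : R) : 'rV[R]_n -> R :=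
  fun x => ground_state k x * (\sum_(i < n | (i < n - k)%N) b 0 i * x 0 i + b0).

Definition deficit (k : nat) u g : \bar R :=
  (grad_int k g + moment_int k u - (n + 2 * k)%:R%:E * sq_int k u)%E.

Definition sqdist_ground (k : nat) u : \bar R :=
  ereal_inf [set sq_int k (u \- (c \*: ground_state k)) | c in [set: R]].

End orthant.

(* Main.v *)
Require Import Defs.
From HB Require Import structures.
From mathcomp Require Import all_boot all_order all_algebra.
From mathcomp Require Import all_classical all_reals all_analysis.
From mathcomp Require Import measurable_realfun lebesgue_measure.
From mathcomp Require Import ring lra.
Import Order.TTheory GRing.Theory Num.Theory.
Import numFieldNormedType.Exports.
Local Open Scope classical_set_scope.
Local Open Scope ring_scope.

(** Write [w0] for the one-dimensional ground state, [t exp(-t^2/2)] on the half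
    line and [exp(-t^2/2)] on the line, and [w1] for the first excited state
    [t exp(-t^2/2)] on the line.  The next eigenvalue of [-d^2/dt^2 + t^2] lies 4
    above the lowest one on the half line, and that is also the distance from the
    first to the third one on the line.  Hence, for compactly supported [u] and with
    [E] the ground energy, |u'|^2 + |t u|^2 - E |u|^2 is at least
    4 |u|^2 - 4 |P0 u|^2 - 2 |P1 u|^2, where P0 and P1 project on the first two
    eigenspaces ([P1 = 0] on the half line); this comes from completing squares with
    the supersymmetric factors of the operator.  The same bound holds in dimension n
    by induction, for P0 the projection on the ground state and P1 the one on the
    [x_i * ground_state k] with [i < n - k]: sum the bounds in the first variable and
    in the others, and control the mixed terms by Bessel's inequality.  By density
    it holds on S, so deficit - 2 dist^2 >= 2 |u - P0 u - P1 u|^2, which proves the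
    inequality and shows that equality forces [u] to be extremal.  Conversely the
    extremals are combinations of eigenfunctions, so that integrating by parts
    against test functions gives the value of their deficit, and they belong to S
    because smooth one-dimensional cut-offs, multiplied over the coordinates,
    approximate them. *)

Set Implicit Arguments.
Unset Strict Implicit.
Unset Printing Implicit Defensive.

(** * Functions dominated by an integrable envelope *)

(** The value 2 is the distance between the two lowest levels on the line. It is visible only
    through a free coordinate, so sharpness is asserted for [k < n]; for [k = n] every mode except
    the ground state is zero and the same argument yields the factor 4. A bound by 2 with P0 alone
    would give the inequality but not its equality case: starting from 4 and subtracting P0 and P1
    with their own weights leaves the extra term 2 |u - P0 u - P1 u|^2. Two obstacles shape the
    proof. The primitives used to complete squares must vanish at both ends, so orthogonality is
    first imposed on a bounded interval, against norms of the states over that interval, which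
    converge as the interval grows. And the norm of S controls |x| u but not u itself where x is
    small; nonnegativity of the energy of compactly supported functions gives a Poincaré inequality,
    which puts u in L^2. Integrals are real-valued wherever possible; one Gaussian envelope
    guarantees their finiteness. *)

Section envelope.
Context d (T : measurableType d) (R : realType).
Variable mu : {measure set T -> \bar R}.

(** Since [0 <= G <= 1], the functions bounded by a multiple of [G] are integrable and also closed
    under products. One predicate therefore discharges every integrability condition for sums,
    products and squares. *)
Definition envelope (G : T -> R) :=
  [/\ measurable_fun setT G, forall x, 0 <= G x <= 1 &
      mu.-integrable setT (EFin \o G)].

Definition dominated (G f : T -> R) :=
  measurable_fun setT f /\ exists2 C, 0 <= C & forall x, `|f x| <= C * G x.

Variable G : T -> R.
Hypothesis envG : envelope G.

Lemma dominated_integrable f : dominated G f -> mu.-integrable setT (EFin \o f).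
Proof.
case: envG => mG G01 iG [mf [C C0 fG]].
apply: (@le_integrable _ _ _ mu _ measurableT _ (fun x => (C%:E * (G x)%:E)%E)).
- exact/measurable_EFinP.
- move=> x _ /=; rewrite lee_fin (le_trans (fG x))//; exact: ler_norm.
- exact: (integrableZl measurableT C iG).
Qed.

Lemma dominatedD f g : dominated G f -> dominated G g ->
  dominated G (fun x => f x + g x).
Proof.
move=> [mf [C C0 fC]] [mg [D D0 gD]]; split; first exact: measurable_funD.
exists (C + D); first exact: addr_ge0.
by move=> x; rewrite mulrDl (le_trans (ler_normD _ _))// lerD.
Qed.

Lemma dominatedN f : dominated G f -> dominated G (fun x => - f x).
Proof.
move=> [mf [C C0 fC]]; split; first exact: measurableT_comp.
by exists C => // x; rewrite normrN.
Qed.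

Lemma dominatedB f g : dominated G f -> dominated G g ->
  dominated G (fun x => f x - g x).
Proof. by move=> df /dominatedN; exact: dominatedD. Qed.

Lemma dominatedM f g : dominated G f -> dominated G g ->
  dominated G (fun x => f x * g x).
Proof.
case: envG => mG G01 iG.
move=> [mf [C C0 fC]] [mg [D D0 gD]]; split; first exact: measurable_funM.
exists (C * D); first exact: mulr_ge0.
move=> x; rewrite normrM; have /andP[G0 G1] := G01 x.
apply: (@le_trans _ _ (C * G x * (D * G x))); first exact: ler_pM.
rewrite mulrACA ler_wpM2l ?mulr_ge0//.
by rewrite -[leRHS]mulr1 ler_wpM2l.
Qed.

Lemma dominatedZ c f : dominated G f -> dominated G (fun x => c * f x).
Proof.
move=> [mf [C C0 fC]]; split; first exact: measurable_funM.
exists (`|c| * C); first exact: mulr_ge0.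
by move=> x; rewrite normrM -mulrA ler_wpM2l.
Qed.

Lemma dominated0 : dominated G (fun=> 0).
Proof. by split=> //; exists 0 => // x; rewrite normr0 mul0r. Qed.

Lemma dominated_sum (I : Type) (r : seq I) (P : pred I) (f : I -> T -> R) :
  (forall i, P i -> dominated G (f i)) ->
  dominated G (fun x => \sum_(i <- r | P i) f i x).
Proof.
move=> df; elim: r => [|i r ih].
  by under eq_fun do rewrite big_nil; exact: dominated0.
have [Pi|Pi] := boolP (P i); last first.
  by under eq_fun do rewrite big_cons (negbTE Pi).
under eq_fun do rewrite big_cons Pi.
by apply: dominatedD => //; exact: df.
Qed.

Lemma intD f g : dominated G f -> dominated G g ->
  \int[mu]_x (f x + g x) = \int[mu]_x f x + \int[mu]_x g x.
Proof. by move=> df dg; rewrite RintegralD//; exact: dominated_integrable. Qed.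

Lemma intB f g : dominated G f -> dominated G g ->
  \int[mu]_x (f x - g x) = \int[mu]_x f x - \int[mu]_x g x.
Proof. by move=> df dg; rewrite RintegralB//; exact: dominated_integrable. Qed.

Lemma intZ c f : dominated G f ->
  \int[mu]_x (c * f x) = c * \int[mu]_x f x.
Proof. by move=> df; rewrite RintegralZl//; exact: dominated_integrable. Qed.

Lemma int_sum (I : Type) (r : seq I) (P : pred I) (f : I -> T -> R) :
  (forall i, P i -> dominated G (f i)) ->
  \int[mu]_x (\sum_(i <- r | P i) f i x) =
  \sum_(i <- r | P i) \int[mu]_x f i x.
Proof.
move=> df; elim: r => [|i r ih].
  rewrite big_nil; under eq_Rintegral do rewrite big_nil.
  by rewrite Rintegral_cst// mul0r.
rewrite big_cons; under eq_Rintegral do rewrite big_cons.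
case: ifP => // Pi; rewrite intD ?ih//; first exact: df.
exact: dominated_sum.
Qed.

Lemma le_int f g : dominated G f -> dominated G g ->
  (forall x, f x <= g x) -> \int[mu]_x f x <= \int[mu]_x g x.
Proof.
by move=> df dg fg; apply: le_Rintegral => //; exact: dominated_integrable.
Qed.

Lemma int_ge0 f : (forall x, 0 <= f x) -> 0 <= \int[mu]_x f x.
Proof. by move=> f0; apply: Rintegral_ge0. Qed.

Lemma int_le f C : 0 <= C -> dominated G f ->
   (forall x, `|f x| <= C * G x) -> `|\int[mu]_x f x| <= C * \int[mu]_x G x.
Proof.
case: envG => mG G01 iG C0 df fC.
apply: le_trans (le_normr_Rintegral _ _) _ => //; first exact: dominated_integrable.
rewrite -RintegralZl//; apply: le_Rintegral => //.
  by have := dominated_integrable df; move=> /integrable_norm.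
exact: (integrableZl measurableT C iG).
Qed.

End envelope.

(** * Real-valued Fubini and Bessel inequalities on a product *)

Section product.
Context d1 d2 (X : measurableType d1) (Y : measurableType d2) (R : realType).
Variable mu : {sigma_finite_measure set X -> \bar R}.
Variable nu : {sigma_finite_measure set Y -> \bar R}.
Variables (GX : X -> R) (GY : Y -> R).
Hypothesis eX : envelope mu GX.
Hypothesis eY : envelope nu GY.

Definition dominated2 (f : X -> Y -> R) :=
  measurable_fun setT (fun p : X * Y => f p.1 p.2) /\
  exists2 C, 0 <= C & forall x y, `|f x y| <= C * (GX x * GY y).

Lemma dominated2_integrable f : dominated2 f ->
  (mu \x nu)%E.-integrable setT (fun p : X * Y => (f p.1 p.2)%:E).
Proof.
case: (eX) => mX X01 iX; case: (eY) => mY Y01 iY [mf [C C0 fC]].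
have mfE : measurable_fun setT (fun p : X * Y => (f p.1 p.2)%:E).
  exact/measurable_EFinP.
apply/integrable12ltyP => //.
apply: (@le_lt_trans _ _ (\int[mu]_x (C * (\int[nu]_y GY y) * GX x)%:E)%E).
  apply: ge0_le_integral => //.
  - by move=> x _; exact: integral_ge0.
  - apply: (measurable_fun_fubini_tonelli_F
      (fun p : X * Y => `| (f p.1 p.2)%:E |%E)) => //.
    exact: measurableT_comp.
  - by apply/measurable_EFinP; apply: measurable_funM.
  - move=> x _.
    apply: (@le_trans _ _ (\int[nu]_y ((C * GX x)%:E * (GY y)%:E))%E).
      apply: ge0_le_integral => //.
      + apply: measurableT_comp => //; apply/measurable_EFinP.
        exact: (measurableT_comp mf (measurable_pair1 x)).
      + apply/measurable_EFinP; exact: measurable_funM.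
      + by move=> y _; rewrite /= lee_fin -mulrA.
    have -> : (C * (\int[nu]_y GY y) * GX x)%:E =
        ((C * GX x)%:E * \int[nu]_y (GY y)%:E)%E.
      by rewrite mulrAC EFinM /Rintegral fineK//; exact: integrable_fin_num.
    by rewrite integralZl.
under eq_integral do rewrite EFinM.
rewrite integralZl// -[X in (_ * X)%E]fineK ?ltry//.
exact: (integrable_fin_num _ iX).
Qed.

Lemma sub_mul_env (C a b : R) : 0 <= C -> 0 <= a -> b <= 1 ->
  C * (a * b) <= C * a.
Proof.
move=> C0 a0 b1; rewrite ler_wpM2l//.
by rewrite -[leRHS]mulr1 ler_wpM2l.
Qed.

Lemma dominated2_sect1 f y : dominated2 f -> dominated GX (f ^~ y).
Proof.
case: (eX) => mX X01 iX; case: (eY) => mY Y01 iY [mf [C C0 fC]].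
split; first exact: (measurableT_comp mf (measurable_pair2 y)).
exists C => // x; rewrite (le_trans (fC x y))// sub_mul_env//.
  by case/andP: (X01 x).
by case/andP: (Y01 y).
Qed.

Lemma dominated2_sect2 f x : dominated2 f -> dominated GY (f x).
Proof.
case: (eX) => mX X01 iX; case: (eY) => mY Y01 iY [mf [C C0 fC]].
split; first exact: (measurableT_comp mf (measurable_pair1 x)).
exists C => // y; rewrite (le_trans (fC x y))// mulrC (mulrC (GX x)) mulrC sub_mul_env//.
  by case/andP: (Y01 y).
by case/andP: (X01 x).
Qed.

Lemma dominated2_int1 f : dominated2 f ->
  dominated GY (fun y => \int[mu]_x f x y).
Proof.
move=> df; case: (eX) => mX X01 iX; case: (eY) => mY Y01 iY.
have [mf [C C0 fC]] := df.
split.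
  have := measurable_fubini_G (dominated2_integrable df).
  by move=> /(measurableT_comp (@fine_measurable R setT measurableT)); apply.
exists (C * \int[mu]_x GX x).
  by rewrite mulr_ge0//; apply: Rintegral_ge0 => x _; case/andP: (X01 x).
move=> y; rewrite mulrAC (int_le eX)//.
- by rewrite mulr_ge0//; case/andP: (Y01 y).
- exact: dominated2_sect1.
- by move=> x; rewrite -mulrA (mulrC (GY y)).
Qed.

Lemma dominated2_int2 f : dominated2 f ->
  dominated GX (fun x => \int[nu]_y f x y).
Proof.
move=> df; case: (eX) => mX X01 iX; case: (eY) => mY Y01 iY.
have [mf [C C0 fC]] := df.
split.
  have := measurable_fubini_F (dominated2_integrable df).
  by move=> /(measurableT_comp (@fine_measurable R setT measurableT)); apply.
exists (C * \int[nu]_y GY y).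
  by rewrite mulr_ge0//; apply: Rintegral_ge0 => x _; case/andP: (Y01 x).
move=> x; rewrite mulrAC (int_le eY)//.
- by rewrite mulr_ge0//; case/andP: (X01 x).
- exact: dominated2_sect2.
- by move=> y; rewrite -mulrA.
Qed.

(** The real-valued inner integrals agree with the extended ones only if every section is
    integrable, not just almost every one; the pointwise bound by [GX x * GY y] provides this. *)
Lemma int_fubini f : dominated2 f ->
  \int[mu]_x \int[nu]_y f x y = \int[nu]_y \int[mu]_x f x y.
Proof.
move=> df; rewrite /Rintegral.
have := Fubini (dominated2_integrable df) => /= h.
congr fine; transitivity (\int[mu]_x \int[nu]_y (f x y)%:E)%E.
  apply: eq_integral => x _; rewrite fineK//.
  by apply: integrable_fin_num => //; apply: (dominated_integrable eY); exact: dominated2_sect2.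
rewrite h; apply: eq_integral => y _; rewrite fineK//.
by apply: integrable_fin_num => //; apply: (dominated_integrable eX); exact: dominated2_sect1.
Qed.

Lemma int_prod f : dominated2 f ->
  fine (\int[(mu \x nu)%E]_p (f p.1 p.2)%:E)%E = \int[mu]_x \int[nu]_y f x y.
Proof.
move=> df; have := integral12_prod_meas1 (dominated2_integrable df) => <-.
congr fine; apply: eq_integral => x _; rewrite fineK//.
by apply: integrable_fin_num => //; apply: (dominated_integrable eY); exact: dominated2_sect2.
Qed.

Lemma dominated2D f g : dominated2 f -> dominated2 g ->
  dominated2 (fun x y => f x y + g x y).
Proof.
move=> [mf [C C0 fC]] [mg [D D0 gD]]; split.
  exact: (measurable_funD mf mg).
exists (C + D); first exact: addr_ge0.
by move=> x y; rewrite mulrDl (le_trans (ler_normD _ _))// lerD.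
Qed.

Lemma dominated2Z c f : dominated2 f -> dominated2 (fun x y => c * f x y).
Proof.
move=> [mf [C C0 fC]]; split.
  by apply: measurable_funM.
exists (`|c| * C); first exact: mulr_ge0.
by move=> x y; rewrite normrM -mulrA ler_wpM2l.
Qed.

Lemma dominated2B f g : dominated2 f -> dominated2 g ->
  dominated2 (fun x y => f x y - g x y).
Proof.
move=> df /(dominated2Z (-1)) dg; have := dominated2D df dg.
by under eq_fun => x do under eq_fun => y do rewrite mulN1r.
Qed.

Lemma dominated2M f g : dominated2 f -> dominated2 g ->
  dominated2 (fun x y => f x y * g x y).
Proof.
case: (eX) => mX X01 iX; case: (eY) => mY Y01 iY.
move=> [mf [C C0 fC]] [mg [D D0 gD]]; split.
  exact: (measurable_funM mf mg).
exists (C * D); first exact: mulr_ge0.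
move=> x y; rewrite normrM.
have /andP[X0 X1] := X01 x; have /andP[Y0 Y1] := Y01 y.
apply: (@le_trans _ _ (C * (GX x * GY y) * (D * (GX x * GY y)))).
  exact: ler_pM.
by rewrite mulrACA sub_mul_env ?mulr_ge0// mulr_ile1.
Qed.

Lemma dominated2_prod f g : dominated GX f -> dominated GY g ->
  dominated2 (fun x y => f x * g y).
Proof.
case: (eX) => mX X01 iX; case: (eY) => mY Y01 iY.
move=> [mf [C C0 fC]] [mg [D D0 gD]]; split.
  apply: measurable_funM; first exact: (measurableT_comp mf measurable_fst).
  exact: (measurableT_comp mg measurable_snd).
exists (C * D); first exact: mulr_ge0.
by move=> x y; rewrite normrM mulrACA ler_pM.
Qed.

Lemma dominated2Ml e f : dominated GX e -> dominated2 f ->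
  dominated2 (fun x y => e x * f x y).
Proof.
case: (eX) => mX X01 iX; case: (eY) => mY Y01 iY.
move=> [mf [C C0 fC]] [mg [D D0 gD]]; split.
  by apply: measurable_funM => //; exact: (measurableT_comp mf measurable_fst).
exists (C * D); first exact: mulr_ge0.
move=> x y; rewrite normrM -mulrA ler_pM//.
have /andP[X0 X1] := X01 x.
by rewrite (le_trans (fC _))// -[leRHS]mulr1 ler_wpM2l.
Qed.

Lemma dominated2Mr e f : dominated GY e -> dominated2 f ->
  dominated2 (fun x y => e y * f x y).
Proof.
case: (eX) => mX X01 iX; case: (eY) => mY Y01 iY.
move=> [mf [C C0 fC]] [mg [D D0 gD]]; split.
  by apply: measurable_funM => //; exact: (measurableT_comp mf measurable_snd).
exists (C * D); first exact: mulr_ge0.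
move=> x y; rewrite normrM -mulrA ler_pM//.
have /andP[X0 X1] := Y01 y.
by rewrite (le_trans (fC _))// -[leRHS]mulr1 ler_wpM2l.
Qed.

(** With [P_f] the projection on [f] in the second variable ([al] is the inverse squared norm of
    [f]) and [P_e] the one on the [e j] in the first, this says that (1 - P_e)(1 - P_f) is a
    nonnegative form. It follows by applying Bessel in the first variable to each section of (1 -
    P_f) [phi] and integrating over the second. *)
Lemma tensor_bessel (J : finType) (e : J -> X -> R) (a : J -> R) (f : Y -> R)
    (al : R) (phi : X -> Y -> R) :
  (forall j, dominated GX (e j)) -> dominated GY f ->
  al * \int[nu]_y (f y * f y) = 1 ->
  (forall psi, dominated GX psi ->
    \sum_j a j * (\int[mu]_x (e j x * psi x)) ^+ 2 <=
    \int[mu]_x (psi x * psi x)) ->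
  dominated2 phi ->
  \sum_j a j * (\int[nu]_y (\int[mu]_x (e j x * phi x y)) ^+ 2 -
    al * (\int[nu]_y (f y * \int[mu]_x (e j x * phi x y))) ^+ 2) <=
  \int[nu]_y \int[mu]_x (phi x y * phi x y) -
  al * \int[mu]_x (\int[nu]_y (f y * phi x y)) ^+ 2.
Proof.
move=> de df alf bes dphi.
pose p j y := \int[mu]_x (e j x * phi x y).
pose P x := \int[nu]_y (f y * phi x y).
have dp j : dominated GY (p j) by apply/dominated2_int1/dominated2Ml.
have dP : dominated GX P by apply/dominated2_int2/dominated2Mr.
(* The part of [phi] orthogonal to [f] in the second variable. *)
pose psi x y := phi x y - al * (P x * f y).
have dPf : dominated2 (fun x y => P x * f y) by exact: dominated2_prod.
have dpsi : dominated2 psi by apply: dominated2B => //; exact: dominated2Z.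
have dff : dominated GY (fun y => f y * f y) by exact: (dominatedM eY).
pose c j := \int[nu]_y (f y * p j y).
have cE j : \int[mu]_x (e j x * P x) = c j.
  rewrite /c /P /p.
  transitivity (\int[mu]_x \int[nu]_y (f y * (e j x * phi x y))).
    apply: eq_Rintegral => x _.
    rewrite -(intZ eY); last first.
      by apply: (dominatedM eY df); exact: dominated2_sect2.
    by apply: eq_Rintegral => y _; ring.
  rewrite int_fubini; last by apply: dominated2Mr => //; exact: dominated2Ml.
  apply: eq_Rintegral => y _; rewrite (intZ eX)//.
  by apply: (dominatedM eX) => //; exact: dominated2_sect1.
have dpsi2 : dominated2 (fun x y => psi x y * psi x y) by exact: dominated2M.
have dphi2 : dominated2 (fun x y => phi x y * phi x y) by exact: dominated2M.
have epsi j y : \int[mu]_x (e j x * psi x y) = p j y - al * c j * f y.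
  have dep : dominated GX (fun x => e j x * phi x y).
    by apply: (dominatedM eX) => //; exact: dominated2_sect1.
  have deP : dominated GX (fun x => e j x * P x) by exact: (dominatedM eX).
  rewrite -cE mulrAC -(intZ eX)// -(intB eX)//; last exact: dominatedZ.
  by apply: eq_Rintegral => x _; rewrite /psi; ring.
have lhs j : \int[nu]_y (\int[mu]_x (e j x * psi x y)) ^+ 2 =
    \int[nu]_y (p j y) ^+ 2 - al * c j ^+ 2.
  have dfp : dominated GY (fun y => f y * p j y) by exact: (dominatedM eY).
  have dpp : dominated GY (fun y => p j y * p j y) by exact: (dominatedM eY).
  transitivity (\int[nu]_y (p j y * p j y - (2 * al * c j) * (f y * p j y) +
      (al * c j) ^+ 2 * (f y * f y))).
    by apply: eq_Rintegral => y _; rewrite epsi; ring.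
  rewrite (intD eY) ?(intB eY) ?(intZ eY)//.
  - by rewrite -/(c j); have -> : (al * c j) ^+ 2 * \int[nu]_y (f y * f y) =
      al * c j ^+ 2 * (al * \int[nu]_y (f y * f y)); [ring|rewrite alf; ring].
  - exact: dominatedZ.
  - by apply: dominatedB => //; exact: dominatedZ.
  - exact: dominatedZ.
have rhs : \int[nu]_y \int[mu]_x (psi x y * psi x y) =
    \int[nu]_y \int[mu]_x (phi x y * phi x y) - al * \int[mu]_x P x ^+ 2.
  rewrite -int_fubini// -int_fubini//.
  have dPP : dominated GX (fun x => P x ^+ 2) by exact: (dominatedM eX).
  rewrite -(intZ eX)// -(intB eX)//; last 2 first.
  - exact: dominated2_int2.
  - exact: dominatedZ.
  apply: eq_Rintegral => x _.
  have dfp : dominated GY (fun y => f y * phi x y).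
    by apply: (dominatedM eY) => //; exact: dominated2_sect2.
  have dpp : dominated GY (fun y => phi x y * phi x y).
    by apply: (dominatedM eY); exact: dominated2_sect2.
  transitivity (\int[nu]_y (phi x y * phi x y - (2 * al * P x) * (f y * phi x y) +
      (al * P x) ^+ 2 * (f y * f y))).
    by apply: eq_Rintegral => y _; rewrite /psi; ring.
  rewrite (intD eY) ?(intB eY) ?(intZ eY)//.
  - by rewrite -/(P x); have -> : (al * P x) ^+ 2 * \int[nu]_y (f y * f y) =
      al * P x ^+ 2 * (al * \int[nu]_y (f y * f y)); [ring|rewrite alf; ring].
  - exact: dominatedZ.
  - by apply: dominatedB => //; exact: dominatedZ.
  - exact: dominatedZ.
(* Both sides are now integrals over [y] of the two sides of Bessel's inequality for the section of
   [psi] at [y]. *)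
rewrite -rhs; under eq_bigr do rewrite -lhs.
have dep j : dominated GY (fun y => a j * (\int[mu]_x (e j x * psi x y)) ^+ 2).
  apply: dominatedZ; apply: (dominatedM eY); apply: dominated2_int1;
    exact: dominated2Ml.
rewrite [leLHS](_ : _ = \int[nu]_y
   \sum_j a j * (\int[mu]_x (e j x * psi x y)) ^+ 2); last first.
  rewrite (int_sum eY)//; apply: eq_bigr => j _; rewrite (intZ eY)//.
  by apply: (dominatedM eY); apply: dominated2_int1; exact: dominated2Ml.
apply: (le_int eY).
- by apply: dominated_sum => j _.
- exact: dominated2_int1.
- by move=> y; apply: bes; exact: dominated2_sect1.
Qed.

End product.

(** * One-dimensional gaps *)

Section cvg_int.
Context d (T : measurableType d) (R : realType) (mu : {measure set T -> \bar R}).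

Lemma cvg_int (f_ : nat -> T -> R) (f g : T -> R) :
  (forall n, measurable_fun setT (f_ n)) -> measurable_fun setT f ->
  (forall x, f_ n x @[n --> \oo] --> f x) ->
  mu.-integrable setT (EFin \o g) ->
  (forall n x, `|f_ n x| <= g x) ->
  \int[mu]_x f_ n x @[n --> \oo] --> \int[mu]_x f x.
Proof.
move=> mf_ mf ff ig fg.
have [iF _ h] := @dominated_convergence _ _ _ mu _ measurableT
  (fun n => EFin \o f_ n) (EFin \o f) (EFin \o g)
  (fun n => (measurable_EFinP _ _).2 (mf_ n)) ((measurable_EFinP _ _).2 mf)
  ltac:(by apply: aeW => x _; apply: cvg_EFin; [exact: nearW|exact: ff])
  ig ltac:(by apply: aeW => x n _ /=; rewrite lee_fin).
have : (\int[mu]_x (f x)%:E)%E \is a fin_num by exact: integrable_fin_num.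
by move=> ff'; apply: fine_cvg; rewrite fineK.
Qed.

Lemma Rintegral_supp (D : set T) (f : T -> R) :
  (forall x, ~ D x -> f x = 0) -> \int[mu]_x f x = \int[mu]_(x in D) f x.
Proof.
move=> f0; rewrite [RHS]Rintegral_mkcond; apply: eq_Rintegral => x _.
by rewrite patchE; case: ifPn => // /negP xD; apply: f0 => Dx; apply: xD; rewrite in_setE.
Qed.

Variable G : T -> R.
Hypothesis envG : envelope mu G.

(** The weight [a j] plays the inverse squared norm of [e j]. The condition on it is written so that
    it also holds for a zero [e j] with [a j = 0], which happens for the excited state on the half
    line. *)
Lemma bessel (J : finType) (e : J -> T -> R) (a : J -> R) :
  (forall j, dominated G (e j)) ->
  (forall i j, i != j -> \int[mu]_x (e i x * e j x) = 0) ->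
  (forall j, a j ^+ 2 * \int[mu]_x (e j x * e j x) = a j) ->
  forall psi, dominated G psi ->
  \sum_j a j * (\int[mu]_x (e j x * psi x)) ^+ 2 <= \int[mu]_x (psi x * psi x).
Proof.
move=> de oe ae psi dpsi.
pose c j := \int[mu]_x (e j x * psi x).
pose S x := \sum_j a j * c j * e j x.
have dS : dominated G S by apply: dominated_sum => j _; exact: dominatedZ.
have dee i j : dominated G (fun x => e i x * e j x) by exact: (dominatedM envG).
have dep j : dominated G (fun x => e j x * psi x) by exact: (dominatedM envG).
have dpp : dominated G (fun x => psi x * psi x) by exact: (dominatedM envG).
have dSp : dominated G (fun x => S x * psi x) by exact: (dominatedM envG).
have dSS : dominated G (fun x => S x * S x) by exact: (dominatedM envG).
have dSe j : dominated G (fun x => S x * e j x) by exact: (dominatedM envG).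
have Sp : \int[mu]_x (S x * psi x) = \sum_j a j * c j ^+ 2.
  transitivity (\int[mu]_x \sum_j a j * c j * (e j x * psi x)).
    apply: eq_Rintegral => x _; rewrite mulr_suml.
    by apply: eq_bigr => j _; ring.
  rewrite (int_sum envG) => [|j _]; last exact: dominatedZ.
  by apply: eq_bigr => j _; rewrite (intZ envG)// -/(c j); ring.
have Se j : \int[mu]_x (S x * e j x) = a j * c j * \int[mu]_x (e j x * e j x).
  transitivity (\int[mu]_x \sum_i a i * c i * (e i x * e j x)).
    apply: eq_Rintegral => x _; rewrite mulr_suml.
    by apply: eq_bigr => i _; ring.
  rewrite (int_sum envG) => [|i _]; last exact: dominatedZ.
  rewrite (bigD1 j)//= (intZ envG)// big1 ?addr0// => i ij.
  by rewrite (intZ envG)// oe// mulr0.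
have SS : \int[mu]_x (S x * S x) = \sum_j a j * c j ^+ 2.
  transitivity (\int[mu]_x \sum_j a j * c j * (S x * e j x)).
    apply: eq_Rintegral => x _; rewrite [in X in _ * X]/S mulr_sumr.
    by apply: eq_bigr => j _; ring.
  rewrite (int_sum envG) => [|j _]; last exact: dominatedZ.
  apply: eq_bigr => j _; rewrite (intZ envG)// Se -[in RHS](ae j); ring.
rewrite -subr_ge0.
(* The defect in Bessel's inequality is the squared norm of [psi] minus its projection [S]. *)
have -> : \int[mu]_x (psi x * psi x) - \sum_j a j * c j ^+ 2 =
    \int[mu]_x ((psi x - S x) * (psi x - S x)).
  transitivity (\int[mu]_x ((psi x * psi x - 2 * (S x * psi x)) + S x * S x)).
    rewrite (intD envG) ?(intB envG) ?(intZ envG)// ?Sp ?SS; first by ring.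
    - exact: dominatedZ.
    - by apply: dominatedB => //; exact: dominatedZ.
  by apply: eq_Rintegral => x _; ring.
by apply: int_ge0 => x; rewrite -expr2 sqr_ge0.
Qed.

End cvg_int.

(** * Primitives on an interval and automated continuity *)

Section calculus.
Context {R : realType}.
Notation mu := (@lebesgue_measure R).
Implicit Types (f F : R -> R) (a b c l : R).

Lemma int_derive F f a b : a < b ->
  (forall x, a <= x <= b -> is_derive x 1 F (f x)) ->
  (forall x, a <= x <= b -> {for x, continuous f}) ->
  \int[mu]_(x in `[a, b]) f x = F b - F a.
Proof.
move=> ab dF cf.
have cF x : a <= x <= b -> {for x, continuous F}.
  by move=> /dF [dFx _]; apply/differentiable_continuous/derivable1_diffP.
rewrite /Rintegral (@continuous_FTC2 _ f F)//.
- apply: continuous_in_subspaceT => x; rewrite inE/= in_itv/=; exact: cf.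
- split.
  + move=> x; rewrite in_itv/= => /andP[ax xb].
    by have [] := dF x; rewrite ?(ltW ax) ?(ltW xb).
  + by apply: cvg_at_right_filter; apply: cF; rewrite lexx ltW.
  + by apply: cvg_at_left_filter; apply: cF; rewrite lexx ltW.
- move=> x; rewrite in_itv/= => /andP[ax xb].
  by rewrite derive1E; have [] := dF x; rewrite ?(ltW ax) ?(ltW xb).
Qed.

Lemma continuous_integrable f a b :
  (forall x, a <= x <= b -> {for x, continuous f}) ->
  mu.-integrable `[a, b] (EFin \o f).
Proof.
move=> cf; apply: continuous_compact_integrable; first exact: segment_compact.
by apply: continuous_in_subspaceT => x; rewrite inE/= in_itv/=; exact: cf.
Qed.

(** The primitive starts at [c], to the left of the interval where it will be used, so that its
    derivative is two-sided even at the left end of that interval. *)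
Lemma ex_antiderivative f l c : l < c ->
  (forall x, l < x -> {for x, continuous f}) ->
  exists F, forall x, c < x -> is_derive x 1 F (f x).
Proof.
move=> lc cf; exists (fun x => \int[mu]_(t in `[c, x]) f t) => x cx.
have [] := @continuous_FTC1_closed _ f c x (x + 1) _ _ cx.
- by rewrite ltrDl.
- by apply: continuous_integrable => y /andP[cy _]; apply: cf; exact: lt_le_trans cy.
- by apply: cf; exact: lt_trans cx.
by move=> h1 h2; split; [exact: h1|rewrite -derive1E; exact: h2].
Qed.

Definition gs (x : R) : R := expR (- (x ^+ 2 / 2)).

Lemma gs_gt0 x : 0 < gs x. Proof. exact: expR_gt0. Qed.

Lemma is_derive_gs (x : R) : is_derive x 1 gs (- x * gs x).
Proof. by rewrite /gs; apply: is_derive_eq; rewrite /GRing.scale /=; field. Qed.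

Lemma continuous_gs : continuous gs.
Proof.
move=> x; apply/differentiable_continuous/derivable1_diffP.
by have [] := is_derive_gs x.
Qed.

Lemma continuous_inv (x : R) : 0 < x -> {for x, continuous (fun y : R => y^-1)}.
Proof. by move=> x0; apply: inv_continuous; rewrite gt_eqF. Qed.

Lemma is_derive_continuous (f : R -> R) (x l : R) :
  is_derive x 1 f l -> {for x, continuous f}.
Proof. by case=> df _; apply/differentiable_continuous/derivable1_diffP. Qed.

(** A named head for pointwise continuity, on which the tactic below can match the shape of the
    function syntactically. *)
Definition cont_at (f : R -> R) (x : R) := {for x, continuous f}.

Lemma cont_atD f g x : cont_at f x -> cont_at g x ->
  cont_at (fun y => f y + g y) x.
Proof. exact: cvgD. Qed.

Lemma cont_atN f x : cont_at f x -> cont_at (fun y => - f y) x.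
Proof. exact: cvgN. Qed.

Lemma cont_atM f g x : cont_at f x -> cont_at g x ->
  cont_at (fun y => f y * g y) x.
Proof. exact: cvgM. Qed.

Lemma cont_at_cst c x : cont_at (fun=> c) x.
Proof. exact: cvg_cst. Qed.

Lemma cont_at_id x : cont_at (fun y => y) x.
Proof. exact: cvg_id. Qed.

Lemma cont_at_derive f (x l : R) : is_derive x 1 f l -> cont_at f x.
Proof. exact: is_derive_continuous. Qed.

Lemma cont_at_gs x : cont_at gs x.
Proof. exact: continuous_gs. Qed.

Lemma cont_at_inv x : 0 < x -> cont_at (fun y => y^-1) x.
Proof. exact: continuous_inv. Qed.

Lemma cont_at_intro f x : cont_at f x -> {for x, continuous f}.
Proof. by []. Qed.

End calculus.

(** Leaves are closed by continuity or derivative facts found in the context; this is why calls are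
    preceded by instances such as [have dux := duu x]. *)
Ltac cvg_go := lazymatch goal with
  | |- cont_at (fun y => GRing.add (@?a y) (@?b y)) ?x =>
      refine (@cont_atD _ a b x _ _); cvg_go
  | |- cont_at (fun y => GRing.mul (@?a y) (@?b y)) ?x =>
      refine (@cont_atM _ a b x _ _); cvg_go
  | |- cont_at (fun y => GRing.opp (@?a y)) ?x =>
      refine (@cont_atN _ a x _); cvg_go
  | |- _ => first [assumption | eapply cont_at_derive; eassumption
      | exact: cont_at_cst | exact: cont_at_id | exact: cont_at_gs
      | apply: cont_at_inv; assumption]
  end.
Ltac cvg_tac := apply: cont_at_intro; cvg_go.

(** * Spectral gaps on a bounded interval by completing squares *)

Section interval_gaps.
Context {R : realType}.
Notation mu := (@lebesgue_measure R).
Implicit Types (f F : R -> R) (a b c l : R).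

(* With [w = x exp(-x^2/2)] and [f = - (1/w) int_e^x w v], which vanishes at both
   ends, one has [v = - f' + (x - 1/x) f]; the integrand below differs from
   [(A v)^2 - 4 v^2] by the squares of [A v - 4 f] and [f' + (x - 2/x) f], up to
   the derivative of [8 v f - 4 (2 x - 3/x) f^2]. *)
Lemma half_line_interval (e M : R) (v dv : R -> R) : 0 < e -> e < M ->
  (forall x : R, 0 < x -> is_derive x 1 v (dv x)) ->
  (forall x : R, 0 < x -> {for x, continuous dv}) ->
  \int[mu]_(x in `[e, M]) (x * gs x * v x) = 0 ->
  4 * \int[mu]_(x in `[e, M]) (v x * v x) <=
  \int[mu]_(x in `[e, M]) ((dv x + (x - x^-1) * v x) * (dv x + (x - x^-1) * v x)).
Proof.
move=> e0 eM dvv cdv orth.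
have e20 : 0 < e / 2 by rewrite divr_gt0.
have e2e : e / 2 < e by rewrite ltr_pdivrMr// ltr_pMr// ltr1n.
have [H dH] := @ex_antiderivative R (fun x => x * gs x * v x) 0 (e / 2) e20
  ltac:(move=> x x0; have dvx := dvv x x0; cvg_tac).
(* Orthogonality to the ground state says exactly that its primitive against [v] returns to its
   initial value. *)
have HM : H M = H e.
  have := @int_derive R H (fun x => x * gs x * v x) e M eM.
  rewrite orth => h; apply/eqP; rewrite -subr_eq0; apply/eqP/esym/h.
    by move=> x /andP[ex _]; apply: dH; exact: lt_le_trans ex.
  move=> x /andP[ex _]; have x0 : 0 < x by exact: lt_le_trans ex.
  by have dvx := dvv x x0; cvg_tac.
pose f x := - (H x - H e) * (x^-1 * expR (x * x / 2)).
have fe : f e = 0 by rewrite /f subrr oppr0 mul0r.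
have fM : f M = 0 by rewrite /f HM subrr oppr0 mul0r.
have df x : e <= x -> is_derive x 1 f (- v x + (x - x^-1) * f x).
  move=> ex; have x0 : 0 < x by exact: lt_le_trans ex.
  have x0' : x != 0 by rewrite gt_eqF.
  have dHx := dH x (lt_le_trans e2e ex).
  have dV : is_derive x 1 (fun y : R => y^-1) (- (x^-1 * x^-1)).
    have := @is_deriveV R id x 1 1 x0' _ => h.
    by apply: is_derive_eq; rewrite /GRing.scale/= expr2 invfM mulr1.
  rewrite /f; apply: is_derive_eq; rewrite /GRing.scale /= /gs.
  rewrite (_ : x ^+ 2 / 2 = x * x / 2)// expRN.
  have := expR_gt0 (x * x / 2); set E := expR _ => E0.
  by field; rewrite x0' gt_eqF.
pose A x := dv x + (x - x^-1) * v x.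
pose B x := - v x + (x - x^-1) * f x + (x - 2 * x^-1) * f x.
pose g x := A x * A x - 4 * (v x * v x) - (A x - 4 * f x) * (A x - 4 * f x) -
  4 * (B x * B x).
pose Gf x := 8 * (v x * f x) - 4 * ((2 * x - 3 * x^-1) * (f x * f x)).
have dG x : e <= x <= M -> is_derive x 1 Gf (g x).
  move=> /andP[ex _]; have x0 : 0 < x by exact: lt_le_trans ex.
  have x0' : x != 0 by rewrite gt_eqF.
  have dfx := df x ex; have dvx := dvv x x0.
  have dV : is_derive x 1 (fun y : R => y^-1) (- (x^-1 * x^-1)).
    have := @is_deriveV R id x 1 1 x0' _ => h.
    by apply: is_derive_eq; rewrite /GRing.scale/= expr2 invfM mulr1.
  rewrite /Gf; apply: is_derive_eq; rewrite /g /B /A /GRing.scale /=.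
  by field.
have cA x : e <= x <= M -> {for x, continuous A}.
  move=> /andP[ex _]; have x0 : 0 < x by exact: lt_le_trans ex.
  have dvx := dvv x x0; have cdvx := cdv x x0; rewrite /A.
  by cvg_tac.
have cv x : e <= x <= M -> {for x, continuous v}.
  move=> /andP[ex _]; have x0 : 0 < x by exact: lt_le_trans ex.
  by have dvx := dvv x x0; cvg_tac.
have cf x : e <= x <= M -> {for x, continuous f}.
  by move=> /andP[ex _]; have dfx := df x ex; cvg_tac.
have cg x : e <= x <= M -> {for x, continuous g}.
  move=> xx; have /andP[ex _] := xx; have x0 : 0 < x by exact: lt_le_trans ex.
  have cAx := cA x xx; have cvx := cv x xx; have cfx := cf x xx.
  by rewrite /g /B; cvg_tac.
have := int_derive eM dG cg; rewrite /Gf fe fM !mulr0 !subr0 => g0.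
have iA : mu.-integrable `[e, M] (EFin \o (fun x => A x * A x)).
  by apply: continuous_integrable => x xx; have cAx := cA x xx; cvg_tac.
have iv : mu.-integrable `[e, M] (EFin \o (fun x => v x * v x)).
  by apply: continuous_integrable => x xx; have cvx := cv x xx; cvg_tac.
have iv4 : mu.-integrable `[e, M] (EFin \o (fun x => 4 * (v x * v x))).
  by apply: continuous_integrable => x xx; have cvx := cv x xx; cvg_tac.
rewrite -subr_ge0 -RintegralZl// -RintegralB// -g0.
have iAv : mu.-integrable `[e, M] (EFin \o (fun x => A x * A x - 4 * (v x * v x))).
  apply: continuous_integrable => x xx; have cvx := cv x xx.
  by have cAx := cA x xx; cvg_tac.
apply: le_Rintegral => //; first exact: continuous_integrable.
move=> x _; rewrite /g -addrA gerDl -opprD oppr_le0 addr_ge0//.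
    by rewrite -expr2 sqr_ge0.
  by rewrite mulr_ge0// -expr2 sqr_ge0.
Qed.

(* The same device, used twice: [f] and [g] vanish at both ends and satisfy
   [v = - f' + x f], [f = - g' + x g]. *)
Lemma full_line_interval (M : R) (v dv : R -> R) : 0 < M ->
  (forall x : R, is_derive x 1 v (dv x)) -> continuous dv ->
  \int[mu]_(x in `[- M, M]) (gs x * v x) = 0 ->
  \int[mu]_(x in `[- M, M]) (x * gs x * v x) = 0 ->
  4 * \int[mu]_(x in `[- M, M]) (v x * v x) <=
  \int[mu]_(x in `[- M, M]) ((dv x + x * v x) * (dv x + x * v x)).
Proof.
move=> M0 dvv cdv orth0 orth1.
have eM : - M < M by rewrite gtrN.
pose l := - M - 2; pose c := - M - 1.
have lc : l < c by rewrite /l /c; lra.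
have ce : c < - M by rewrite /c; lra.
have [H dH] := @ex_antiderivative R (fun x => gs x * v x) l c lc
  ltac:(move=> x x0; have dvx := dvv x; cvg_tac).
have HM : H M = H (- M).
  have := @int_derive R H (fun x => gs x * v x) (- M) M eM.
  rewrite orth0 => h; apply/eqP; rewrite -subr_eq0; apply/eqP/esym/h.
    by move=> x /andP[ex _]; apply: dH; exact: lt_le_trans ex.
  by move=> x /andP[ex _]; have dvx := dvv x; cvg_tac.
(* The second primitive again starts to the left of [- M], at the midpoint of [c] and [- M], inside
   the region where [H] is differentiable. *)
have [K dK] := @ex_antiderivative R (fun x => - (H x - H (- M))) c
  ((c - M) / 2) ltac:(rewrite /c; lra)
  ltac:(move=> x x0; have dHx := dH x x0; cvg_tac).
have c2 : (c - M) / 2 < - M by rewrite /c; lra.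
(* Integration by parts: [P] is a primitive of [x * gs x * v x], so orthogonality to the first
   excited state makes the second primitive return to its initial value too. *)
have KM : K M = K (- M).
  pose P x := x * (H x - H (- M)) + K x.
  have := @int_derive R P (fun x => x * gs x * v x) (- M) M eM.
  rewrite orth1 /P HM !subrr !mulr0 !add0r => h.
  apply/eqP; rewrite -subr_eq0; apply/eqP/esym/h.
    move=> x /andP[ex _]; have dHx := dH x (lt_le_trans ce ex).
    have dKx := dK x (lt_le_trans c2 ex).
    by apply: is_derive_eq; rewrite /GRing.scale/=; ring.
  by move=> x /andP[ex _]; have dvx := dvv x; cvg_tac.
pose f x := - (H x - H (- M)) * expR (x * x / 2).
pose g x := - (K x - K (- M)) * expR (x * x / 2).
have fe : f (- M) = 0 by rewrite /f subrr oppr0 mul0r.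
have fM : f M = 0 by rewrite /f HM subrr oppr0 mul0r.
have ge : g (- M) = 0 by rewrite /g subrr oppr0 mul0r.
have gM : g M = 0 by rewrite /g KM subrr oppr0 mul0r.
have df x : - M <= x -> is_derive x 1 f (- v x + x * f x).
  move=> ex; have dHx := dH x (lt_le_trans ce ex).
  rewrite /f; apply: is_derive_eq; rewrite /GRing.scale /= /gs.
  rewrite (_ : x ^+ 2 / 2 = x * x / 2)// expRN.
  have := expR_gt0 (x * x / 2); set E := expR _ => E0.
  by field; rewrite gt_eqF.
have dg x : - M <= x -> is_derive x 1 g (- f x + x * g x).
  move=> ex; have dKx := dK x (lt_le_trans c2 ex).
  by rewrite /g; apply: is_derive_eq; rewrite /GRing.scale /= /f; field.
pose A x := dv x + x * v x.
pose B x := - v x + 2 * x * f x.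
pose C x := - f x + 2 * x * g x.
(* Here [B] is f' + x f and [C] is g' + x g. The coefficients are tuned so that [h] is the
   derivative of [Gf], which vanishes at both ends; the integral of A^2 - 4 v^2 is then an integral
   of squares. *)
pose h x := A x * A x - 4 * (v x * v x) - (A x - 4 * f x) * (A x - 4 * f x) -
  4 * ((B x - 2 * g x) * (B x - 2 * g x)) - 8 * (C x * C x).
pose Gf x := 8 * (v x * f x) - 8 * (x * (f x * f x)) + 16 * (g x * f x) -
  16 * (x * (g x * g x)).
have dG x : - M <= x <= M -> is_derive x 1 Gf (h x).
  move=> /andP[ex _].
  have dfx := df x ex; have dgx := dg x ex; have dvx := dvv x.
  rewrite /Gf; apply: is_derive_eq; rewrite /h /C /B /A /GRing.scale /=.
  by field.
have cA x : - M <= x <= M -> {for x, continuous A}.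
  move=> /andP[ex _].
  have dvx := dvv x; have cdvx := cdv x; rewrite /A.
  by cvg_tac.
have cv x : {for x, continuous v}.
  by have dvx := dvv x; cvg_tac.
have cf x : - M <= x <= M -> {for x, continuous f}.
  by move=> /andP[ex _]; have dfx := df x ex; cvg_tac.
have cg x : - M <= x <= M -> {for x, continuous g}.
  by move=> /andP[ex _]; have dgx := dg x ex; cvg_tac.
have ch x : - M <= x <= M -> {for x, continuous h}.
  move=> xx; have cgx := cg x xx.
  have cAx := cA x xx; have cvx := cv x; have cfx := cf x xx.
  by rewrite /h /C /B; cvg_tac.
have := int_derive eM dG ch; rewrite /Gf fe fM ge gM !(mulr0, subr0, addr0) => g0.
have iA : mu.-integrable `[- M, M] (EFin \o (fun x => A x * A x)).
  by apply: continuous_integrable => x xx; have cAx := cA x xx; cvg_tac.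
have iv : mu.-integrable `[- M, M] (EFin \o (fun x => v x * v x)).
  by apply: continuous_integrable => x xx; have cvx := cv x; cvg_tac.
have iv4 : mu.-integrable `[- M, M] (EFin \o (fun x => 4 * (v x * v x))).
  by apply: continuous_integrable => x xx; have cvx := cv x; cvg_tac.
rewrite -subr_ge0 -RintegralZl// -RintegralB// -g0.
have iAv : mu.-integrable `[- M, M] (EFin \o (fun x => A x * A x - 4 * (v x * v x))).
  apply: continuous_integrable => x xx; have cvx := cv x.
  by have cAx := cA x xx; cvg_tac.
apply: le_Rintegral => //; first exact: continuous_integrable.
move=> x _; rewrite /h -!addrA lerD2l gerDl -!opprD oppr_le0.
have sq (z : R) : 0 <= z * z by rewrite -expr2 sqr_ge0.
by rewrite addr_ge0 ?sq// addr_ge0// mulr_ge0 ?sq.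
Qed.

End interval_gaps.

(** * From the interval to compactly supported functions, with truncated norms *)

Section one_dim.
Context {R : realType}.
Notation mu := (@lebesgue_measure R).

(** The square root of [gs]: one factor absorbs polynomial growth and the other remains as
    envelope. *)
Definition env1 (x : R) : R := expR (- (x ^+ 2 / 4)).

Lemma env1_gt0 x : 0 < env1 x. Proof. exact: expR_gt0. Qed.

Lemma env1_le1 x : env1 x <= 1.
Proof. by rewrite /env1 -expR0 ler_expR oppr_le0 divr_ge0// sqr_ge0. Qed.

Lemma gs_env1 (x : R) : gs x = env1 x * env1 x.
Proof. by rewrite /gs /env1 -expRD; congr expR; field. Qed.

Lemma norm_env1_le1 (x : R) : `|x| * env1 x <= 1.
Proof.
rewrite /env1 expRN ler_pdivrMr ?expR_gt0// mul1r.
apply: le_trans (expR_ge1Dx _).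
rewrite -(real_normK (num_real x)); set y := `|x|.
have := sqr_ge0 (y / 2 - 1); lra.
Qed.

(** Up to a constant this is the normal density of variance 2, whence its integrability. *)
Lemma envelope_env1 : envelope mu env1.
Proof.
split.
- by apply: measurableT_comp => //; apply: measurableT_comp => //;
    exact: measurable_funM.
- by move=> x; rewrite ltW ?env1_gt0// env1_le1.
- have s0 : Num.sqrt 2 != 0 :> R by rewrite gt_eqF// sqrtr_gt0.
  have := @integrable_normal_pdf R 0 (Num.sqrt 2).
  rewrite normal_pdfE// => h.
  have h2 := integrableZl measurableT (normal_peak (Num.sqrt 2))^-1 h.
  apply: eq_integrable h2 => // x _ /=.
  rewrite -EFinM mulKf ?gt_eqF ?normal_peak_gt0//.
  rewrite /normal_fun /env1 subr0 sqr_sqrtr//; congr (expR _)%:E; by field.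
Qed.

(* [h] selects the half line (0, +oo), where the excited state is not needed and is
   replaced by 0. *)
Definition w0 (h : bool) (x : R) : R :=
  if h then (if 0 < x then x * gs x else 0) else gs x.
Definition w1 (h : bool) (x : R) : R := if h then 0 else x * gs x.

Lemma measurable_gs : measurable_fun setT (@gs R).
Proof. by apply: continuous_measurable_fun; exact: continuous_gs. Qed.

Lemma dominated_w0 h : dominated env1 (w0 h).
Proof.
have mg := measurable_gs.
split.
  case: h; rewrite /w0 => //; apply: measurable_fun_ifT => //.
    exact: measurable_fun_ltr.
  exact: measurable_funM.
exists 1 => // x; rewrite mul1r /w0; case: h.
  case: ifP => x0; last by rewrite normr0 ltW// env1_gt0.
  rewrite normrM gs_env1 normrM mulrA (gtr0_norm (env1_gt0 x)).
  rewrite -[leRHS]mul1r ler_wpM2r ?(ltW (env1_gt0 _))//.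
  exact: norm_env1_le1.
rewrite gs_env1 normrM (gtr0_norm (env1_gt0 x)) -[leRHS]mul1r.
by rewrite ler_wpM2r ?env1_le1 ?(ltW (env1_gt0 _)).
Qed.

Lemma dominated_w1 h : dominated env1 (w1 h).
Proof.
have mg := measurable_gs.
case: h; first exact: dominated0.
split; first exact: measurable_funM.
exists 1 => // x; rewrite mul1r /w1.
rewrite normrM gs_env1 normrM mulrA (gtr0_norm (env1_gt0 x)).
rewrite -[leRHS]mul1r ler_wpM2r ?(ltW (env1_gt0 _))//.
exact: norm_env1_le1.
Qed.

(** Dominated convergence with [|f|] as bound. Only the points where [f] is nonzero have to be
    reached, so intervals exhausting the half line suffice for [w0 true]. *)
Lemma int_exhaust (f : R -> R) (a b : nat -> R) :
  mu.-integrable setT (EFin \o f) ->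
  (forall x, f x != 0 -> \forall n \near \oo, a n <= x <= b n) ->
  \int[mu]_(x in `[a n, b n]) f x @[n --> \oo] --> \int[mu]_x f x.
Proof.
move=> intf fab.
have mf : measurable_fun setT f by case/integrableP : intf => /measurable_EFinP.
under eq_fun do rewrite Rintegral_mkcond.
apply: (@cvg_int _ _ _ mu _ _ (fun x => `|f x|)) => //.
- by move=> n; apply/measurable_restrict => //; exact: measurable_funTS.
- move=> x; have [fx|fx] := eqVneq (f x) 0.
    rewrite fx (_ : (fun n => _) = cst 0); first exact: cvg_cst.
    by apply/funext => n; rewrite patchE fx if_same.
  apply: cvg_near_cst; near=> n.
  rewrite patchE mem_set//= in_itv/=.
  by near: n; exact: fab.
- exact: (integrable_norm intf).
- by move=> n x; rewrite patchE; case: ifP => // _; rewrite normr0.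
Unshelve. all: by end_near. Qed.

Lemma Rintegral_itv (a b : R) (f : R -> R) :
  (forall x, ~ (a < x < b) -> f x = 0) ->
  \int[mu]_x f x = \int[mu]_(x in `[a, b]) f x.
Proof.
move=> f0; apply: Rintegral_supp => x; rewrite /= in_itv/= => h; apply: f0.
by move=> /andP[ax xb]; apply: h; rewrite !ltW.
Qed.

Lemma Rintegral_itv_ge (a b c : R) (f : R -> R) : a < b ->
  mu.-integrable `[a, b] (EFin \o f) -> (forall x, a <= x <= b -> c <= f x) ->
  c * (b - a) <= \int[mu]_(x in `[a, b]) f x.
Proof.
move=> ab intf cf; apply: (@le_trans _ _ (\int[mu]_(x in `[a, b]) c)).
  have dF (x : R) : a <= x <= b -> is_derive x 1 (fun x : R => c * x) c.
    by move=> _; apply: is_derive_eq; rewrite /GRing.scale/=; ring.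
  have cc (x : R) : a <= x <= b -> {for x, continuous (fun=> c : R)}.
    by move=> _; exact: cvg_cst.
  by rewrite (int_derive ab dF cc) mulrBr.
apply: le_Rintegral => //.
by apply: continuous_integrable => x _; exact: cvg_cst.
Qed.

(** The interval inequality is applied to [v], which is [u] minus its projection on w = x
    exp(-x^2/2) over [e, M]. The factor A = d/dx + x - 1/x annihilates w, so A v = A u, and
    expanding (A u)^2 gives u'^2 + x^2 u^2 - 3 u^2 up to an exact derivative. *)
Lemma half_line_gap (e M : R) (u du : R -> R) : 0 < e -> e < M ->
  (forall x : R, is_derive x 1 u (du x)) -> continuous du ->
  (forall x, u x != 0 -> e < x < M) -> (forall x, du x != 0 -> e < x < M) ->
  4 * \int[mu]_x (u x * u x) -
  4 * ((\int[mu]_(x in `[e, M]) (x * gs x * (x * gs x)))^-1 *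
    (\int[mu]_x (w0 true x * u x)) ^+ 2) <=
  \int[mu]_x (du x * du x + x * x * (u x * u x) - 3 * (u x * u x)).
Proof.
move=> e0 eM duu cdu suppu suppdu.
have u0 x : ~ (e < x < M) -> u x = 0.
  by move=> h; apply/eqP/negP => /negP/suppu.
have du0 x : ~ (e < x < M) -> du x = 0.
  by move=> h; apply/eqP/negP => /negP/suppdu.
have ue : u e = 0.
  by apply/eqP/negP => /negP/suppu; rewrite ltxx.
have uM : u M = 0.
  by apply/eqP/negP => /negP/suppu; rewrite ltxx andbF.
rewrite (@Rintegral_itv (e) M (fun x => u x * u x)); last first.
  by move=> x /u0 ->; rewrite mul0r.
rewrite [leRHS](@Rintegral_itv (e) M); last first.
  by move=> x xx; rewrite u0// du0// !mulr0 addr0 subr0.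
rewrite (@Rintegral_itv e M (fun x => w0 true x * u x)); last first.
  by move=> x /u0 ->; rewrite mulr0.
have pos (x : R) : e <= x <= M -> 0 < x.
  by move=> /andP[ex _]; exact: lt_le_trans ex.
rewrite [X in X ^+ 2](_ : _ = \int[mu]_(x in `[e, M]) (x * gs x * u x)); last first.
  apply: eq_Rintegral => x; rewrite inE/= in_itv/= => /pos x0.
  by rewrite /w0 x0.
set U := \int[mu]_(x in _) (u x * u x).
set J := \int[mu]_(x in _) (x * gs x * (x * gs x)); set s := \int[mu]_(x in _) (x * gs x * u x).
have iw : mu.-integrable `[e, M] (EFin \o (fun x => x * gs x * (x * gs x))).
  by apply: continuous_integrable => x xx; cvg_tac.
have iu : mu.-integrable `[e, M] (EFin \o (fun x => u x * u x)).
  by apply: continuous_integrable => x xx; have dux := duu x; cvg_tac.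
have isu : mu.-integrable `[e, M] (EFin \o (fun x => x * gs x * u x)).
  by apply: continuous_integrable => x xx; have dux := duu x; cvg_tac.
have J0 : 0 < J.
  apply: (@lt_le_trans _ _ ((e * gs M) ^+ 2 * (M - e))).
    by rewrite mulr_gt0 ?subr_gt0// exprn_gt0// mulr_gt0// gs_gt0.
  apply: Rintegral_itv_ge => // x /andP[ex xM].
  rewrite expr2; have : e * gs M <= x * gs x.
    rewrite ler_pM ?(ltW e0) ?(ltW (gs_gt0 _))// /gs ler_expR lerN2.
    by rewrite ler_wpM2r// ler_sqr ?nnegrE ?(le_trans (ltW e0))// (le_trans ex).
  by move=> hh; rewrite ler_pM// mulr_ge0 ?(ltW e0) ?(ltW (gs_gt0 _)).
pose k := s / J.
pose v x := u x - k * (x * gs x).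
pose dv x := du x - k * (gs x - x * x * gs x).
have dvv (x : R) : 0 < x -> is_derive x 1 v (dv x).
  move=> _; have dux := duu x; have dg := is_derive_gs x.
  by rewrite /v; apply: is_derive_eq; rewrite /dv /GRing.scale/=; ring.
have cdv (x : R) : 0 < x -> {for x, continuous dv}.
  by move=> _; have cdux := cdu x; rewrite /dv; cvg_tac.
have orth : \int[mu]_(x in `[e, M]) (x * gs x * v x) = 0.
  transitivity (\int[mu]_(x in `[e, M])
      (x * gs x * u x - k * (x * gs x * (x * gs x)))).
    by apply: eq_Rintegral => x _; rewrite /v; ring.
  rewrite RintegralB// ?RintegralZl//; last exact: (integrableZl _ k iw).
  by rewrite -/s -/J /k mulfVK ?subrr// gt_eqF.
have := half_line_interval e0 eM dvv cdv orth.
have -> : \int[mu]_(x in `[e, M]) (v x * v x) = U - J^-1 * s ^+ 2.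
  transitivity (\int[mu]_(x in `[e, M])
      (u x * u x - k * (x * gs x * u x) - k * (x * gs x * v x))).
    by apply: eq_Rintegral => x _; rewrite /v; ring.
  have iv : mu.-integrable `[e, M] (EFin \o (fun x => x * gs x * v x)).
    apply: continuous_integrable => x xx; have dux := dvv x (pos x xx).
    by cvg_tac.
  rewrite !RintegralB// ?RintegralZl// ?orth; first by rewrite -/U -/s /k; ring.
  - by apply: continuous_integrable => x xx; have dux := duu x; cvg_tac.
  - by apply: continuous_integrable => x xx; have dux := duu x; cvg_tac.
  - apply: continuous_integrable => x xx; have dux := dvv x (pos x xx).
    by cvg_tac.
rewrite mulrBr => h; apply: (le_trans h).
(* The boundary term of (A u)^2; it vanishes because [u] does at both ends. *)
pose F (x : R) := (x - x^-1) * (u x * u x).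
pose f (x : R) := (1 + x^-1 * x^-1) * (u x * u x) + (x - x^-1) * (2 * (u x * du x)).
have F0 : \int[mu]_(x in `[e, M]) f x = 0.
  have dF x : e <= x <= M -> is_derive x 1 F (f x).
    move=> xx; have x0 := pos x xx; have dux := duu x; have x0' : x != 0 by rewrite gt_eqF.
    have dV : is_derive x 1 (fun y : R => y^-1) (- (x^-1 * x^-1)).
      have := @is_deriveV R id x 1 1 x0' _ => hV.
      by apply: is_derive_eq; rewrite /GRing.scale/= expr2 invfM mulr1.
    by rewrite /F; apply: is_derive_eq; rewrite /f /GRing.scale /=; ring.
  have cf x : e <= x <= M -> {for x, continuous f}.
    move=> xx; have x0 := pos x xx; have dux := duu x; have cdux := cdu x.
    by rewrite /f; cvg_tac.
  by rewrite (int_derive eM dF cf) /F ue uM !mulr0 subr0.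
have iF : mu.-integrable `[e, M] (EFin \o f).
  apply: continuous_integrable => x xx; have x0 := pos x xx.
  by have dux := duu x; have cdux := cdu x; rewrite /f; cvg_tac.
rewrite -[leRHS]addr0 -F0 -RintegralD//; last first.
  apply: continuous_integrable => x xx; have dux := duu x; have cdux := cdu x.
  by cvg_tac.
rewrite le_eqVlt; apply/orP; left; apply/eqP; apply: eq_Rintegral => x.
rewrite inE/= in_itv/= => /pos x0; have x0' : x != 0 by rewrite gt_eqF.
by rewrite /f /dv /v; field.
Qed.

(** Both projections are now subtracted. The factor A = d/dx + x annihilates [gs] but sends
    [x * gs x] to [gs], so A v = A u - k1 gs. The square of the last term produces the unusual
    weight of the [w1] coefficient, the norm of [gs] over the squared norm of the excited state; in
    the limit it becomes twice the inverse of [N1 false]. *)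
Lemma full_line_gap (M : R) (u du : R -> R) : 0 < M ->
  (forall x : R, is_derive x 1 u (du x)) -> continuous du ->
  (forall x, u x != 0 -> - M < x < M) -> (forall x, du x != 0 -> - M < x < M) ->
  4 * \int[mu]_x (u x * u x) -
  4 * ((\int[mu]_(x in `[- M, M]) (gs x * gs x))^-1 *
    (\int[mu]_x (w0 false x * u x)) ^+ 2) -
  ((\int[mu]_(x in `[- M, M]) (gs x * gs x)) *
   (\int[mu]_(x in `[- M, M]) (x * gs x * (x * gs x)))^-1 ^+ 2) *
   (\int[mu]_x (w1 false x * u x)) ^+ 2 <=
  \int[mu]_x (du x * du x + x * x * (u x * u x) - 1 * (u x * u x)).
Proof.
move=> M0 duu cdu suppu suppdu.
set I0 := \int[mu]_(x in _) (gs x * gs x).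
set I2 := \int[mu]_(x in _) (x * gs x * (x * gs x)).
have eM : - M < M by rewrite gtrN.
have u0 x : ~ (- M < x < M) -> u x = 0.
  by move=> h; apply/eqP/negP => /negP/suppu.
have du0 x : ~ (- M < x < M) -> du x = 0.
  by move=> h; apply/eqP/negP => /negP/suppdu.
have ue : u (- M) = 0.
  by apply/eqP/negP => /negP/suppu; rewrite ltxx.
have uM : u M = 0.
  by apply/eqP/negP => /negP/suppu; rewrite ltxx andbF.
rewrite (@Rintegral_itv (- M) M (fun x => u x * u x)); last first.
  by move=> x /u0 ->; rewrite mul0r.
rewrite [leRHS](@Rintegral_itv (- M) M); last first.
  by move=> x xx; rewrite u0// du0// !mulr0 addr0 subr0.
rewrite (@Rintegral_itv (- M) M (fun x => w1 false x * u x)); last first.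
  by move=> x /u0 ->; rewrite mulr0.
rewrite (@Rintegral_itv (- M) M (fun x => w0 false x * u x)); last first.
  by move=> x /u0 ->; rewrite mulr0.
rewrite /w0 /w1.
set U := \int[mu]_(x in _) (u x * u x).
set s1 := \int[mu]_(x in _) (x * gs x * u x).
set s0 := \int[mu]_(x in _) (gs x * u x).
have iI0 : mu.-integrable `[- M, M] (EFin \o (fun x => gs x * gs x)).
  by apply: continuous_integrable => x xx; cvg_tac.
have iI1 : mu.-integrable `[- M, M] (EFin \o (fun x => x * gs x * gs x)).
  by apply: continuous_integrable => x xx; cvg_tac.
have iI2 : mu.-integrable `[- M, M] (EFin \o (fun x => x * gs x * (x * gs x))).
  by apply: continuous_integrable => x xx; cvg_tac.
have iu : mu.-integrable `[- M, M] (EFin \o (fun x => u x * u x)).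
  by apply: continuous_integrable => x xx; have dux := duu x; cvg_tac.
have is0 : mu.-integrable `[- M, M] (EFin \o (fun x => gs x * u x)).
  by apply: continuous_integrable => x xx; have dux := duu x; cvg_tac.
have is1 : mu.-integrable `[- M, M] (EFin \o (fun x => x * gs x * u x)).
  by apply: continuous_integrable => x xx; have dux := duu x; cvg_tac.
have gsM x : - M <= x <= M -> gs M <= gs x.
  rewrite -ler_norml => xM; rewrite /gs ler_expR lerN2 ler_wpM2r//.
  by rewrite -(real_normK (num_real x)) ler_sqr ?nnegrE// ltW.
have I00 : 0 < I0.
  apply: (@lt_le_trans _ _ ((gs M * gs M) * (M - - M))).
    by rewrite mulr_gt0 ?subr_gt0// mulr_gt0// gs_gt0.
  apply: Rintegral_itv_ge => // x xM.
  by rewrite ler_pM ?(ltW (gs_gt0 _))// gsM.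
have I20 : 0 < I2.
  have i3 : mu.-integrable `[- M, M] (EFin \o (fun x : R => gs M * gs M * (x * x))).
    by apply: continuous_integrable => x xx; cvg_tac.
  apply: (@lt_le_trans _ _ (\int[mu]_(x in `[- M, M]) (gs M * gs M * (x * x)))).
    have dF (x : R) : - M <= x <= M -> is_derive x 1
        (fun x : R => gs M * gs M * (3^-1 * (x * (x * x))))
        (gs M * gs M * (x * x)).
      by move=> _; apply: is_derive_eq; rewrite /GRing.scale/=; field.
    have cc (x : R) : - M <= x <= M ->
        {for x, continuous (fun x : R => gs M * gs M * (x * x))}.
      by move=> _; cvg_tac.
    rewrite (int_derive eM dF cc) -mulrBr mulr_gt0// ?mulr_gt0 ?gs_gt0//.
    have : 0 < M * (M * M) by rewrite !mulr_gt0.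
    by rewrite !(mulNr, mulrN) opprK; lra.
  apply: le_Rintegral => //= x; rewrite in_itv/= => xM.
  have -> : x * gs x * (x * gs x) = gs x * gs x * (x * x) by ring.
  rewrite ler_wpM2r// -?expr2 ?sqr_ge0//.
  by rewrite ler_sqr ?nnegrE ?(ltW (gs_gt0 _))// gsM.
(* The interval is symmetric and the primitive even, so the two states are orthogonal already before
   the limit. *)
have I10 : \int[mu]_(x in `[- M, M]) (x * gs x * gs x) = 0.
  have dF (x : R) : - M <= x <= M -> is_derive x 1
      (fun x : R => - 2^-1 * (gs x * gs x)) (x * gs x * gs x).
    move=> _; have dg := is_derive_gs x.
    by apply: is_derive_eq; rewrite /GRing.scale/=; field.
  have cc (x : R) : - M <= x <= M -> {for x, continuous (fun x : R => x * gs x * gs x)}.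
    by move=> _; cvg_tac.
  by rewrite (int_derive eM dF cc) /gs sqrrN subrr.
pose k0 := s0 / I0; pose k1 := s1 / I2.
pose v x := u x - k0 * gs x - k1 * (x * gs x).
pose dv x := du x + k0 * (x * gs x) - k1 * (gs x - x * x * gs x).
have dvv (x : R) : is_derive x 1 v (dv x).
  have dux := duu x; have dg := is_derive_gs x.
  by rewrite /v; apply: is_derive_eq; rewrite /dv /GRing.scale/=; ring.
have cdv : continuous dv.
  by move=> x; have cdux := cdu x; rewrite /dv; cvg_tac.
have orth0 : \int[mu]_(x in `[- M, M]) (gs x * v x) = 0.
  transitivity (\int[mu]_(x in `[- M, M])
      (gs x * u x - k0 * (gs x * gs x) - k1 * (x * gs x * gs x))).
    by apply: eq_Rintegral => x _; rewrite /v; ring.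
  rewrite !RintegralB// ?RintegralZl//.
  - by rewrite I10 -/s0 -/I0 /k0 mulfVK ?gt_eqF// subrr mulr0 subr0.
  - exact: (integrableZl _ k0 iI0).
  - by apply: continuous_integrable => x xx; have dux := duu x; cvg_tac.
  - exact: (integrableZl _ k1 iI1).
have orth1 : \int[mu]_(x in `[- M, M]) (x * gs x * v x) = 0.
  transitivity (\int[mu]_(x in `[- M, M])
      (x * gs x * u x - k0 * (x * gs x * gs x) - k1 * (x * gs x * (x * gs x)))).
    by apply: eq_Rintegral => x _; rewrite /v; ring.
  rewrite !RintegralB// ?RintegralZl//.
  - by rewrite I10 -/s1 -/I2 /k1 mulfVK ?gt_eqF// mulr0 subr0 subrr.
  - exact: (integrableZl _ k0 iI1).
  - by apply: continuous_integrable => x xx; have dux := duu x; cvg_tac.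
  - exact: (integrableZl _ k1 iI2).
have := full_line_interval M0 dvv cdv orth0 orth1.
have iv0 : mu.-integrable `[- M, M] (EFin \o (fun x => gs x * v x)).
  by apply: continuous_integrable => x xx; have dvx := dvv x; cvg_tac.
have iv1 : mu.-integrable `[- M, M] (EFin \o (fun x => x * gs x * v x)).
  by apply: continuous_integrable => x xx; have dvx := dvv x; cvg_tac.
have -> : \int[mu]_(x in `[- M, M]) (v x * v x) = U - k0 * s0 - k1 * s1.
  transitivity (\int[mu]_(x in `[- M, M])
      (u x * u x - k0 * (gs x * u x) - k1 * (x * gs x * u x)
       - k0 * (gs x * v x) - k1 * (x * gs x * v x))).
    by apply: eq_Rintegral => x _; rewrite /v; ring.
  rewrite !RintegralB// ?RintegralZl// ?orth0 ?orth1.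
  - by rewrite !mulr0 !subr0.
  all: try by apply: continuous_integrable => x xx; have dux := duu x;
    have dvx := dvv x; cvg_tac.
(* The first term integrates the cross term 2 x u u' by parts, the second one the product of [gs]
   with u'. *)
pose F (x : R) := x * (u x * u x) - 2 * k1 * (gs x * u x).
pose f (x : R) := u x * u x + x * (2 * (u x * du x)) -
   2 * k1 * (gs x * du x - x * gs x * u x).
have F0 : \int[mu]_(x in `[- M, M]) f x = 0.
  have dF x : - M <= x <= M -> is_derive x 1 F (f x).
    move=> xx; have dux := duu x; have dg := is_derive_gs x.
    by rewrite /F; apply: is_derive_eq; rewrite /f /GRing.scale /=; ring.
  have cf x : - M <= x <= M -> {for x, continuous f}.
    by move=> xx; have dux := duu x; have cdux := cdu x; rewrite /f; cvg_tac.
  by rewrite (int_derive eM dF cf) /F ue uM !mulr0 !subr0.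
have iF : mu.-integrable `[- M, M] (EFin \o f).
  apply: continuous_integrable => x xx.
  by have dux := duu x; have cdux := cdu x; rewrite /f; cvg_tac.
set D := \int[mu]_(x in _) (_ - _).
have -> : \int[mu]_(x in `[- M, M]) ((dv x + x * v x) * (dv x + x * v x)) =
    D - 4 * k1 * s1 + k1 ^+ 2 * I0.
  transitivity (\int[mu]_(x in `[- M, M])
     ((du x * du x + x * x * (u x * u x) - 1 * (u x * u x)) + f x
      - 4 * k1 * (x * gs x * u x) + k1 ^+ 2 * (gs x * gs x))).
    by apply: eq_Rintegral => x _; rewrite /dv /v /f; ring.
  have iD : mu.-integrable `[- M, M]
      (EFin \o (fun x => du x * du x + x * x * (u x * u x) - 1 * (u x * u x))).
    apply: continuous_integrable => x xx; have dux := duu x.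
    by have cdux := cdu x; cvg_tac.
  have i1 : mu.-integrable `[- M, M] (EFin \o (fun x =>
      du x * du x + x * x * (u x * u x) - 1 * (u x * u x) + f x)).
    apply: continuous_integrable => x xx; have dux := duu x.
    by have cdux := cdu x; rewrite /f; cvg_tac.
  have i2 : mu.-integrable `[- M, M] (EFin \o (fun x => 4 * k1 * (x * gs x * u x))).
    by apply: continuous_integrable => x xx; have dux := duu x; cvg_tac.
  have i3 : mu.-integrable `[- M, M] (EFin \o (fun x => k1 ^+ 2 * (gs x * gs x))).
    by apply: continuous_integrable => x xx; cvg_tac.
  rewrite RintegralD//; last first.
    apply: continuous_integrable => x xx; have dux := duu x.
    by have cdux := cdu x; rewrite /f; cvg_tac.
  by rewrite RintegralB// RintegralD// !RintegralZl// F0 -/D -/s1 -/I0 addr0.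
have -> : I0 * I2^-1 ^+ 2 * s1 ^+ 2 = k1 ^+ 2 * I0 by rewrite /k1; ring.
have -> : I0^-1 * s0 ^+ 2 = k0 * s0 by rewrite /k0; ring.
lra.
Qed.

End one_dim.

(** * The one-dimensional gap with the norms over the whole line *)

Section one_dim2.
Context {R : realType}.
Notation mu := (@lebesgue_measure R).
Local Notation w0 := (@w0 R).
Local Notation w1 := (@w1 R).
Local Notation env1 := (@env1 R).

Definition N0 (h : bool) : R := \int[mu]_x (w0 h x * w0 h x).
Definition N1 (h : bool) : R := \int[mu]_x (w1 h x * w1 h x).
(** Lowest eigenvalue of -d^2/dt^2 + t^2: 3 on the half line with Dirichlet condition, 1 on the
    line. Over the coordinates these add up to n + 2k. *)
Definition E1 (h : bool) : R := if h then 3 else 1.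

Lemma dominated_w00 h : dominated env1 (fun x => w0 h x * w0 h x).
Proof. by apply: (dominatedM envelope_env1); exact: dominated_w0. Qed.

Lemma dominated_w11 h : dominated env1 (fun x => w1 h x * w1 h x).
Proof. by apply: (dominatedM envelope_env1); exact: dominated_w1. Qed.

Lemma dominated_w01 h : dominated env1 (fun x => w0 h x * w1 h x).
Proof.
by apply: (dominatedM envelope_env1); [exact: dominated_w0|exact: dominated_w1].
Qed.

(** On [1, 2] both ground states are at least [gs 2], which treats the two cases at once. *)
Lemma N0_gt0 h : 0 < N0 h.
Proof.
have iw := dominated_integrable envelope_env1 (dominated_w00 h).
have sq (z : R) : 0 <= z * z by rewrite -expr2 sqr_ge0.
have le12 x : 1 <= x <= 2 -> gs 2 <= w0 h x.
  move=> /andP[x1 x2]; have x0 : 0 < x by exact: lt_le_trans x1.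
  have : gs 2 <= gs x.
    rewrite /gs ler_expR lerN2 ler_wpM2r// ler_sqr ?nnegrE//.
    exact: ltW.
  rewrite /w0 x0; case: h {iw} => // /le_trans; apply.
  by rewrite ler_peMl// ltW// gs_gt0.
have i12 : mu.-integrable `[1, 2] (EFin \o (fun x => w0 h x * w0 h x)).
  by apply: integrableS iw.
apply: (@lt_le_trans _ _ ((gs 2 * gs 2) * (2 - 1))).
  by rewrite mulr_gt0// ?mulr_gt0 ?gs_gt0// subr_gt0 ltr1n.
apply: (@le_trans _ _ (\int[mu]_(x in `[1, 2]) (w0 h x * w0 h x))).
  apply: Rintegral_itv_ge => //; first by rewrite ltr1n.
  by move=> x x12; rewrite ler_pM ?le12// ltW// gs_gt0.
rewrite Rintegral_mkcond; apply: le_Rintegral => //.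
  rewrite -restrict_EFin.
  apply/(@integrable_restrict _ _ _ mu _ (measurable_itv _) _ measurableT).
  by rewrite setTI.
by move=> x _; rewrite patchE; case: ifP.
Qed.

(** The shift by one keeps the end points [nn1 n] and their inverses positive for every [n]. *)
Definition nn1 (n : nat) : R := n.+1%:R.

Lemma near_nn1 (r : R) : \forall n \near \oo, r < nn1 n.
Proof.
near=> n; apply: (@le_lt_trans _ _ n%:R); last by rewrite ltr_nat.
by near: n; exact: nbhs_infty_ger.
Unshelve. all: by end_near. Qed.

Lemma itv_nn1 (f : R -> R) : dominated env1 f ->
  \int[mu]_(x in `[- nn1 n, nn1 n]) f x @[n --> \oo] --> \int[mu]_x f x.
Proof.
move=> df; apply: int_exhaust; first exact: (dominated_integrable envelope_env1 df).
move=> x _; near=> n; rewrite -ler_norml ltW//; near: n; exact: near_nn1.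
Unshelve. all: by end_near. Qed.

Lemma int_w01 h : \int[mu]_x (w0 h x * w1 h x) = 0.
Proof.
case: h; first by under eq_Rintegral do rewrite mulr0; rewrite Rintegral_cst ?mul0r.
have := itv_nn1 (dominated_w01 false).
rewrite (_ : (fun n => _) = cst 0); last first.
  apply/funext => n /=; have nn : - nn1 n < nn1 n by rewrite gtrN// ltr0n.
  have dF (x : R) : - nn1 n <= x <= nn1 n -> is_derive x 1
      (fun x : R => - 2^-1 * (gs x * gs x)) (w0 false x * w1 false x).
    move=> _; have dg := is_derive_gs x.
    by rewrite /w0 /w1; apply: is_derive_eq; rewrite /GRing.scale/=; field.
  have cc (x : R) : - nn1 n <= x <= nn1 n ->
      {for x, continuous (fun x : R => w0 false x * w1 false x)}.
    by move=> _; rewrite /w0 /w1; cvg_tac.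
  by rewrite (int_derive nn dF cc) /gs sqrrN subrr.
by move=> /(cvg_unique _); apply => //; exact: cvg_cst.
Qed.

(** The function gs^2 / 2 - x^2 gs^2 is the derivative of x gs^2 / 2, whose boundary values tend to
    0. This ratio turns the weight found on the interval into 2 / N1. *)
Lemma N1_false : N1 false = N0 false / 2.
Proof.
have c0 := itv_nn1 (dominated_w00 false).
have c1 := itv_nn1 (dominated_w11 false).
apply/eqP; rewrite eq_sym -subr_eq0; apply/eqP.
have : (fun n => (\int[mu]_(x in `[- nn1 n, nn1 n]) (w0 false x * w0 false x)) / 2
   - \int[mu]_(x in `[- nn1 n, nn1 n]) (w1 false x * w1 false x)) @ \oo -->
   N0 false / 2 - N1 false.
  by apply: cvgB => //; apply: cvgM => //; exact: cvg_cst.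
move=> /(cvg_unique _); apply => //.
(* With M = n + 1 the boundary term is M exp(-M^2), at most 1/M because M^2 <= exp(M^2). *)
have ch : (fun n => harmonic n : R) @ \oo --> (0:R) by exact: cvg_harmonic.
apply: (squeeze_cvgr _ (cvg_cst 0) ch); near=> n.
have n0 : 0 < nn1 n by rewrite ltr0n.
have nn : - nn1 n < nn1 n by rewrite gtrN.
have iw0 : mu.-integrable `[- nn1 n, nn1 n]
    (EFin \o (fun x => w0 false x * w0 false x)).
  by apply: continuous_integrable => x xx; rewrite /w0; cvg_tac.
have iw1 : mu.-integrable `[- nn1 n, nn1 n]
    (EFin \o (fun x => w1 false x * w1 false x)).
  by apply: continuous_integrable => x xx; rewrite /w1; cvg_tac.
have dF (x : R) : - nn1 n <= x <= nn1 n -> is_derive x 1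
    (fun x : R => 2^-1 * (x * (gs x * gs x)))
    (w0 false x * w0 false x / 2 - w1 false x * w1 false x).
  move=> _; have dg := is_derive_gs x.
  by rewrite /w0 /w1; apply: is_derive_eq; rewrite /GRing.scale/=; field.
have cc (x : R) : - nn1 n <= x <= nn1 n ->
    {for x, continuous (fun x : R => w0 false x * w0 false x / 2
       - w1 false x * w1 false x)}.
  by move=> _; rewrite /w0 /w1; cvg_tac.
have := int_derive nn dF cc.
rewrite RintegralB ?RintegralZr//; last exact: (integrableZr _ 2^-1 iw0).
move=> ->.
have -> : gs (- nn1 n) = gs (nn1 n) by rewrite /gs sqrrN.
have g0 := gs_gt0 (nn1 n).
have -> : 2^-1 * (nn1 n * (gs (nn1 n) * gs (nn1 n))) -
    2^-1 * (- nn1 n * (gs (nn1 n) * gs (nn1 n))) =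
    nn1 n * (gs (nn1 n) * gs (nn1 n)) by field.
rewrite !mulr_ge0 ?(ltW n0) ?(ltW g0)//= /harmonic -/(nn1 n).
rewrite -(ler_pM2l n0) mulfV ?gt_eqF//.
have -> : gs (nn1 n) * gs (nn1 n) = (expR (nn1 n ^+ 2))^-1.
  by rewrite /gs -expRD -expRN; congr expR; field.
rewrite mulrA ler_pdivrMr ?expR_gt0// mul1r -expr2.
by apply: le_trans (expR_ge1Dx _); rewrite lerDr.
Unshelve. all: by end_near. Qed.

(** A single constant bounds the support and, on the half line, its distance to 0; the support then
    lies inside the exhausting interval as soon as [nn1 n] exceeds [M]. *)
Definition C1c (h : bool) (u du : R -> R) :=
  [/\ forall x : R, is_derive x 1 u (du x), continuous du &
    exists2 M, 0 < M & forall x, (u x != 0) || (du x != 0) ->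
      `|x| <= M /\ (h -> M^-1 <= x)].

(** For large intervals the integrals of [u] no longer change, so only the truncated norms of the
    states move, and they converge to [N0 h] and [N1 h]. *)
Lemma one_dim_gap h u du : C1c h u du ->
  4 * \int[mu]_x (u x * u x)
  - 4 * ((N0 h)^-1 * (\int[mu]_x (w0 h x * u x)) ^+ 2)
  - 2 * ((N1 h)^-1 * (\int[mu]_x (w1 h x * u x)) ^+ 2) <=
  \int[mu]_x (du x * du x + x * x * (u x * u x) - E1 h * (u x * u x)).
Proof.
move=> [duu cdu [M M0 uM]].
set U := \int[mu]_x (u x * u x); set s0 := \int[mu]_x (w0 h x * u x).
set s1 := \int[mu]_x (w1 h x * u x).
set D := \int[mu]_x (_ - _).
have N00 := N0_gt0 h.
case: h uM @s0 @s1 @D N00 => uM s0 s1 D N00.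
- have c0 : \int[mu]_(x in `[(nn1 n)^-1, nn1 n]) (w0 true x * w0 true x)
      @[n --> \oo] --> N0 true.
    apply: int_exhaust.
      exact: (dominated_integrable envelope_env1 (dominated_w00 true)).
    move=> x; rewrite /w0; case: ifPn => [x0 _|_]; last by rewrite mulr0 eqxx.
    near=> n; apply/andP; split.
      rewrite -[leRHS]invrK lef_pV2 ?posrE ?invr_gt0 ?ltr0n//.
      by rewrite ltW//; near: n; exact: near_nn1.
    by rewrite ltW//; near: n; exact: near_nn1.
  have cL : 4 * U - 4 * ((\int[mu]_(x in `[(nn1 n)^-1, nn1 n])
        (w0 true x * w0 true x))^-1 * s0 ^+ 2) @[n --> \oo] -->
      4 * U - 4 * ((N0 true)^-1 * s0 ^+ 2).
    apply: cvgB; first exact: cvg_cst.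
    apply: cvgM; first exact: cvg_cst.
    by apply: cvgM; [apply: cvgV => //; rewrite gt_eqF|exact: cvg_cst].
  rewrite (_ : s1 = 0) ?expr0n/= ?mulr0 ?subr0; last first.
    by rewrite /s1; under eq_Rintegral do rewrite mul0r; rewrite Rintegral_cst ?mul0r.
  apply: (ler_cvg_to cL (cvg_cst D)); near=> n.
  have nM : M < nn1 n by near: n; exact: near_nn1.
  have n1 : 1 < nn1 n by near: n; exact: near_nn1.
  have nMV : (nn1 n)^-1 < M^-1 by rewrite ltf_pV2 ?posrE// ltr0n.
  have un x : (u x != 0) || (du x != 0) -> (nn1 n)^-1 < x < nn1 n.
    move=> /uM[xM /(_ isT) Mx]; rewrite (lt_le_trans nMV)//=.
    by rewrite (le_lt_trans _ nM)// (le_trans _ xM)// ler_norm.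
  have -> : \int[mu]_(x in `[(nn1 n)^-1, nn1 n]) (w0 true x * w0 true x) =
      \int[mu]_(x in `[(nn1 n)^-1, nn1 n]) (x * gs x * (x * gs x)).
    apply: eq_Rintegral => x; rewrite inE/= in_itv/= => /andP[x1 _].
    by rewrite /w0 (lt_le_trans _ x1)// invr_gt0 ltr0n.
  apply: half_line_gap => //.
  - by rewrite invr_gt0 ltr0n.
  - by rewrite (@lt_trans _ _ 1)// invf_lt1// ltr0n.
  - by move=> x ux; apply: un; rewrite ux.
  - by move=> x ux; apply: un; rewrite ux orbT.
- have c0 := itv_nn1 (dominated_w00 false).
  have c1 := itv_nn1 (dominated_w11 false).
  have N10 : N1 false != 0 by rewrite N1_false gt_eqF// divr_gt0.
  have cL : 4 * U - 4 * ((\int[mu]_(x in `[- nn1 n, nn1 n])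
        (w0 false x * w0 false x))^-1 * s0 ^+ 2) -
        ((\int[mu]_(x in `[- nn1 n, nn1 n]) (w0 false x * w0 false x)) *
        (\int[mu]_(x in `[- nn1 n, nn1 n]) (w1 false x * w1 false x))^-1 ^+ 2 *
          s1 ^+ 2) @[n --> \oo] -->
      4 * U - 4 * ((N0 false)^-1 * s0 ^+ 2) -
        (N0 false * (N1 false)^-1 ^+ 2 * s1 ^+ 2).
    apply: cvgB.
      apply: cvgB; first exact: cvg_cst.
      apply: cvgM; first exact: cvg_cst.
      by apply: cvgM; [apply: cvgV => //; rewrite gt_eqF|exact: cvg_cst].
    apply: cvgM; last exact: cvg_cst.
    apply: cvgM => //; rewrite expr2; under eq_fun do rewrite expr2.
    by apply: cvgM; exact: cvgV.
  (* The limit weight is N0 / N1^2, and N0 = 2 N1. *)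
  have -> : 2 * ((N1 false)^-1 * s1 ^+ 2) =
      N0 false * (N1 false)^-1 ^+ 2 * s1 ^+ 2.
    have -> : N0 false = 2 * N1 false by rewrite N1_false mulrCA divff ?mulr1.
    by rewrite expr2; field.
  apply: (ler_cvg_to cL (cvg_cst D)); near=> n.
  have nM : M < nn1 n by near: n; exact: near_nn1.
  have un x : (u x != 0) || (du x != 0) -> - nn1 n < x < nn1 n.
    by move=> /uM[xM _]; rewrite -ltr_norml (le_lt_trans xM).
  apply: full_line_gap => //.
  - by move=> x ux; apply: un; rewrite ux.
  - by move=> x ux; apply: un; rewrite ux orbT.
Unshelve. all: by end_near. Qed.

End one_dim2.

(** * Integration over row vectors *)

Section cons_rV.
Context {R : realType}.

Lemma cons_rV0 n (t : R) (y : 'rV[R]_n) : cons_rV (t, y) 0 ord0 = t.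
Proof. by rewrite mxE unlift_none. Qed.

Lemma cons_rVS n (t : R) (y : 'rV[R]_n) j : cons_rV (t, y) 0 (lift ord0 j) = y 0 j.
Proof. by rewrite mxE liftK. Qed.

Lemma cons_rV_ind n (P : 'rV[R]_n.+1 -> Prop) :
  (forall t y, P (cons_rV (t, y))) -> forall x, P x.
Proof.
move=> h x; rewrite (_ : x = cons_rV (x 0 ord0, \row_j x 0 (lift ord0 j))) //.
apply/rowP => i; rewrite !mxE /=; case: (unliftP ord0 i) => [j ->|->] //=.
by rewrite mxE.
Qed.

Lemma cons_rV_shift0 n (t h : R) (y : 'rV[R]_n) :
  cons_rV (h + t, y) = h *: delta_mx 0 ord0 + cons_rV (t, y).
Proof.
apply/rowP => i; rewrite !mxE; case: (unliftP ord0 i) => [j ->|->] /=.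
  by rewrite mulr0 add0r.
by rewrite mulr1.
Qed.

Lemma cons_rV_shiftS n (t h : R) (y : 'rV[R]_n) i :
  cons_rV (t, h *: delta_mx 0 i + y) =
  h *: delta_mx 0 (lift ord0 i) + cons_rV (t, y).
Proof.
apply/rowP => j; rewrite !mxE; case: (unliftP ord0 j) => [l ->|->] /=.
  by rewrite !mxE (inj_eq lift_inj).
by rewrite mulr0 add0r.
Qed.

Lemma sqnorm_cons n (t : R) (y : 'rV[R]_n) :
  sqnorm (cons_rV (t, y)) = t ^+ 2 + sqnorm y.
Proof.
rewrite /sqnorm big_ord_recl cons_rV0; congr +%R.
by apply: eq_bigr => i _; rewrite cons_rVS.
Qed.

Lemma measurable_cons_rV n :
  measurable_fun setT (@cons_rV R n : measurableTypeR R * 'rV[R]_n -> 'rV[R]_n.+1).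
Proof.
apply: measurable_fun_rVP => i.
case: (unliftP ord0 i) => [j ->|->].
  apply: (@eq_measurable_fun _ _ _ _ _
    (fun p : measurableTypeR R * 'rV[R]_n => p.2 0%R j)).
    by move=> [t y] _; rewrite cons_rVS.
  by apply: (measurableT_comp (measurable_coord_rV j)).
move=> _ Y mY.
rewrite (_ : (fun t => _) = fst); first exact: measurable_fst.
by apply/funext => -[t y]; rewrite cons_rV0.
Qed.

Lemma sqnorm_ge0 n (x : 'rV[R]_n) : 0 <= sqnorm x.
Proof. by apply: sumr_ge0 => i _; exact: sqr_ge0. Qed.

Lemma coord_le_sqnorm n (x : 'rV[R]_n) i : x 0 i ^+ 2 <= sqnorm x.
Proof.
by rewrite /sqnorm (bigD1 i)//= lerDl sumr_ge0// => j _; exact: sqr_ge0.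
Qed.

Lemma measurable_coord n (i : 'I_n) :
  measurable_fun setT (fun x : 'rV[R]_n => x 0 i).
Proof. exact: measurable_coord_rV. Qed.

Lemma measurable_sqnorm n : measurable_fun setT (@sqnorm R n).
Proof.
by apply: measurable_sum => i; apply: measurable_funX; exact: measurable_coord.
Qed.

Lemma measurable_orthant n k : measurable (@orthant R n k).
Proof.
rewrite (_ : orthant k = \bigcap_(i in [set i : 'I_n | (n - k <= i)%N])
   ((fun x : 'rV[R]_n => x 0 i) @^-1` `]0, +oo[)).
  apply: fin_bigcap_measurable => // i _.
  rewrite -[X in measurable X]setTI.
  by apply: measurable_coord => //; exact: measurable_itv.
apply/seteqP; split => x /= h i /=.
  by move=> ki; rewrite in_itv/= andbT; exact: h.
by move=> /h /=; rewrite in_itv/= andbT.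
Qed.

(* An open set is the countable union of the grid cells of size 1/(N+1)
   that it contains. *)
Lemma open_measurable_rV n (U : set 'rV[R]_n) : open U -> measurable U.
Proof.
move=> oU.
pose cell (p : nat * 'rV[int]_n) : set 'rV[R]_n :=
  [set y | forall i, (p.2 0 i)%:~R <= p.1.+1%:R * y 0 i < (p.2 0 i)%:~R + 1].
have mcell p : measurable (cell p).
  rewrite (_ : cell p = \bigcap_(i in [set: 'I_n])
     ((fun x : 'rV[R]_n => x 0 i) @^-1`
       ((fun t : R => p.1.+1%:R * t) @^-1` `[(p.2 0 i)%:~R, (p.2 0 i)%:~R + 1[))).
    apply: fin_bigcap_measurable => // i _.
    rewrite -[X in measurable X]setTI.
    apply: measurable_coord => //.
    rewrite -[X in measurable X]setTI.
    by apply: measurable_funM => //; exact: measurable_itv.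
  apply/seteqP; split => x /= h i /=.
    by move=> _; rewrite in_itv/=; exact: h.
  by have := h i I; rewrite /= in_itv.
rewrite (_ : U = \bigcup_(m in [set: nat])
    (if (unpickle m : option (nat * 'rV[int]_n)) is Some p then
      if `[< cell p `<=` U >] then cell p else set0 else set0)).
  apply: bigcup_measurable => m _; case: (unpickle m) => // p.
  by case: ifP.
apply/seteqP; split => x; last first.
  by move=> [m _]; case: (unpickle m) => // p; case: ifPn => // /asboolP h /h.
move=> Ux; have /nbhs_ballP[e /= e0 eU] : nbhs x U by exact: open_nbhs_nbhs.
have [N Ne] : exists N, e^-1 < N.+1%:R.
  exists (Num.truncn e^-1); exact: truncnS_gt.
pose p : nat * 'rV[int]_n := (N, \row_i Num.floor (N.+1%:R * x 0 i)).
have cx : cell p x.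
  by move=> i; rewrite /= mxE; have := floor_itv (N.+1%:R * x 0 i); rewrite intrD.
exists (pickle p) => //; rewrite pickleK.
rewrite ifT//; apply/asboolP => y cy; apply: eU; split => // i j.
rewrite ord1 {i}; have /andP[x1 x2] := cx j; have /andP[y1 y2] := cy j.
have N0 : 0 < N.+1%:R :> R by rewrite ltr0n.
rewrite /ball/= -(ltr_pM2l N0) -[X in X * `|_|]gtr0_norm// -normrM mulrBr.
apply: (@lt_le_trans _ _ 1).
  rewrite ltr_norml; lra.
by rewrite -ler_pdivrMr// mul1r ltW.
Qed.

Lemma continuous_measurable_rV n (f : 'rV[R]_n -> R) :
  continuous f -> measurable_fun setT f.
Proof.
move=> /continuousP cf; apply: (measurability _ (RGenOpens.measurableE R)).
move=> _ [_ [a [b ->] <-]]; rewrite setTI; apply: open_measurable_rV.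
exact/cf/interval_open.
Qed.

(** The product of [env1] over the coordinates; the factorization makes it compatible with splitting
    off the first variable. *)
Definition envn n (x : 'rV[R]_n) : R := expR (- (sqnorm x / 4)).

Lemma envn_cons n t (y : 'rV[R]_n) : envn (cons_rV (t, y)) = env1 t * envn y.
Proof. by rewrite /envn /env1 sqnorm_cons mulrDl opprD expRD. Qed.

Lemma envn_gt0 n (x : 'rV[R]_n) : 0 < envn x. Proof. exact: expR_gt0. Qed.

Lemma envn_le1 n (x : 'rV[R]_n) : envn x <= 1.
Proof. by rewrite /envn -expR0 ler_expR oppr_le0 divr_ge0// sqnorm_ge0. Qed.

Lemma measurable_envn n : measurable_fun setT (@envn n).
Proof.
apply: measurableT_comp => //; apply: measurableT_comp => //.
by apply: measurable_funM => //; exact: measurable_sqnorm.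
Qed.

Lemma integral_lebesgue_cons n (f : 'rV[R]_n.+1 -> \bar R) :
  measurable_fun setT f -> (forall x, 0 <= f x)%E ->
  (\int[lebesgue_rV n.+1]_x f x =
   \int[(@lebesgue_measure R \x lebesgue_rV n)]_p f (cons_rV p))%E.
Proof.
move=> mf f0.
pose m : {measure set (measurableTypeR R * 'rV[R]_n) -> \bar R} :=
  (@lebesgue_measure R \x lebesgue_rV n)%E.
exact: (ge0_integral_pushforward (@measurable_cons_rV n) m
  measurableT mf (fun x _ => f0 x)).
Qed.

Lemma envelope_envn n : envelope (lebesgue_rV n) (@envn n).
Proof.
split; first exact: measurable_envn.
  by move=> x; rewrite envn_le1 ltW ?envn_gt0.
elim: n => [|n ih].
  apply/integrableP; split; first by apply/measurable_EFinP; exact: measurable_envn.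
  rewrite integral_dirac//=; last first.
    by apply/measurable_EFinP; apply: measurableT_comp => //; exact: measurable_envn.
  by rewrite diracT mul1e ltry.
apply/integrableP; split; first by apply/measurable_EFinP; exact: measurable_envn.
rewrite integral_lebesgue_cons//; last first.
  by apply: measurableT_comp => //; apply/measurable_EFinP; exact: measurable_envn.
have en : envelope (lebesgue_rV n) (@envn n).
  split => //; first exact: measurable_envn.
  by move=> x; rewrite envn_le1 ltW ?envn_gt0.
have d1 : dominated env1 (@env1 R).
  by split; [case: (@envelope_env1 R)|exists 1 => // x; rewrite mul1r ger0_norm// ltW ?env1_gt0].
have dn : dominated (@envn n) (@envn n).
  split; first exact: measurable_envn.
  by exists 1 => // x; rewrite mul1r ger0_norm// ltW ?envn_gt0.
have := dominated2_integrable envelope_env1 en (dominated2_prod envelope_env1 en d1 dn).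
move=> /integrableP[_]; apply: le_lt_trans.
by rewrite le_eqVlt; apply/orP; left; apply/eqP; apply: eq_integral => -[t y] _ /=; rewrite envn_cons.
Qed.

End cons_rV.

(** * The gap for compactly supported functions *)

Section rV_integral.
Context {R : realType}.
Notation leb := (@lebesgue_measure R).
Notation env1 := (@env1 R).

Lemma dominated_cons n (f : 'rV[R]_n.+1 -> R) : dominated (@envn R n.+1) f ->
  dominated2 env1 (@envn R n) (fun t y => f (cons_rV (t, y))).
Proof.
move=> [mf [C C0 fC]]; split.
  rewrite (_ : (fun p => _) = f \o (@cons_rV R n)); last by apply/funext => -[].
  exact: (measurableT_comp mf (@measurable_cons_rV R n)).
by exists C => // t y; rewrite -envn_cons.
Qed.

Lemma int_cons n (f : 'rV[R]_n.+1 -> R) : dominated (@envn R n.+1) f ->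
  \int[lebesgue_rV n.+1]_x f x =
  \int[leb]_t \int[lebesgue_rV n]_y f (cons_rV (t, y)).
Proof.
move=> df; have d2 := dominated_cons df.
rewrite -(int_prod envelope_env1 (envelope_envn n) d2) /Rintegral; congr fine.
pose m : {measure set (measurableTypeR R * 'rV[R]_n) -> \bar R} :=
  (@lebesgue_measure R \x lebesgue_rV n)%E.
have mf : measurable_fun setT (EFin \o f) by apply/measurable_EFinP; case: df.
have fm : m.-integrable setT ((EFin \o f) \o (@cons_rV R n)).
  apply: eq_integrable (dominated2_integrable envelope_env1 (envelope_envn n) d2) => //.
transitivity (\int[m]_p ((EFin \o f) \o (@cons_rV R n)) p)%E.
  exact: (integral_pushforward (@measurable_cons_rV R n) mf fm measurableT).
by apply: eq_integral => -[t y] _.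
Qed.

Lemma int_cons' n (f : 'rV[R]_n.+1 -> R) : dominated (@envn R n.+1) f ->
  \int[lebesgue_rV n.+1]_x f x =
  \int[lebesgue_rV n]_y \int[leb]_t f (cons_rV (t, y)).
Proof.
move=> df; rewrite int_cons//.
exact: (int_fubini envelope_env1 (envelope_envn n) (dominated_cons df)).
Qed.

Lemma cvg_rV n (T : Type) (F : set_system T) (FF : Filter F)
    (f : T -> 'rV[R]_n) (x : 'rV[R]_n) :
  (forall i, f t 0 i @[t --> F] --> x 0 i) -> f @ F --> x.
Proof.
move=> h; apply/cvg_ballP => e e0.
have : \forall t \near F, forall i, ball (x 0 i) e (f t 0 i).
  apply: filter_forall => i.
  by move/cvg_ballP : (h i); apply.
by apply: filterS => t ht; split => // i j; rewrite ord1.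
Qed.

Lemma continuous_coord n (i : 'I_n) : continuous (fun x : 'rV[R]_n => x 0 i).
Proof.
by move=> x; apply/differentiable_continuous/differentiable_coord.
Qed.

Lemma continuous_cons1 n (y : 'rV[R]_n) :
  continuous (fun t : R => cons_rV (t, y)).
Proof.
move=> t; apply: cvg_rV => i; case: (unliftP ord0 i) => [j ->|->].
  by under eq_fun do rewrite cons_rVS; rewrite cons_rVS; exact: cvg_cst.
by under eq_fun do rewrite cons_rV0; rewrite cons_rV0; exact: cvg_id.
Qed.

Lemma continuous_cons2 n (t : R) :
  continuous (fun y : 'rV[R]_n => cons_rV (t, y)).
Proof.
move=> y; apply: (@cvg_rV _ _ _ (nbhs_filter y)) => i; case: (unliftP ord0 i) => [j ->|->].
  by under eq_fun do rewrite cons_rVS; rewrite cons_rVS; exact: continuous_coord.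
by under eq_fun do rewrite cons_rV0; rewrite cons_rV0; exact: cvg_cst.
Qed.

Lemma is_derive_cons1 n (u : 'rV[R]_n.+1 -> R) (t : R) (y : 'rV[R]_n) :
  derivable u (cons_rV (t, y)) (delta_mx 0 ord0) ->
  is_derive t 1 (fun t => u (cons_rV (t, y))) (partial ord0 u (cons_rV (t, y))).
Proof.
move=> du.
have E : (fun h : R => h^-1 *: (((fun t => u (cons_rV (t, y))) \o shift t) (h *: 1)
     - u (cons_rV (t, y)))) =
   (fun h : R => h^-1 *: ((u \o shift (cons_rV (t, y))) (h *: delta_mx 0 ord0)
     - u (cons_rV (t, y)))).
  by apply/funext => h /=; rewrite /shift /= -cons_rV_shift0 /GRing.scale/= mulr1.
split; first by rewrite /derivable E.
by rewrite /partial /derive E.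
Qed.

Lemma is_derive_cons2 n (u : 'rV[R]_n.+1 -> R) (t : R) (y : 'rV[R]_n) i :
  derivable u (cons_rV (t, y)) (delta_mx 0 (lift ord0 i)) ->
  is_derive y (delta_mx 0 i) (fun y => u (cons_rV (t, y)))
    (partial (lift ord0 i) u (cons_rV (t, y))).
Proof.
move=> du.
have E : (fun h : R => h^-1 *: (((fun y => u (cons_rV (t, y))) \o shift y)
    (h *: delta_mx 0 i) - u (cons_rV (t, y)))) =
   (fun h : R => h^-1 *: ((u \o shift (cons_rV (t, y)))
     (h *: delta_mx 0 (lift ord0 i)) - u (cons_rV (t, y)))).
  by apply/funext => h /=; rewrite /shift /= -cons_rV_shiftS.
split; first by rewrite /derivable E.
by rewrite /partial /derive E.
Qed.

(** One constant records both compactness and the distance to the faces of the orthant, as in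
    [C1c]. *)
Definition in_box (k n : nat) (M : R) (x : 'rV[R]_n) :=
  forall i : 'I_n, `|x 0 i| <= M /\ ((n - k <= i)%N -> M^-1 <= x 0 i).

(** The class in which the induction on the dimension runs: it is stable under freezing the first
    variable and under differences, and it contains the test functions and their partial
    derivatives. *)
Definition testC1 (k n : nat) (u : 'rV[R]_n -> R) :=
  [/\ continuous u, forall i, continuous (partial i u),
    forall i x, derivable u x (delta_mx 0 i) &
    exists2 M, 0 < M & forall x,
      u x != 0 \/ (exists i, partial i u x != 0) -> in_box k M x].

(** The induction lowers the dimension with [k] fixed: removing the first variable keeps the
    positive coordinates last, and once the dimension is at most [k] the truncated subtraction makes
    every coordinate positive. The variable split off is thus a half-line one exactly when
    [n < k]. *)
Lemma box_cons0 k n : (n.+1 - k <= (ord0 : 'I_n.+1))%N = (n < k)%N.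
Proof. by rewrite leqn0 subn_eq0. Qed.

Lemma box_consS k n (i : 'I_n) :
  (n.+1 - k <= lift ord0 i)%N = (n - k <= i)%N.
Proof.
rewrite /= /bump /= add1n; case: (leqP k n) => [kn|nk].
  by rewrite subSn.
have /eqP -> : (n.+1 - k == 0)%N by rewrite subn_eq0.
by have /eqP -> : (n - k == 0)%N by rewrite subn_eq0 ltnW.
Qed.

Lemma testC1_sect1 k n (u : 'rV[R]_n.+1 -> R) y : testC1 k u ->
  C1c (n < k)%N (fun t => u (cons_rV (t, y)))
    (fun t => partial ord0 u (cons_rV (t, y))).
Proof.
move=> [cu cdu du [M M0 uM]]; split.
- by move=> t; apply: is_derive_cons1; exact: du.
- move=> t; apply: (@continuous_comp _ _ _ (fun t => cons_rV (t, y)) (partial ord0 u)).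
    exact: continuous_cons1.
  exact: cdu.
- exists M => // t h; have : in_box k M (cons_rV (t, y)).
    by apply: uM; case/orP: h => h; [left|right; exists ord0].
  by move=> /(_ ord0); rewrite box_cons0 cons_rV0.
Qed.

Lemma partial_cons2 n (u : 'rV[R]_n.+1 -> R) t i :
  (forall i x, derivable u x (delta_mx 0 i)) ->
  partial i (fun y : 'rV[R]_n => u (cons_rV (t, y))) =
  (fun y => partial (lift ord0 i) u (cons_rV (t, y))).
Proof.
move=> du; apply/funext => y.
by have [_ <-] := is_derive_cons2 (du (lift ord0 i) (cons_rV (t, y))).
Qed.

Lemma testC1_sect2 k n (u : 'rV[R]_n.+1 -> R) t : testC1 k u ->
  testC1 k (fun y => u (cons_rV (t, y))).
Proof.
move=> [cu cdu du [M M0 uM]]; split.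
- move=> y; apply: (@continuous_comp _ _ _ (fun y => cons_rV (t, y)) u).
    exact: continuous_cons2.
  exact: cu.
- move=> i y; rewrite partial_cons2//.
  apply: (@continuous_comp _ _ _ (fun y => cons_rV (t, y)) (partial (lift ord0 i) u)).
    exact: continuous_cons2.
  exact: cdu.
- by move=> i y; case: (is_derive_cons2 (du (lift ord0 i) (cons_rV (t, y)))).
- exists M => // y h i.
  have : in_box k M (cons_rV (t, y)).
    apply: uM; case: h => [h|[j h]]; first by left.
    by right; exists (lift ord0 j); rewrite partial_cons2 in h.
  by move=> /(_ (lift ord0 i)); rewrite box_consS cons_rVS.
Qed.

Lemma box_bound n (f : 'rV[R]_n -> R) k M : continuous f ->
  (forall x, f x != 0 -> in_box k M x) -> exists2 K, 0 <= K & forall x, `|f x| <= K.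
Proof.
move=> cf fM.
pose B := [set x : 'rV[R]_n | forall i, `[- M, M]%classic (x ord0 i)].
have cB : compact B by apply: (@rV_compact _ n (fun=> `[- M, M]%classic)) => i; exact: segment_compact.
have : compact (f @` B).
  by apply: continuous_compact => //; apply: continuous_subspaceT.
move=> /compact_bounded [K [_ hK]].
exists (Num.max 0 (K + 1)); first by rewrite le_max lexx.
move=> x; have [->|fx] := eqVneq (f x) 0; first by rewrite normr0 le_max lexx.
rewrite le_max; apply/orP; right; apply: hK; first by rewrite ltrDl.
exists x => // i; rewrite /= in_itv/= -ler_norml.
by have [] := fM x fx i.
Qed.

Lemma dominated_box n (f : 'rV[R]_n -> R) k M K : measurable_fun setT f ->
  0 <= K -> (forall x, f x != 0 -> in_box k M x) -> (forall x, `|f x| <= K) ->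
  dominated (@envn R n) f.
Proof.
move=> mf K0 fM fK; split => //.
(* The exponential is the inverse of the minimum of [envn] on the cube of half-width [M]. *)
exists (K * expR (n%:R * M ^+ 2 / 4)); first by rewrite mulr_ge0// expR_ge0.
move=> x; have [->|fx] := eqVneq (f x) 0.
  by rewrite normr0 !mulr_ge0// ?expR_ge0.
rewrite -mulrA /envn -expRD (le_trans (fK x))// -[leLHS]mulr1 ler_wpM2l//.
rewrite -[X in X <= _]expR0 ler_expR subr_ge0 ler_wpM2r// /sqnorm.
apply: (@le_trans _ _ (\sum_(i < n) M ^+ 2)); last first.
  by rewrite sumr_const card_ord mulr_natl.
apply: ler_sum => i _; have [xM _] := fM x fx i.
rewrite -(real_normK (num_real _)) ler_sqr ?nnegrE//.
exact: le_trans xM.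
Qed.

Lemma dominated_cbox n (f : 'rV[R]_n -> R) k M : continuous f ->
  (forall x, f x != 0 -> in_box k M x) -> dominated (@envn R n) f.
Proof.
move=> cf fM; have [K K0 fK] := box_bound cf fM.
by apply: dominated_box fM fK => //; exact: continuous_measurable_rV.
Qed.

Lemma testC1_dominated k n (u : 'rV[R]_n -> R) : testC1 k u ->
  dominated (@envn R n) u.
Proof.
move=> [cu cdu du [M M0 uM]].
by apply: (dominated_cbox cu (M := M)) => x ux; apply: uM; left.
Qed.

Lemma testC1_dominated_partial k n (u : 'rV[R]_n -> R) i : testC1 k u ->
  dominated (@envn R n) (partial i u).
Proof.
move=> [cu cdu du [M M0 uM]].
apply: (dominated_cbox (cdu i) (M := M)) => x ux; apply: uM.
by right; exists i.
Qed.

Lemma continuous_mulr (T : topologicalType) (f g : T -> R) :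
  continuous f -> continuous g -> continuous (fun x => f x * g x).
Proof. by move=> cf cg x; apply: cvgM; [exact: cf|exact: cg]. Qed.

Lemma continuous_sumr (T : topologicalType) (I : Type) (r : seq I) (P : pred I)
    (f : I -> T -> R) : (forall i, continuous (f i)) ->
  continuous (fun x => \sum_(i <- r | P i) f i x).
Proof.
move=> cf; elim: r => [|i r ih] x.
  by under eq_fun do rewrite big_nil; exact: cvg_cst.
have [Pi|Pi] := boolP (P i).
  under eq_fun do rewrite big_cons Pi.
  by apply: cvgD; [exact: cf|exact: ih].
under eq_fun do rewrite big_cons (negbTE Pi).
exact: ih.
Qed.

Lemma continuous_prodr (T : topologicalType) (I : Type) (r : seq I) (P : pred I)
    (f : I -> T -> R) : (forall i, continuous (f i)) ->
  continuous (fun x => \prod_(i <- r | P i) f i x).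
Proof.
move=> cf; elim: r => [|i r ih] x.
  by under eq_fun do rewrite big_nil; exact: cvg_cst.
have [Pi|Pi] := boolP (P i).
  under eq_fun do rewrite big_cons Pi.
  by apply: cvgM; [exact: cf|exact: ih].
under eq_fun do rewrite big_cons (negbTE Pi).
exact: ih.
Qed.

Lemma continuous_sqnorm n : continuous (@sqnorm R n).
Proof.
apply: continuous_sumr => i.
rewrite (_ : (fun y => _) = (fun y : 'rV[R]_n => y 0 i * y 0 i)).
  by apply: continuous_mulr; exact: continuous_coord.
by apply/funext => y; rewrite expr2.
Qed.

Lemma testC1_dominated_moment k n (u : 'rV[R]_n -> R) : testC1 k u ->
  dominated (@envn R n) (fun x => sqnorm x * (u x * u x)).
Proof.
move=> [cu cdu du [M M0 uM]].
apply: (@dominated_cbox _ _ k M) => [|x ux].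
  apply: continuous_mulr; first exact: continuous_sqnorm.
  exact: continuous_mulr.
apply: uM; left; apply: contraNneq ux => ->.
by rewrite !mulr0.
Qed.

Definition ws (b h : bool) : R -> R := if b then w1 h else w0 h.

(* On the orthant, [modes k None] is the ground state and [modes k (Some i)] is
   [x_i * ground_state k] if [i < n - k], and 0 otherwise. *)
Definition modes (k n : nat) (j : option 'I_n) (x : 'rV[R]_n) : R :=
  \prod_(l < n) ws (j == Some l) (n - k <= l)%N (x 0 l).

Lemma dominated_ws b h : dominated env1 (ws b h).
Proof. by case: b; [exact: dominated_w1|exact: dominated_w0]. Qed.

Lemma modes_cons_None k n t (y : 'rV[R]_n) :
  modes k None (cons_rV (t, y)) = w0 (n < k)%N t * modes k None y.
Proof.
rewrite /modes big_ord_recl cons_rV0 box_cons0; congr (_ * _).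
by apply: eq_bigr => l _; rewrite cons_rVS box_consS.
Qed.

Lemma modes_cons_0 k n t (y : 'rV[R]_n) :
  modes k (Some ord0) (cons_rV (t, y)) = w1 (n < k)%N t * modes k None y.
Proof.
rewrite /modes big_ord_recl cons_rV0 box_cons0 eqxx; congr (_ * _).
by apply: eq_bigr => l _; rewrite cons_rVS box_consS.
Qed.

Lemma modes_cons_S k n t (y : 'rV[R]_n) i :
  modes k (Some (lift ord0 i)) (cons_rV (t, y)) =
  w0 (n < k)%N t * modes k (Some i) y.
Proof.
rewrite /modes big_ord_recl cons_rV0 box_cons0; congr (_ * _).
by apply: eq_bigr => l _; rewrite cons_rVS box_consS.
Qed.

Lemma dominated_modes k n (j : option 'I_n) : dominated (@envn R n) (modes k j).
Proof.
elim: n j => [|n ih] j.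
  split.
    by apply: continuous_measurable_rV; apply: continuous_prodr => -[].
  by exists 1 => // x; rewrite /modes /envn /sqnorm !big_ord0 mul0r oppr0 expR0 normr1 mulr1.
split.
  apply: measurable_prod => l _.
  have [mw _] := dominated_ws (j == Some l) (n.+1 - k <= l)%N.
  exact: (measurableT_comp mw (@measurable_coord R n.+1 l)).
have main b j' : (forall t y, modes k j (cons_rV (t, y)) =
    ws b (n < k)%N t * modes k j' y) ->
    exists2 C, 0 <= C & forall x, `|modes k j x| <= C * envn x.
  move=> E; have [_ [C C0 hC]] := dominated_ws b (n < k)%N.
  have [_ [D D0 hD]] := ih j'; exists (C * D); first exact: mulr_ge0.
  apply: cons_rV_ind => t y; rewrite E envn_cons normrM mulrACA.
  by rewrite ler_pM.
case: j main => [i|] main; last first.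
  by apply: (main false None) => t y; rewrite modes_cons_None.
case: (unliftP ord0 i) => [l li|l0] in main *; subst i.
  by apply: (main false (Some l)) => t y; rewrite modes_cons_S.
by apply: (main true None) => t y; rewrite modes_cons_0.
Qed.

Definition gram k n (i j : option 'I_n) : R :=
  \int[lebesgue_rV n]_x (modes k i x * modes k j x).

Lemma dominated_gram k n (i j : option 'I_n) :
  dominated (@envn R n) (fun x => modes k i x * modes k j x).
Proof. by apply: (dominatedM (envelope_envn n)); exact: dominated_modes. Qed.

Lemma gram_cons k n (i j : option 'I_n.+1) (i' j' : option 'I_n) bi bj :
  (forall t y, modes k i (cons_rV (t, y)) = ws bi (n < k)%N t * modes k i' y) ->
  (forall t y, modes k j (cons_rV (t, y)) = ws bj (n < k)%N t * modes k j' y) ->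
  gram k i j = \int[leb]_t (ws bi (n < k)%N t * ws bj (n < k)%N t) * gram k i' j'.
Proof.
move=> Ei Ej; rewrite /gram int_cons; last exact: dominated_gram.
rewrite -RintegralZr//; last first.
  apply: (dominated_integrable envelope_env1).
  by apply: (dominatedM envelope_env1); exact: dominated_ws.
apply: eq_Rintegral => t _.
rewrite -(intZ (envelope_envn n)); last exact: dominated_gram.
by apply: eq_Rintegral => y _; rewrite Ei Ej; ring.
Qed.

Lemma int_ws01 h : \int[leb]_t (ws false h t * ws true h t) = 0.
Proof. exact: int_w01. Qed.

Lemma int_ws10 h : \int[leb]_t (ws true h t * ws false h t) = 0.
Proof. by rewrite -(int_w01 h); apply: eq_Rintegral => t _; rewrite mulrC. Qed.

(** Splitting off the first variable, either the two factors are [w0] and [w1], which are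
    orthogonal, or both are [w0] and the remaining indices still differ. *)
Lemma gram_orth k n (i j : option 'I_n) : i != j -> gram k i j = 0.
Proof.
elim: n i j => [|n ih] i j; first by case: i => [[]//|]; case: j => [[]//|].
have cases (P : option 'I_n.+1 -> Prop) : P None -> P (Some ord0) ->
    (forall l, P (Some (lift ord0 l))) -> forall o, P o.
  move=> h1 h2 h3 [p|] //.
  by case: (unliftP ord0 p) => [l ->|->].
have E0 t (y : 'rV[R]_n) := modes_cons_None k t y.
have E1 t (y : 'rV[R]_n) := modes_cons_0 k t y.
have E2 l t (y : 'rV[R]_n) := modes_cons_S k t y l.
move: j; elim/cases : i => [||l]; apply: cases => [||m] // ij.
- by rewrite (gram_cons (bi := false) (bj := true) E0 E1) int_ws01 mul0r.
- by rewrite (gram_cons (bi := false) (bj := false) E0 (E2 m)) ih ?mulr0.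
- by rewrite (gram_cons (bi := true) (bj := false) E1 E0) int_ws10 mul0r.
- by rewrite (gram_cons (bi := true) (bj := false) E1 (E2 m)) int_ws10 mul0r.
- by rewrite (gram_cons (bi := false) (bj := false) (E2 l) E0) ih ?mulr0.
- by rewrite (gram_cons (bi := false) (bj := true) (E2 l) E1) int_ws01 mul0r.
- by rewrite (gram_cons (bi := false) (bj := false) (E2 l) (E2 m)) ih ?mulr0.
Qed.

Lemma int_rV0 (f : 'rV[R]_0 -> R) : \int[lebesgue_rV 0]_x f x = f 0.
Proof.
transitivity (\int[lebesgue_rV 0]_x f 0).
  by apply: eq_Rintegral => x _; congr f; apply/rowP => -[].
rewrite Rintegral_cst// -[RHS]mulr1; congr (_ * _).
by rewrite -[RHS]/(fine (1%:E : \bar R)); congr fine; exact: diracT.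
Qed.

Lemma gramE k n : gram k (None : option 'I_n.+1) None =
  N0 (n < k)%N * gram k (None : option 'I_n) None.
Proof.
have E0 t (y : 'rV[R]_n) := modes_cons_None k t y.
exact: (gram_cons (bi := false) (bj := false) E0 E0).
Qed.

Lemma gramE0 k n : gram k (Some (ord0 : 'I_n.+1)) (Some ord0) =
  N1 (n < k)%N * gram k (None : option 'I_n) None.
Proof.
have E1 t (y : 'rV[R]_n) := modes_cons_0 k t y.
exact: (gram_cons (bi := true) (bj := true) E1 E1).
Qed.

Lemma gramES k n (i : 'I_n) : gram k (Some (lift ord0 i)) (Some (lift ord0 i)) =
  N0 (n < k)%N * gram k (Some i) (Some i).
Proof.
have E2 t (y : 'rV[R]_n) := modes_cons_S k t y i.
exact: (gram_cons (bi := false) (bj := false) E2 E2).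
Qed.

Lemma gram_gt0 k n : 0 < gram k (None : option 'I_n) None.
Proof.
elim: n => [|n ih]; last by rewrite gramE mulr_gt0// N0_gt0.
by rewrite /gram int_rV0 /modes !big_ord0 mulr1.
Qed.

Lemma gram_ge0 k n (i : option 'I_n) : 0 <= gram k i i.
Proof. by apply: Rintegral_ge0 => x _; rewrite -expr2 sqr_ge0. Qed.

(** Holds also for the modes of half-line coordinates, which are zero, since 0 is its own inverse
    here. *)
Lemma gram_inv k n (i : option 'I_n) : (gram k i i)^-1 ^+ 2 * gram k i i = (gram k i i)^-1.
Proof.
have [->|g0] := eqVneq (gram k i i) 0; first by rewrite invr0 mulr0.
by rewrite expr2 -mulrA mulVf// mulr1.
Qed.

(** A single factor [N0 false] is replaced by [N1 false], which is half of it. This gives the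
    positive norm needed for sharpness. *)
Lemma gram_free k n (i : 'I_n) : (i < n - k)%N ->
  gram k (Some i) (Some i) = gram k (None : option 'I_n) None / 2.
Proof.
elim: n i => [|n ih] i ik; first by case: i ik.
case: (unliftP ord0 i) ik => [j ->|->] ik.
  rewrite gramES gramE ih ?mulrA//.
  by move: ik; rewrite !ltnNge box_consS.
rewrite gramE0 gramE.
have -> : (n < k)%N = false by move: ik; rewrite ltnNge box_cons0 => /negbTE.
by rewrite N1_false; ring.
Qed.

(** The real-valued deficit, with n + 2k written as a sum of one-dimensional ground energies so that
    it also has the right meaning for the dimensions below [k] met by the induction. *)
Definition energy (k n : nat) (u : 'rV[R]_n -> R) : R :=
  \sum_(i < n) \int[lebesgue_rV n]_x (partial i u x * partial i u x) +
  \int[lebesgue_rV n]_x (sqnorm x * (u x * u x)) -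
  (\sum_(i < n) E1 (n - k <= i)%N) * \int[lebesgue_rV n]_x (u x * u x).

(** The weight is 4 minus the excess of the level over the ground energy, which is 0 for [None] and
    2 for [Some i]. *)
Definition coef n (j : option 'I_n) : R := if j is Some _ then 2 else 4.

Lemma testC1_dominated2_moments k n (u : 'rV[R]_n.+1 -> R) : testC1 k u ->
  dominated2 env1 (@envn R n)
    (fun t y => sqnorm y * (u (cons_rV (t, y)) * u (cons_rV (t, y)))) /\
  dominated2 env1 (@envn R n)
    (fun t y => t * t * (u (cons_rV (t, y)) * u (cons_rV (t, y)))).
Proof.
move=> tu; have du := testC1_dominated tu.
have duu : dominated (@envn R n.+1) (fun x => u x * u x).
  exact: (dominatedM (envelope_envn n.+1)).
have d2uu := dominated_cons duu.
have d2m := dominated_cons (testC1_dominated_moment tu).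
have d2y : dominated2 env1 (@envn R n)
    (fun t y => sqnorm y * (u (cons_rV (t, y)) * u (cons_rV (t, y)))).
  split.
    apply: measurable_funM; last by case: d2uu.
    exact: (measurableT_comp (@measurable_sqnorm R n) measurable_snd).
  have [_ [C C0 hC]] := d2m; exists C => // t y; apply: le_trans (hC t y).
  rewrite !normrM ler_wpM2r ?mulr_ge0// sqnorm_cons.
  by rewrite !ger0_norm ?addr_ge0 ?sqnorm_ge0 ?sqr_ge0// lerDr sqr_ge0.
split=> //; have := dominated2B d2m d2y; congr dominated2.
by apply/funext => t; apply/funext => y; rewrite sqnorm_cons; ring.
Qed.

Lemma energy_cons k n (u : 'rV[R]_n.+1 -> R) : testC1 k u ->
  energy k u =
  \int[lebesgue_rV n]_y
    (\int[leb]_t (let v := u (cons_rV (t, y)) in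
      let dv := partial ord0 u (cons_rV (t, y)) in
      dv * dv + t * t * (v * v) - E1 (n < k)%N * (v * v))) +
  \int[leb]_t energy k (fun y => u (cons_rV (t, y))).
Proof.
move=> tu; have du := testC1_dominated tu.
have dpu i := testC1_dominated_partial i tu.
have dmu := testC1_dominated_moment tu.
have en := envelope_envn (R := R) n.
have eN := envelope_envn (R := R) n.+1.
have e1 := envelope_env1 (R := R).
have duu : dominated (@envn R n.+1) (fun x => u x * u x) by exact: (dominatedM eN).
have dpp i : dominated (@envn R n.+1) (fun x => partial i u x * partial i u x).
  exact: (dominatedM eN).
pose phi t y := u (cons_rV (t, y)).
have d2uu := dominated_cons duu.
have d2pp i := dominated_cons (dpp i).
have d2m := dominated_cons dmu.
have [d2y d2t] := testC1_dominated2_moments tu.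
have D1 y : \int[leb]_t (let v := u (cons_rV (t, y)) in
      let dv := partial ord0 u (cons_rV (t, y)) in
      dv * dv + t * t * (v * v) - E1 (n < k)%N * (v * v)) =
   \int[leb]_t (partial ord0 u (cons_rV (t, y)) * partial ord0 u (cons_rV (t, y)))
   + \int[leb]_t (t * t * (phi t y * phi t y)) -
   E1 (n < k)%N * \int[leb]_t (phi t y * phi t y).
  have h1 := dominated2_sect1 e1 en y (d2pp ord0).
  have h2 := dominated2_sect1 e1 en y d2t.
  have h3 := dominated2_sect1 e1 en y d2uu.
  rewrite (intB e1); [|exact: dominatedD|exact: dominatedZ].
  by rewrite (intD e1)// (intZ e1).
under eq_Rintegral do rewrite D1.
have i1 := dominated2_int1 e1 en (d2pp ord0).
have i2 := dominated2_int1 e1 en d2t.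
have i3 := dominated2_int1 e1 en d2uu.
rewrite (intB en); [|exact: dominatedD|exact: dominatedZ].
rewrite (intD en)// (intZ en)//.
rewrite /energy.
have j1 i := dominated2_int2 e1 en (d2pp (lift ord0 i)).
have j2 := dominated2_int2 e1 en d2y.
have j3 := dominated2_int2 e1 en d2uu.
have dc i x : derivable u x (delta_mx 0 i) by case: tu.
have Im : \int[lebesgue_rV n.+1]_x (sqnorm x * (u x * u x)) =
    \int[lebesgue_rV n]_y \int[leb]_t (t * t * (phi t y * phi t y)) +
    \int[leb]_t \int[lebesgue_rV n]_y (sqnorm y * (phi t y * phi t y)).
  rewrite (int_cons dmu) -(int_fubini e1 en d2t) -(intD e1)//; last first.
    exact: (dominated2_int2 e1 en d2t).
  apply: eq_Rintegral => t _; rewrite -(intD en); last 2 first.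
  - exact: (dominated2_sect2 e1 en t d2t).
  - exact: (dominated2_sect2 e1 en t d2y).
  by apply: eq_Rintegral => y _; rewrite sqnorm_cons /phi; ring.
have Ie t : \sum_(i < n) \int[lebesgue_rV n]_x
      (partial i (fun y => u (cons_rV (t, y))) x *
       partial i (fun y => u (cons_rV (t, y))) x) =
    \sum_(i < n) \int[lebesgue_rV n]_y (partial (lift ord0 i) u (cons_rV (t, y)) *
       partial (lift ord0 i) u (cons_rV (t, y))).
  by apply: eq_bigr => i _; rewrite partial_cons2.
under [X in _ = _ + X]eq_Rintegral => t _ do rewrite Ie.
rewrite (intB e1); [|apply: dominatedD => //; apply: dominated_sum => i _; exact: j1|exact: dominatedZ].
rewrite (intD e1)//; last by apply: dominated_sum => i _; exact: j1.
rewrite (int_sum e1); last by move=> i _; exact: j1.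
rewrite (intZ e1)// Im.
rewrite !big_ord_recl box_cons0 (int_cons' (dpp ord0)).
rewrite (eq_bigr _ (fun i _ => int_cons (dpp (lift ord0 i)))).
have SE : \sum_(i < n) E1 (n.+1 - k <= lift ord0 i)%N =
    \sum_(i < n) E1 (n - k <= i)%N :> R.
  by apply: eq_bigr => i _; rewrite box_consS.
rewrite SE mulrDl {1}(int_cons' duu) (int_cons duu) /phi.
have shuffle (a b c d e f : R) :
  a + b + (c + d) - (e + f) = a + c - e + (b + d - f) by ring.
exact: shuffle.
Qed.

End rV_integral.

(** * Induction on the dimension *)

Section gap.
Context {R : realType}.
Notation leb := (@lebesgue_measure R).
Notation env1 := (@env1 R).

Lemma big_option (I : finType) (F : option I -> R) :
  \sum_j F j = F None + \sum_i F (Some i).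
Proof.
rewrite (bigD1 None)//=; congr +%R.
rewrite (reindex_omap (fun i => Some i) id); last by case.
by apply: eq_bigl => i /=; rewrite eqxx.
Qed.

Lemma bessel_modes k n psi : dominated (@envn R n) psi ->
  \sum_j (gram k j j)^-1 * (\int[lebesgue_rV n]_x (modes k j x * psi x)) ^+ 2 <=
  \int[lebesgue_rV n]_x (psi x * psi x).
Proof.
move=> dpsi; apply: (bessel (envelope_envn n)) => //.
- by move=> j; exact: dominated_modes.
- by move=> i j; exact: gram_orth.
- by move=> j; exact: gram_inv.
Qed.

Lemma bessel_ws h psi : dominated env1 psi ->
  \sum_(b : bool) (if b then N1 h else N0 h)^-1 *
    (\int[leb]_x (ws b h x * psi x)) ^+ 2 <=
  \int[leb]_x (psi x * psi x).
Proof.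
move=> dpsi; apply: (bessel envelope_env1) => //.
- by move=> j; exact: dominated_ws.
- by move=> [] [] // _; [exact: int_ws10|exact: int_ws01].
- move=> b; set c := if b then _ else _.
  have -> : \int[leb]_x (ws b h x * ws b h x) = c by rewrite /c; case: (b).
  have [->|c0] := eqVneq c 0; first by rewrite invr0 mulr0.
  by rewrite expr2 -mulrA mulVf// mulr1.
Qed.

(** Here [nf] and [nt] are the inverse norms in the first variable, [a] that of the ground state in
    the others, [pf], [pt], [q], [X] the squares of the projections in one group of variables only,
    and [cf], [ct], [Y] those of the double projections. The conclusion is twice the sum of the
    hypotheses. *)
Lemma gap_algebra (U nf nt a pf pt q cf ct X Y : R) :
  nt * (pt - a * ct ^+ 2) + nf * (pf - a * cf ^+ 2) <= U - a * q ->
  a * (q - nf * cf ^+ 2) + (X - nf * Y) <= U - nf * pf ->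
  4 * U - (4 * (nf * a * cf ^+ 2) + (2 * (nt * a * ct ^+ 2) + 2 * (nf * Y))) <=
  4 * U - 4 * (nf * pf) - 2 * (nt * pt) + (4 * U - (4 * (a * q) + 2 * X)).
Proof. by move=> h1 h2; lra. Qed.

(* With P, Q (resp. P', Q'_i) the projections on the modes of the first variable
   (resp. of the others), the one-dimensional inequality and the induction
   hypothesis leave [4 (1 - P) (1 - P') - 2 Q (1 - P') - 2 Q' (1 - P)]
   = [2 (1 - P - Q) (1 - P') + 2 (1 - P) (1 - P' - Q')], which is nonnegative. *)
Lemma energy_gap k n (u : 'rV[R]_n -> R) : testC1 k u ->
  4 * \int[lebesgue_rV n]_x (u x * u x) -
  \sum_j coef j * ((gram k j j)^-1 *
    (\int[lebesgue_rV n]_x (modes k j x * u x)) ^+ 2) <= energy k u.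
Proof.
elim: n u => [|n ih] u tu.
  rewrite /energy !big_ord0 mul0r subr0 add0r big_option big_ord0 addr0 /gram.
  rewrite !int_rV0 /modes /sqnorm !big_ord0 mul0r !mul1r invr1 mul1r /coef.
  by rewrite expr2 subrr.
have en := envelope_envn (R := R) n.
have eN := envelope_envn (R := R) n.+1.
have e1 := envelope_env1 (R := R).
have du := testC1_dominated tu.
have dpu i := testC1_dominated_partial i tu.
have dmu := testC1_dominated_moment tu.
have duu : dominated (@envn R n.+1) (fun x => u x * u x) by exact: (dominatedM eN).
pose phi t y := u (cons_rV (t, y)).
have d2 : dominated2 env1 (@envn R n) phi := dominated_cons du.
have d2uu : dominated2 env1 (@envn R n) (fun t y => phi t y * phi t y) :=
  dominated_cons duu.
pose h := (n < k)%N.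
pose p b y := \int[leb]_t (ws b h t * phi t y).
pose Q j t := \int[lebesgue_rV n]_y (modes k j y * phi t y).
have dws b : dominated env1 (ws b h) := dominated_ws b h.
have dmo j : dominated (@envn R n) (modes k j) := dominated_modes k j.
have dp b : dominated (@envn R n) (p b).
  exact: (dominated2_int1 e1 en (dominated2Ml e1 en (dws b) d2)).
have dQ j : dominated env1 (Q j).
  exact: (dominated2_int2 e1 en (dominated2Mr e1 en (dmo j) d2)).
have pws b y : dominated env1 (fun t => ws b h t * phi t y) :=
  dominatedM e1 (dws b) (dominated2_sect1 e1 en y d2).
have pmo j t : dominated (@envn R n) (fun y => modes k j y * phi t y) :=
  dominatedM en (dmo j) (dominated2_sect2 e1 en t d2).
pose c b j := \int[leb]_t (ws b h t * Q j t).
have cE b j : \int[lebesgue_rV n]_y (modes k j y * p b y) = c b j.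
  have dbj : dominated2 env1 (@envn R n)
      (fun t y => ws b h t * (modes k j y * phi t y)).
    exact: (dominated2Ml e1 en (dws b) (dominated2Mr e1 en (dmo j) d2)).
  transitivity (\int[lebesgue_rV n]_y \int[leb]_t (ws b h t * (modes k j y * phi t y))).
    apply: eq_Rintegral => y _; rewrite -(intZ e1 _ (pws b y)).
    by apply: eq_Rintegral => t _; ring.
  transitivity (\int[leb]_t \int[lebesgue_rV n]_y (ws b h t * (modes k j y * phi t y))).
    exact: (esym (int_fubini e1 en dbj)).
  apply: eq_Rintegral => t _.
  by rewrite (intZ en _ (pmo j t)).
have modeE b j i : (forall (t : R) (y : 'rV[R]_n),
      modes k i (cons_rV (t, y)) = ws b h t * modes k j y) ->
    \int[lebesgue_rV n.+1]_x (modes k i x * u x) = c b j.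
  move=> E; rewrite int_cons; last first.
    by apply: (dominatedM eN) => //; exact: dominated_modes.
  apply: eq_Rintegral => t _; rewrite /Q -(intZ en _ (pmo j t)).
  apply: eq_Rintegral => y _.
  by rewrite E /phi; ring.
pose U := \int[lebesgue_rV n.+1]_x (u x * u x).
have U1 : U = \int[lebesgue_rV n]_y \int[leb]_t (phi t y * phi t y).
  by rewrite /U (int_cons' duu).
have U2 : U = \int[leb]_t \int[lebesgue_rV n]_y (phi t y * phi t y).
  by rewrite /U (int_cons duu).
pose a : R := (gram k (None : option 'I_n) None)^-1.
have g0 : gram k (None : option 'I_n) None != 0 :> R by rewrite gt_eqF// gram_gt0.
pose nn b := ((if b then N1 h else N0 h)^-1 : R).
have N00 : N0 h != 0 :> R by rewrite gt_eqF// N0_gt0.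
pose aj j := (gram k (j : option 'I_n) j)^-1 : R.
pose pp b := \int[lebesgue_rV n]_y (p b y) ^+ 2.
pose QQ j := \int[leb]_t (Q j t) ^+ 2.
(* Nonnegativity of (1 - P - Q)(1 - P'). *)
have T1 : \sum_(b : bool) nn b * (pp b - a * c b None ^+ 2) <= U - a * QQ None.
  have := @tensor_bessel _ _ _ _ R leb (lebesgue_rV n) _ _ e1 en bool
    (fun b => ws b h) nn (modes k None) a phi dws (dmo None) (mulVf g0)
    (@bessel_ws h) d2.
  rewrite -U1; apply: le_trans; rewrite le_eqVlt; apply/orP; left; apply/eqP.
  by apply: eq_bigr => b _; rewrite cE.
(* Nonnegativity of (1 - P)(1 - P' - Q'), by the same lemma with the two groups of variables
   exchanged. *)
have T2 : \sum_j aj j * (QQ j - nn false * c false j ^+ 2) <= U - nn false * pp false.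
  have d2' : dominated2 (@envn R n) env1 (fun y t => phi t y).
    case: d2 => m2 [C C0 hC]; split; last first.
      by exists C => // y t; rewrite mulrC [X in _ <= X](_ : _ = C * (env1 t * envn y)) ?hC//; ring.
    have := measurableT_comp m2 (@measurable_swap _ _ 'rV[R]_n (measurableTypeR R)).
    exact.
  have := @tensor_bessel _ _ _ _ R (lebesgue_rV n) leb _ _ en e1 _
    (fun j : option 'I_n => modes k j) aj (w0 h) (nn false) (fun y t => phi t y) dmo (dws false) (mulVf N00)
    (@bessel_modes k n) d2'.
  rewrite -U2; apply: le_trans; rewrite le_eqVlt; apply/orP; left; apply/eqP.
  by apply: eq_bigr => b _.
have [d2y d2t] := testC1_dominated2_moments tu.
have d2pp i : dominated2 env1 (@envn R n) (fun t y =>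
    partial i u (cons_rV (t, y)) * partial i u (cons_rV (t, y))).
  by apply: (dominated_cons (f := fun x => partial i u x * partial i u x)); exact: (dominatedM eN).
have D1 : 4 * U - 4 * (nn false * pp false) - 2 * (nn true * pp true) <=
   \int[lebesgue_rV n]_y
    (\int[leb]_t (let v := u (cons_rV (t, y)) in
      let dv := partial ord0 u (cons_rV (t, y)) in
      dv * dv + t * t * (v * v) - E1 h * (v * v))).
  have i1 := dominated2_int1 e1 en d2uu.
  have ip b : dominated (@envn R n) (fun y => nn b * p b y ^+ 2).
    by apply: dominatedZ; exact: (dominatedM en).
  rewrite U1 -(intZ en)// /pp -!(intZ en)//; try exact: (dominatedM en).
  rewrite -(intB en); [|exact: dominatedZ|exact: dominatedZ].
  rewrite -(intB en); [|by apply: dominatedB; exact: dominatedZ|exact: dominatedZ].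
  apply: (le_int en).
  - by do 2 (apply: dominatedB; last exact: dominatedZ); exact: dominatedZ.
  - apply: (dominated2_int1 e1 en); apply: dominated2B.
      by apply: dominated2D => //; exact: d2pp.
    exact: dominated2Z.
  - by move=> y; exact: (one_dim_gap (testC1_sect1 y tu)).
have D2 : 4 * U - \sum_j coef j * (aj j * QQ j) <=
   \int[leb]_t energy k (fun y => u (cons_rV (t, y))).
  have i2 := dominated2_int2 e1 en d2uu.
  have iQ2 j : dominated env1 (fun t => Q j t ^+ 2) := dominatedM e1 (dQ j) (dQ j).
  have iQ1 j : dominated env1 (fun t => aj j * Q j t ^+ 2) := dominatedZ (aj j) (iQ2 j).
  have iQ j : dominated env1 (fun t => coef j * (aj j * Q j t ^+ 2)) :=
    dominatedZ (coef j) (iQ1 j).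
  have -> : \sum_j coef j * (aj j * QQ j) =
      \int[leb]_t \sum_j coef j * (aj j * Q j t ^+ 2).
    rewrite (int_sum e1 _ (fun j _ => iQ j)); apply: eq_bigr => j _.
    by rewrite (intZ e1 _ (iQ1 j)) (intZ e1 _ (iQ2 j)).
  have iS : dominated env1 (fun t => \sum_j coef j * (aj j * Q j t ^+ 2)).
    by apply: dominated_sum.
  rewrite U2 -(intZ e1 _ i2) -(intB e1 (dominatedZ 4 i2) iS).
  apply: (le_int e1).
  - exact: (dominatedB (dominatedZ 4 i2) iS).
  - have dc i x : derivable u x (delta_mx 0 i) by case: tu.
    have Ie t : \sum_(i < n) \int[lebesgue_rV n]_x
          (partial i (fun y => u (cons_rV (t, y))) x *
           partial i (fun y => u (cons_rV (t, y))) x) =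
        \sum_(i < n) \int[lebesgue_rV n]_y (partial (lift ord0 i) u (cons_rV (t, y)) *
           partial (lift ord0 i) u (cons_rV (t, y))).
      by apply: eq_bigr => i _; rewrite (partial_cons2 t i dc).
    rewrite /energy; under eq_fun => t do rewrite Ie.
    apply: dominatedB; last exact: (dominatedZ _ i2).
    apply: dominatedD; last exact: (dominated2_int2 e1 en d2y).
    by apply: dominated_sum => i _; exact: (dominated2_int2 e1 en (d2pp _)).
  - by move=> t; exact: (ih _ (testC1_sect2 t tu)).
rewrite energy_cons//; apply: le_trans (lerD D1 D2).
rewrite -/U big_option big_ord_recl.
rewrite (modeE false None None (@modes_cons_None R k n)).
rewrite (modeE true None (Some ord0) (@modes_cons_0 R k n)).
pose X := \sum_i aj (Some i) * QQ (Some i).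
pose Y := \sum_i aj (Some i) * c false (Some i) ^+ 2.
rewrite [X in _ - (_ + (_ + X))](_ : _ = 2 * (nn false * Y)); last first.
  rewrite mulr_sumr mulr_sumr; apply: eq_bigr => i _.
  rewrite (modeE false (Some i) (Some (lift ord0 i)) (fun t y => modes_cons_S k t y i)).
  by rewrite gramES invfM -/(aj _) -[(N0 _)^-1]/(nn false) !mulrA.
rewrite gramE gramE0 !invfM -/a -[(N0 _)^-1]/(nn false) -[(N1 _)^-1]/(nn true).
have -> : \sum_j coef j * (aj j * QQ j) = 4 * (a * QQ None) + 2 * X.
  by rewrite big_option mulr_sumr.
have {}T1 : nn true * (pp true - a * c true None ^+ 2) +
    nn false * (pp false - a * c false None ^+ 2) <= U - a * QQ None.
  by move: T1; rewrite big_bool.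
have {}T2 : a * (QQ None - nn false * c false None ^+ 2) + (X - nn false * Y) <=
    U - nn false * pp false.
  move: T2; rewrite big_option; apply: le_trans.
  rewrite lerD2l le_eqVlt; apply/orP; left; apply/eqP.
  rewrite /X /Y mulr_sumr -sumrB; apply: eq_bigr => i _.
  by rewrite mulrBr; congr (_ - _); rewrite mulrCA.
exact: gap_algebra T1 T2.
Qed.

End gap.

(** * Square-integrable functions and the closure *)

Section L2.
Context d (T : measurableType d) (R : realType) (mu : {measure set T -> \bar R}).
Implicit Types f g h : T -> R.

Definition L2 f := measurable_fun setT f /\
  (\int[mu]_x (f x * f x)%:E < +oo)%E.

Lemma L2_sq_integrable f : L2 f -> mu.-integrable setT (EFin \o (fun x => f x * f x)).
Proof.
move=> [mf f2]; apply/integrableP; split.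
  by apply/measurable_EFinP; exact: measurable_funM.
apply: le_lt_trans f2; rewrite le_eqVlt; apply/orP; left; apply/eqP.
by apply: eq_integral => x _ /=; rewrite ger0_norm// -expr2 sqr_ge0.
Qed.

Lemma L2_mul f g : L2 f -> L2 g -> mu.-integrable setT (EFin \o (fun x => f x * g x)).
Proof.
move=> Lf Lg; have [mf _] := Lf; have [mg _] := Lg.
apply: (@le_integrable _ _ _ mu _ measurableT _
  (fun x => ((f x * f x)%:E + (g x * g x)%:E)%E)).
- by apply/measurable_EFinP; exact: measurable_funM.
- move=> x _ /=; rewrite lee_fin normrM.
  rewrite [leRHS]ger0_norm; last by rewrite addr_ge0// -expr2 sqr_ge0.
  rewrite -[X in _ <= X + _]expr2 -[X in _ <= _ + X]expr2.
  rewrite -[f x ^+ 2](real_normK (num_real _)) -[g x ^+ 2](real_normK (num_real _)).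
  have := sqr_ge0 (`|f x| - `|g x|); have := sqr_ge0 (`|f x| + `|g x|).
  by move: `|f x| `|g x| => a b; rewrite sqrrB sqrrD; nra.
- by apply: integrableD => //; exact: L2_sq_integrable.
Qed.

Lemma integrable_L2 f : measurable_fun setT f ->
  mu.-integrable setT (EFin \o (fun x => f x * f x)) -> L2 f.
Proof.
move=> mf /integrableP[_ f2]; split => //; apply: le_lt_trans f2.
rewrite le_eqVlt; apply/orP; left; apply/eqP.
by apply: eq_integral => x _ /=; rewrite ger0_norm// -expr2 sqr_ge0.
Qed.

Lemma L2D f g : L2 f -> L2 g -> L2 (fun x => f x + g x).
Proof.
move=> Lf Lg; have [mf _] := Lf; have [mg _] := Lg.
apply: integrable_L2; first exact: measurable_funD.
have i1 := L2_mul Lf Lf; have i2 := L2_mul Lg Lg; have i3 := L2_mul Lf Lg.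
apply: eq_integrable (integrableD measurableT (integrableD measurableT i1 i2)
   (integrableD measurableT i3 i3)) => // x _ /=.
by rewrite -!EFinD; congr EFin; ring.
Qed.

Lemma L2Z c f : L2 f -> L2 (fun x => c * f x).
Proof.
move=> Lf; have [mf _] := Lf.
apply: integrable_L2; first exact: measurable_funM.
apply: eq_integrable (integrableZl measurableT (c * c) (L2_mul Lf Lf)) => // x _ /=.
by rewrite -EFinM; congr EFin; ring.
Qed.

Lemma L2B f g : L2 f -> L2 g -> L2 (fun x => f x - g x).
Proof.
move=> Lf /(L2Z (-1)) Lg; have := L2D Lf Lg.
by under eq_fun do rewrite mulN1r.
Qed.

Lemma L20 : L2 (fun=> 0).
Proof.
split => //; under eq_integral do rewrite mulr0.
by rewrite integral0 ltry.
Qed.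

Lemma L2_sum (I : Type) (r : seq I) (P : pred I) (f : I -> T -> R) :
  (forall i, P i -> L2 (f i)) -> L2 (fun x => \sum_(i <- r | P i) f i x).
Proof.
move=> df; elim: r => [|i r ih].
  by under eq_fun do rewrite big_nil; exact: L20.
have [Pi|Pi] := boolP (P i); last first.
  by under eq_fun do rewrite big_cons (negbTE Pi).
under eq_fun do rewrite big_cons Pi.
by apply: L2D => //; exact: df.
Qed.

Definition ip f g := \int[mu]_x (f x * g x).

Lemma ipC f g : ip f g = ip g f.
Proof. by apply: eq_Rintegral => x _; rewrite mulrC. Qed.

Lemma ipDl f g h : L2 f -> L2 g -> L2 h ->
  ip (fun x => f x + g x) h = ip f h + ip g h.
Proof.
move=> Lf Lg Lh; rewrite /ip -RintegralD//; try exact: L2_mul.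
by apply: eq_Rintegral => x _; rewrite mulrDl.
Qed.

Lemma ipZl c f g : L2 f -> L2 g -> ip (fun x => c * f x) g = c * ip f g.
Proof.
move=> Lf Lg; rewrite /ip -RintegralZl//; try exact: L2_mul.
by apply: eq_Rintegral => x _; rewrite mulrA.
Qed.

Lemma ipBl f g h : L2 f -> L2 g -> L2 h ->
  ip (fun x => f x - g x) h = ip f h - ip g h.
Proof.
move=> Lf Lg Lh; rewrite /ip -RintegralB//; try exact: L2_mul.
by apply: eq_Rintegral => x _; rewrite mulrBl.
Qed.

Lemma ipDr f g h : L2 f -> L2 g -> L2 h ->
  ip h (fun x => f x + g x) = ip h f + ip h g.
Proof. by move=> Lf Lg Lh; rewrite ipC ipDl// !(ipC h). Qed.

Lemma ipBr f g h : L2 f -> L2 g -> L2 h ->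
  ip h (fun x => f x - g x) = ip h f - ip h g.
Proof. by move=> Lf Lg Lh; rewrite ipC ipBl// !(ipC h). Qed.

Lemma ipZr c f g : L2 f -> L2 g -> ip f (fun x => c * g x) = c * ip f g.
Proof. by move=> Lf Lg; rewrite ipC ipZl// ipC. Qed.

Lemma ip_suml (I : Type) (r : seq I) (P : pred I) (f : I -> T -> R) g :
  (forall i, P i -> L2 (f i)) -> L2 g ->
  ip (fun x => \sum_(i <- r | P i) f i x) g = \sum_(i <- r | P i) ip (f i) g.
Proof.
move=> df Lg; elim: r => [|i r ih].
  rewrite big_nil /ip; under eq_Rintegral do rewrite big_nil mul0r.
  by rewrite Rintegral_cst// mul0r.
have [Pi|Pi] := boolP (P i); last first.
  by rewrite big_cons (negbTE Pi); under [X in ip X]eq_fun do rewrite big_cons (negbTE Pi).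
rewrite big_cons Pi; under [X in ip X]eq_fun do rewrite big_cons Pi.
rewrite ipDl// ?ih//; first exact: df.
exact: L2_sum.
Qed.

Lemma ip_ge0 f : 0 <= ip f f.
Proof. by apply: Rintegral_ge0 => x _; rewrite -expr2 sqr_ge0. Qed.

Lemma ipE f : L2 f -> (\int[mu]_x (f x * f x)%:E)%E = (ip f f)%:E.
Proof.
by move=> Lf; rewrite /ip /Rintegral fineK//; exact: (integrable_fin_num _ (L2_mul Lf Lf)).
Qed.

Lemma cauchy_schwarz f g : L2 f -> L2 g -> ip f g ^+ 2 <= ip f f * ip g g.
Proof.
move=> Lf Lg.
have quad t : 0 <= ip f f - 2 * t * ip f g + t ^+ 2 * ip g g.
  have Ltg := L2Z t Lg.
  have := ip_ge0 (fun x => f x - t * g x).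
  rewrite ipBl ?ipBr ?ipZl ?ipZr//; try exact: L2B.
  rewrite (ipC g f); congr (_ <= _); ring.
have [g0|g0] := eqVneq (ip g g) 0.
  (* When [g] has norm 0 the quadratic is affine in [t]; at this point it would equal -1 unless
     [ip f g] vanishes. *)
  have h1 := quad ((ip f f + 1) / (2 * ip f g)).
  have [->|fg] := eqVneq (ip f g) 0; first by rewrite expr0n/= g0 mulr0.
  move: h1; rewrite g0 mulr0 addr0.
  have -> : 2 * ((ip f f + 1) / (2 * ip f g)) * ip f g = ip f f + 1 by field.
  by rewrite opprD addrA subrr add0r oppr_ge0 ler10.
have gp : 0 < ip g g by rewrite lt_neqAle eq_sym g0 ip_ge0.
have := quad (ip f g / ip g g).
have -> : ip f f - 2 * (ip f g / ip g g) * ip f g + (ip f g / ip g g) ^+ 2 * ip g g =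
  (ip f f * ip g g - ip f g ^+ 2) / ip g g by field.
by rewrite pmulr_lge0 ?invr_gt0// subr_ge0.
Qed.

Lemma cvg_ip0 (f : nat -> T -> R) g : (forall j, L2 (f j)) -> L2 g ->
  ip (f j) (f j) @[j --> \oo] --> 0 -> ip (f j) g @[j --> \oo] --> 0.
Proof.
move=> Lf Lg f0.
apply/cvgr0Pnorm_lt => e e0.
have g1 : 0 < ip g g + 1 by rewrite ltr_wpDl// ip_ge0.
have d0 : 0 < e ^+ 2 / (ip g g + 1) by rewrite divr_gt0// exprn_gt0.
move/cvgr0Pnorm_lt : f0 => /(_ _ d0); apply: filterS => j.
rewrite ger0_norm ?ip_ge0// => fj.
rewrite -ltr_sqr ?nnegrE// ?(ltW e0)// real_normK ?num_real//.
apply: le_lt_trans (cauchy_schwarz (Lf j) Lg) _.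
apply: (@le_lt_trans _ _ (ip (f j) (f j) * (ip g g + 1))).
  by rewrite ler_wpM2l ?ip_ge0// lerDl.
by rewrite -ltr_pdivlMr.
Qed.

Lemma cvg_ip (f_ g_ : nat -> T -> R) f g :
  (forall j, L2 (f_ j)) -> (forall j, L2 (g_ j)) -> L2 f -> L2 g ->
  ip (fun x => f x - f_ j x) (fun x => f x - f_ j x) @[j --> \oo] --> 0 ->
  ip (fun x => g x - g_ j x) (fun x => g x - g_ j x) @[j --> \oo] --> 0 ->
  ip (f_ j) (g_ j) @[j --> \oo] --> ip f g.
Proof.
move=> Lf_ Lg_ Lf Lg cf cg.
pose a j x := f x - f_ j x; pose b j x := g x - g_ j x.
have La j : L2 (a j) by exact: L2B.
have Lb j : L2 (b j) by exact: L2B.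
have E j : ip (f_ j) (g_ j) = ip f g - ip (a j) g - ip (b j) f + ip (a j) (b j).
  rewrite [ip (a j) (b j)]ipBr// [ip (b j) f]ipBl// !(@ipBl f (f_ j))//.
  by rewrite (ipC g f) (ipC (g_ j) f); ring.
have -> : (fun j => ip (f_ j) (g_ j)) =
    (fun j => ip f g - ip (a j) g - ip (b j) f + ip (a j) (b j)).
  by apply/funext => j; exact: E.
suff : ip f g - ip (a j) g - ip (b j) f + ip (a j) (b j) @[j --> \oo] -->
    ip f g - 0 - 0 + 0 by rewrite !subr0 addr0.
apply: cvgD; last first.
  apply/cvgr0Pnorm_lt => e e0.
  have h1 := cf; have h2 := cg.
  move/cvgr0Pnorm_lt : h1 => /(_ _ e0); move/cvgr0Pnorm_lt : h2 => /(_ _ e0).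
  apply: filterS2 => j; rewrite -/(a j) -/(b j) => bj aj.
  rewrite ger0_norm ?ip_ge0// in aj; rewrite ger0_norm ?ip_ge0// in bj.
  rewrite -ltr_sqr ?nnegrE// ?(ltW e0)// real_normK ?num_real//.
  apply: le_lt_trans (cauchy_schwarz (La j) (Lb j)) _.
  by rewrite expr2 ltr_pM// ip_ge0.
apply: cvgB; last exact: cvg_ip0.
by apply: cvgB; [exact: cvg_cst|exact: cvg_ip0].
Qed.

End L2.

(** * Test functions as members of the induction class *)

Section test_functions.
Context {R : realType}.

Lemma nbhs_eq0_partial n (u : 'rV[R]_n -> R) (x : 'rV[R]_n) i :
  (\near x, u x = 0) -> partial i u x = 0.
Proof.
move=> u0.
have d0 : is_derive x (delta_mx 0 i) (cst 0 : 'rV[R]_n -> R) 0.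
  exact: is_derive_cst.
have e : \near x, (cst 0 : 'rV[R]_n -> R) x = u x by apply: filterS u0 => y ->.
by have [_] := near_eq_is_derive e d0.
Qed.

Lemma supp_partial n (u : 'rV[R]_n -> R) (x : 'rV[R]_n) i :
  partial i u x != 0 -> supp u x.
Proof.
apply: contraNP => xu; apply/eqP; apply: nbhs_eq0_partial.
have : nbhs x (~` supp u) by apply: open_nbhs_nbhs; split => //; rewrite openC; exact: closed_closure.
apply: filterS => y yu; apply/eqP/negP => /negP uy; apply: yu.
exact: subset_closure.
Qed.

Lemma supp_neq0 n (u : 'rV[R]_n -> R) (x : 'rV[R]_n) : u x != 0 -> supp u x.
Proof. by move=> ux; exact: subset_closure. Qed.

(** Each coordinate maps [K] onto a compact set; for a positive coordinate it misses 0, hence a ball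
    around 0. The sum of the resulting constants dominates each of them. *)
Lemma compact_in_box k n (K : set 'rV[R]_n) : compact K -> K `<=` orthant k ->
  exists2 M, 0 < M & forall x, K x -> in_box k M x.
Proof.
move=> cK Ko.
have cim (i : 'I_n) : compact ((fun x : 'rV[R]_n => x 0 i) @` K).
  apply: continuous_compact => //; apply: continuous_subspaceT.
  exact: continuous_coord.
have one (i : 'I_n) : exists m : R, 0 < m /\ forall x, K x ->
    `|x 0 i| <= m /\ ((n - k <= i)%N -> m^-1 <= x 0 i).
  have /compact_bounded[b [_ hb]] := cim i.
  have b1 x : K x -> `|x 0 i| <= b + 1.
    by move=> Kx; apply: hb; rewrite ?ltrDl//; exists x.
  have [ki|ki] := boolP (n - k <= i)%N; last first.
    exists (Num.max 1 (b + 1)); split; first by rewrite lt_max ltr01.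
    by move=> x Kx; split => //; rewrite le_max b1// orbT.
  have clo : closed ((fun x : 'rV[R]_n => x 0 i) @` K).
    by apply: compact_closed => //; exact: Rhausdorff.
  have : nbhs (0 : R) (~` ((fun x : 'rV[R]_n => x 0 i) @` K)).
    apply: open_nbhs_nbhs; split; first by rewrite openC.
    by move=> [x Kx x0]; have := Ko x Kx i ki; rewrite x0 ltxx.
  move=> /nbhs_ballP[e /= e0 he].
  exists (Num.max e^-1 (b + 1)); split; first by rewrite lt_max invr_gt0 e0.
  move=> x Kx; split; first by rewrite le_max b1// orbT.
  move=> _; have x0 := Ko x Kx i ki.
  apply: (@le_trans _ _ e).
    by rewrite -[leRHS]invrK lef_pV2 ?posrE ?lt_max ?invr_gt0 ?e0// le_max lexx.
  rewrite leNgt; apply/negP => xe.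
  apply: (he (x 0 i)); last by exists x.
  by rewrite /ball/= sub0r normrN gtr0_norm.
have [m hm] := choice one.
exists (1 + \sum_i m i).
  by rewrite ltr_pwDl// sumr_ge0// => i _; have [/ltW] := hm i.
move=> x Kx i; have [m0 /(_ x Kx)[h1 h2]] := hm i.
have mle : m i <= 1 + \sum_i m i.
  rewrite (bigD1 i)//= addrCA lerDl addr_ge0// sumr_ge0// => j _.
  by have [/ltW] := hm j.
split; first exact: le_trans mle.
move=> /h2; apply: le_trans; rewrite lef_pV2 ?posrE//.
exact: lt_le_trans mle.
Qed.

Lemma test_function_testC1 k n (u : 'rV[R]_n -> R) : test_function k u -> testC1 k u.
Proof.
move=> [su cu uo]; split.
- by have [] := su [::].
- by move=> i; have [] := su [:: i].
- by move=> i x; have [_] := su [::]; exact.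
- have [M M0 hM] := compact_in_box cu uo.
  exists M => // x [ux|[i ux]]; apply: hM; first exact: supp_neq0.
  exact: supp_partial ux.
Qed.

Lemma test_function_partial k n (u : 'rV[R]_n -> R) i : test_function k u ->
  testC1 k (partial i u).
Proof.
move=> [su cu uo]; split.
- by have [] := su [:: i].
- by move=> j; have [] := su [:: j; i].
- by move=> j x; have [_] := su [:: i]; exact.
- have [M M0 hM] := compact_in_box cu uo.
  have sp x : partial i u x != 0 -> supp u x by exact: supp_partial.
  have ssub : supp (partial i u) `<=` supp u.
    have -> : supp u = closure (supp u).
      by apply/closure_id; rewrite /supp; exact: closed_closure.
    by apply: closure_subset => x; exact: sp.
  exists M => // x [ux|[j ux]]; apply: hM; first exact: sp.
  by apply: ssub; exact: supp_partial ux.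
Qed.

Lemma testC1_out k n (u : 'rV[R]_n -> R) x : testC1 k u -> ~ orthant k x -> u x = 0.
Proof.
move=> [_ _ _ [M M0 hM]] xo; apply/eqP/negP => /negP ux; apply: xo => i ki.
have [_ /(_ ki)] := hM x (or_introl ux) i.
by apply: lt_le_trans; rewrite invr_gt0.
Qed.

Lemma testC1_partial_out k n (u : 'rV[R]_n -> R) x i :
  testC1 k u -> ~ orthant k x -> partial i u x = 0.
Proof.
move=> [_ _ _ [M M0 hM]] xo; apply/eqP/negP => /negP ux; apply: xo => l kl.
have [_ /(_ kl)] := hM x (or_intror (ex_intro _ i ux)) l.
by apply: lt_le_trans; rewrite invr_gt0.
Qed.

Lemma continuous_subr (T : topologicalType) (f g : T -> R) :
  continuous f -> continuous g -> continuous (fun x => f x - g x).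
Proof. by move=> cf cg x; apply: cvgB; [exact: cf|exact: cg]. Qed.

Lemma partialB n (u v : 'rV[R]_n -> R) i x :
  derivable u x (delta_mx 0 i) -> derivable v x (delta_mx 0 i) ->
  partial i (fun y => u y - v y) x = partial i u x - partial i v x.
Proof. by move=> du dv; rewrite /partial; exact: deriveB. Qed.

Lemma in_box_le k n (M M' : R) (x : 'rV[R]_n) : 0 < M -> M <= M' ->
  in_box k M x -> in_box k M' x.
Proof.
move=> M0 MM h i; have [h1 h2] := h i; split; first exact: le_trans MM.
move=> /h2; apply: le_trans; rewrite lef_pV2 ?posrE//.
exact: lt_le_trans MM.
Qed.

Lemma testC1B k n (u v : 'rV[R]_n -> R) : testC1 k u -> testC1 k v ->
  testC1 k (fun x => u x - v x).
Proof.
move=> [cu cdu du [M M0 hM]] [cv cdv dv [N N0 hN]].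
have pE i : partial i (fun x => u x - v x) = (fun x => partial i u x - partial i v x).
  by apply/funext => x; exact: partialB.
split.
- exact: continuous_subr.
- by move=> i; rewrite pE; exact: continuous_subr.
- by move=> i x; exact: derivableB.
- exists (M + N); first exact: addr_gt0.
  have MM : M <= M + N by rewrite lerDl ltW.
  have NN : N <= M + N by rewrite lerDr ltW.
  have neq (a b : R) : a - b != 0 -> (a != 0) || (b != 0).
    by apply: contraNT; rewrite negb_or !negbK => /andP[/eqP -> /eqP ->]; rewrite subrr.
  move=> x [|[i]]; rewrite ?pE => /neq/orP[h|h].
  + by apply: (in_box_le M0 MM); apply: hM; left.
  + by apply: (in_box_le N0 NN); apply: hN; left.
  + by apply: (in_box_le M0 MM); apply: hM; right; exists i.
  + by apply: (in_box_le N0 NN); apply: hN; right; exists i.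
Qed.

(** Raising all weights in the gap to 4 leaves four times Bessel's inequality. *)
Lemma energy_ge0 k n (u : 'rV[R]_n -> R) : testC1 k u -> 0 <= energy k u.
Proof.
move=> tu; apply: le_trans (energy_gap tu); rewrite subr_ge0.
apply: (@le_trans _ _ (4 * \sum_j (gram k j j)^-1 *
    (\int[lebesgue_rV n]_x (modes k j x * u x)) ^+ 2)).
  rewrite mulr_sumr; apply: ler_sum => j _; rewrite ler_wpM2r//.
    by rewrite mulr_ge0 ?sqr_ge0// invr_ge0 gram_ge0.
  by case: j => // i; rewrite /coef ler_nat.
by rewrite ler_wpM2l//; apply: bessel_modes; exact: testC1_dominated tu.
Qed.

End test_functions.

(** * Passing to the completion S *)

Section closure.
Context {R : realType}.

Lemma sqrte_lt (a : \bar R) (e : R) : (0 <= a)%E -> 0 < e ->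
  (sqrte a < e%:E)%E -> (a < (e ^+ 2)%:E)%E.
Proof.
case: a => [r| |]//= r0 e0; rewrite !lte_fin => re.
rewrite -(sqr_sqrtr (_ : 0 <= r))//.
by rewrite ltr_sqr ?nnegrE ?sqrtr_ge0// ltW.
Qed.

Variables n k : nat.
Hypothesis hk : (1 <= k <= n)%N.
Notation lam := (@lebesgue_rV R n).
Notation D := (@orthant R n k).
Notation ip := (ip lam).
Notation L2 := (L2 lam).
Implicit Types (u : 'rV[R]_n -> R) (g : 'rV[R]_n -> 'rV[R]_n).

Lemma measurable_restrict_orthant u : measurable_fun D u -> measurable_fun setT (u \_ D).
Proof.
move=> mu; apply/measurable_restrict => //; first exact: measurable_orthant.
by rewrite setTI.
Qed.

(** Integrals over the orthant are rewritten over the whole space for extensions by zero, so that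
    one L^2 calculus serves both the elements of S and the test functions. *)
Lemma grad_intE g : grad_int k g =
  (\int[lam]_x (\sum_i ((fun y => g y 0 i) \_ D) x * ((fun y => g y 0 i) \_ D) x)%:E)%E.
Proof.
rewrite /grad_int integral_mkcond; apply: eq_integral => x _.
rewrite patchE; case: ifPn => xD.
  by congr EFin; apply: eq_bigr => i _; rewrite patchE xD expr2.
by rewrite big1// => i _; rewrite patchE (negbTE xD) mulr0.
Qed.

Lemma moment_intE u : moment_int k u =
  (\int[lam]_x (\sum_i (x 0 i * (u \_ D) x) * (x 0 i * (u \_ D) x))%:E)%E.
Proof.
rewrite /moment_int integral_mkcond; apply: eq_integral => x _.
rewrite patchE; case: ifPn => xD.
  congr EFin; rewrite /sqnorm mulr_suml; apply: eq_bigr => i _.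
  by rewrite patchE xD; ring.
by rewrite big1// => i _; rewrite patchE (negbTE xD) !mulr0.
Qed.

Lemma sq_intE u : sq_int k u = (\int[lam]_x ((u \_ D) x * (u \_ D) x)%:E)%E.
Proof.
rewrite /sq_int integral_mkcond; apply: eq_integral => x _.
by rewrite !patchE; case: ifPn => xD; rewrite ?mulr0// expr2.
Qed.

Lemma dominated_L2 f : dominated (@envn R n) f -> L2 f.
Proof.
move=> df; apply: integrable_L2; first by case: df.
apply: (dominated_integrable (envelope_envn n)).
exact: (dominatedM (envelope_envn n)).
Qed.

Lemma testC1_L2 u : testC1 k u -> L2 u.
Proof. by move=> tu; apply: dominated_L2; exact: testC1_dominated tu. Qed.

Lemma testC1_partial_L2 u i : testC1 k u -> L2 (partial i u).
Proof. by move=> tu; apply: dominated_L2; exact: testC1_dominated_partial tu. Qed.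

Lemma testC1_coord_L2 u i : testC1 k u -> L2 (fun x => x 0 i * u x).
Proof.
move=> [cu cdu du [M M0 uM]]; apply: dominated_L2.
apply: (@dominated_cbox _ _ _ k M).
  by apply: continuous_mulr => //; exact: continuous_coord.
by move=> x; rewrite mulf_eq0 negb_or => /andP[_ ux]; apply: uM; left.
Qed.

Lemma count_last : (\sum_(i < n) (n - k <= i)%N)%N = k.
Proof.
case/andP: hk => k1 kn.
have e : n = (n - k + k)%N by rewrite subnK.
rewrite -(big_mkord xpredT (fun i => nat_of_bool (n - k <= i)%N)).
rewrite (big_cat_nat _ (leq_subr k n))//= big_nat_cond big1 ?add0n; last first.
  by move=> i; rewrite andbT => /andP[_ ik]; rewrite leqNgt ik.
rewrite big_nat_cond (eq_bigr (fun=> 1%N)); last first.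
  by move=> i /andP[/andP[-> _] _].
by rewrite -big_nat_cond sum_nat_const_nat muln1 subKn.
Qed.

Lemma sumE1 : \sum_(i < n) E1 (n - k <= i)%N = (n + 2 * k)%:R :> R.
Proof.
rewrite (eq_bigr (fun i : 'I_n => 1 + 2 * (n - k <= i)%N%:R)); last first.
  by move=> i _; rewrite /E1; case: (n - k <= i)%N => /=; ring.
rewrite big_split/= sumr_const card_ord -mulr_sumr natrD natrM; congr (_ + _ * _).
by rewrite -natr_sum count_last.
Qed.

Lemma energyE u : testC1 k u -> energy k u =
  \sum_i ip (partial i u) (partial i u) +
  \sum_i ip (fun x => x 0 i * u x) (fun x => x 0 i * u x) -
  (\sum_(i < n) E1 (n - k <= i)%N) * ip u u.
Proof.
move=> tu; rewrite /energy; congr (_ + _ - _).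
transitivity (\int[lam]_x \sum_i (x 0 i * u x) * (x 0 i * u x)).
  apply: eq_Rintegral => x _; rewrite /sqnorm mulr_suml.
  by apply: eq_bigr => i _; ring.
rewrite (int_sum (envelope_envn n))// => i _.
have [cu cdu du [M M0 uM]] := tu.
apply: (@dominated_cbox _ _ _ k M).
  by apply: continuous_mulr; apply: continuous_mulr => //; exact: continuous_coord.
move=> x; rewrite !mulf_eq0 !negb_or => /andP[/andP[_ ux] _]; apply: uM; left.
exact: ux.
Qed.

(** The energy is nonnegative and, as the dimension is positive, the sum of ground energies is at
    least 1. The norm of S has no plain L^2 term, and this inequality supplies it. *)
Lemma poincare u : testC1 k u ->
  ip u u <= \sum_i (ip (partial i u) (partial i u) +
  ip (fun x => x 0 i * u x) (fun x => x 0 i * u x)).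
Proof.
case/andP: hk => k1 kn.
move=> tu; have := energy_ge0 tu; rewrite energyE// subr_ge0 big_split/=.
apply: le_trans; rewrite ler_peMl ?ip_ge0//.
have n0 : (0 < n)%N by exact: leq_trans kn.
rewrite (bigD1 (Ordinal n0))//= -[leLHS]addr0 lerD//.
  by rewrite /E1; case: ifP; rewrite ?lexx// ler1n.
by apply: sumr_ge0 => i _; rewrite /E1; case: ifP.
Qed.

Lemma ipB_le f h : L2 f -> L2 h ->
  ip (fun x => h x - f x) (fun x => h x - f x) <= 2 * ip f f + 2 * ip h h.
Proof.
move=> Lf Lh; have := ip_ge0 lam (fun x => f x + h x).
have Ls := L2D Lf Lh; have Lm := L2B Lh Lf.
rewrite (ipDl Lf Lh Ls) (ipDr Lf Lh Lf) (ipDr Lf Lh Lh).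
rewrite (ipBl Lh Lf Lm) (ipBr Lh Lf Lf) (ipBr Lh Lf Lh).
by rewrite (ipC _ h f); lra.
Qed.

Lemma sumsq_L2 (F : 'I_n -> 'rV[R]_n -> R) : (forall i, measurable_fun setT (F i)) ->
  (\int[lam]_x (\sum_i (F i x * F i x))%:E < +oo)%E -> forall i, L2 (F i).
Proof.
move=> mF Fo i; split => //; apply: le_lt_trans Fo; apply: ge0_le_integral => //.
- by move=> x _; rewrite lee_fin -expr2 sqr_ge0.
- by apply/measurable_EFinP; exact: measurable_funM.
- apply/measurable_EFinP; apply: measurable_sum => j; exact: measurable_funM.
- move=> x _; rewrite lee_fin (bigD1 i)//= lerDl sumr_ge0// => j _.
  by rewrite -expr2 sqr_ge0.
Qed.

Lemma sumsqE (F : 'I_n -> 'rV[R]_n -> R) : (forall i, L2 (F i)) ->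
  (\int[lam]_x (\sum_i (F i x * F i x))%:E)%E = (\sum_i ip (F i) (F i))%:E.
Proof.
move=> LF; under eq_integral do rewrite -sumEFin.
rewrite ge0_integral_sum//.
- by rewrite -sumEFin; apply: eq_bigr => i _; exact: ipE.
- by move=> i; apply/measurable_EFinP; apply: measurable_funM; have [] := LF i.
- by move=> i x _; rewrite lee_fin -expr2 sqr_ge0.
Qed.

Lemma sum_four (a b c d : 'I_n -> R) :
  2 * (\sum_i a i + \sum_i b i) + 2 * (\sum_i c i + \sum_i d i) =
  \sum_i (2 * a i + 2 * c i + (2 * b i + 2 * d i)).
Proof. by rewrite !big_split/= -!mulr_sumr !mulrDr addrACA. Qed.

Lemma cvg_ip_cst f : ip (fun x => f x - f x) (fun x => f x - f x) @[_ --> \oo] --> 0.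
Proof.
rewrite [X in X @[_ --> _]](_ : _ = 0); first exact: cvg_cst.
by rewrite /ip; under eq_Rintegral do rewrite subrr mulr0; rewrite Rintegral_cst// mul0r.
Qed.

(** * Convergence of an approximating sequence to an element of S *)

Section in_S.
Variables (u : 'rV[R]_n -> R) (g : 'rV[R]_n -> 'rV[R]_n).
Variable phi : nat -> 'rV[R]_n -> R.
Hypothesis mu : measurable_fun D u.
Hypothesis mg : forall i, measurable_fun D (fun x => g x 0 i).
Hypothesis tphi : forall j, testC1 k (phi j).
Hypothesis cphi :
  S_norm k (u \- phi j) (g \- gradient (phi j)) @[j --> \oo] --> 0%E.

Let U := u \_ D.
Let G i := (fun x => g x 0 i) \_ D.
Let H i j x := G i x - partial i (phi j) x.
Let X (i : 'I_n) j (x : 'rV[R]_n) := x 0 i * U x - x 0 i * phi j x.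

Let mU : measurable_fun setT U. Proof. exact: measurable_restrict_orthant. Qed.
Let mG i : measurable_fun setT (G i). Proof. exact: measurable_restrict_orthant. Qed.

Let gradE j : grad_int k (g \- gradient (phi j)) =
  (\int[lam]_x (\sum_i (H i j x * H i j x))%:E)%E.
Proof.
rewrite grad_intE; apply: eq_integral => x _; congr EFin; apply: eq_bigr => i _.
suff -> : ((fun y => (g \- gradient (phi j)) y 0 i) \_ D) x = H i j x by [].
rewrite /H /G !patchE; case: ifPn => [_|/negP xD]; first by rewrite !mxE.
rewrite (testC1_partial_out i (tphi j)) ?subr0// => Dx; apply: xD; rewrite inE//.
Qed.

Let momE j : moment_int k (u \- phi j) =
  (\int[lam]_x (\sum_i (X i j x * X i j x))%:E)%E.
Proof.
rewrite moment_intE; apply: eq_integral => x _; congr EFin; apply: eq_bigr => i _.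
suff -> : x 0 i * ((u \- phi j) \_ D) x = X i j x by [].
rewrite /X /U !patchE; case: ifPn => [_|/negP xD]; first by rewrite /=; ring.
rewrite (testC1_out (tphi j)) ?mulr0 ?subr0// => Dx; apply: xD; rewrite inE//.
Qed.

Let mH i j : measurable_fun setT (H i j).
Proof. by apply: measurable_funB => //; have [] := testC1_partial_L2 i (tphi j). Qed.

Let mxU i : measurable_fun setT (fun x : 'rV[R]_n => x 0 i * U x).
Proof. by apply: measurable_funM => //; exact: measurable_coord. Qed.

Let mX i j : measurable_fun setT (X i j).
Proof. by apply: measurable_funB => //; have [] := testC1_coord_L2 i (tphi j). Qed.

Let small (e : R) : 0 < e -> \forall j \near \oo,
  (\int[lam]_x (\sum_i (H i j x * H i j x))%:E < e%:E)%E /\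
  (\int[lam]_x (\sum_i (X i j x * X i j x))%:E < e%:E)%E.
Proof.
move=> e0; have se0 : 0 < Num.sqrt e by rewrite sqrtr_gt0.
have : \forall j \near \oo, (S_norm k (u \- phi j)%R (g \- gradient (phi j))%R < (Num.sqrt e)%:E)%E.
  have [fS cS] := (fine_cvgP _ _).1 cphi.
  move/cvgr0Pnorm_lt : cS => /(_ _ se0); move: fS; apply: filterS2 => j fj /=.
  move=> /(le_lt_trans (ler_norm _)) lt_e.
  by rewrite -(fineK fj) lte_fin.
apply: filterS => j; rewrite /S_norm => lt_e.
rewrite -gradE -momE -[in e%:E](sqr_sqrtr (ltW e0)).
have g0 : (0 <= grad_int k (g \- gradient (phi j))%R)%E.
  by apply: integral_ge0 => x _; rewrite lee_fin sqnorm_ge0.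
have m0 : (0 <= moment_int k (u \- phi j)%R)%E.
  by apply: integral_ge0 => x _; rewrite lee_fin mulr_ge0 ?sqnorm_ge0 ?sqr_ge0.
split; apply: sqrte_lt => //; apply: le_lt_trans lt_e.
  by rewrite leeDl// sqrte_ge0.
by rewrite leeDr// sqrte_ge0.
Qed.

Let LG i : L2 (G i).
Proof.
have [j0 _ hj0] := small ltr01; have [h _] := hj0 j0 (leqnn _).
have LH := sumsq_L2 (fun i => mH i j0) (lt_trans h (ltry _)).
have := L2D (LH i) (testC1_partial_L2 i (tphi j0)).
by under [X in L2 X]eq_fun do rewrite subrK.
Qed.

Let LxU i : L2 (fun x : 'rV[R]_n => x 0 i * U x).
Proof.
have [j0 _ hj0] := small ltr01; have [_ h] := hj0 j0 (leqnn _).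
have LX := sumsq_L2 (fun i => mX i j0) (lt_trans h (ltry _)).
have := L2D (LX i) (testC1_coord_L2 i (tphi j0)).
by under [X in L2 X]eq_fun do rewrite subrK.
Qed.

Let LH i j : L2 (H i j).
Proof. by apply: L2B => //; exact: testC1_partial_L2. Qed.

Let LX i j : L2 (X i j).
Proof. by apply: L2B => //; exact: testC1_coord_L2. Qed.

Let s j := \sum_i ip (H i j) (H i j) + \sum_i ip (X i j) (X i j).

Let s_ge0 j : 0 <= s j.
Proof. by rewrite addr_ge0// sumr_ge0// => i _; exact: ip_ge0. Qed.

Let s_small (e : R) : 0 < e -> \forall j \near \oo, s j < e.
Proof.
move=> e0; have e2 : 0 < e / 2 by rewrite divr_gt0.
apply: filterS (small e2) => j; rewrite !sumsqE// !lte_fin => -[h1 h2].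
by rewrite [e]splitr ltrD.
Qed.

(** Poincaré for [phi l - phi j], whose derivatives and moments are differences of the errors [H]
    and [X]: convergence in the norm of S makes the sequence Cauchy in L^2. *)
Let cauchy l j : ip (fun x => phi l x - phi j x) (fun x => phi l x - phi j x) <= 2 * s l + 2 * s j.
Proof.
apply: le_trans (poincare (testC1B (tphi l) (tphi j))) _.
have -> : 2 * s l + 2 * s j = \sum_i (2 * ip (H i l) (H i l) + 2 * ip (H i j) (H i j) +
    (2 * ip (X i l) (X i l) + 2 * ip (X i j) (X i j))).
  exact: sum_four.
apply: ler_sum => i _; apply: lerD.
  have -> : partial i (fun x => phi l x - phi j x) = (fun x => H i j x - H i l x).
    apply/funext => x; rewrite partialB; last 2 first.
    - by have [_ _ d _] := tphi l; exact: d.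
    - by have [_ _ d _] := tphi j; exact: d.
    by rewrite /H; ring.
  exact: (ipB_le (LH i l) (LH i j)).
have -> : (fun x : 'rV[R]_n => x 0 i * (phi l x - phi j x)) = (fun x => X i j x - X i l x).
  by apply/funext => x; rewrite /X; ring.
exact: (ipB_le (LX i l) (LX i j)).
Qed.

(* The norm of S bounds the weighted function |x| u; truncating the weight gives an
   L^2 bound uniform in N, hence convergence in L^2 by monotone convergence as
   |x| > 0 on the orthant. *)
Let theta (N : nat) (x : 'rV[R]_n) := Num.min 1 (N%:R * sqnorm x).
Let V j x := U x - phi j x.

Let mV j : measurable_fun setT (V j).
Proof. by apply: measurable_funB => //; have [] := testC1_L2 (tphi j). Qed.

Let mtheta N : measurable_fun setT (theta N).
Proof.
apply: measurable_minr => //; apply: measurable_funM => //.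
exact: measurable_sqnorm.
Qed.

Let theta_ge0 N x : 0 <= theta N x.
Proof. by rewrite /theta le_min ler01 mulr_ge0 ?sqnorm_ge0. Qed.

Let mthetaV N j : measurable_fun setT (fun x => (theta N x * (V j x * V j x))%:E).
Proof. by apply/measurable_EFinP; apply: measurable_funM => //; apply: measurable_funM. Qed.

Let thetaV_ge0 N j x : (0 <= (theta N x * (V j x * V j x))%:E)%E.
Proof. by rewrite lee_fin mulr_ge0// -expr2 sqr_ge0. Qed.

(** Write [V j] as [V l] plus [phi l - phi j]. The weight is bounded by N |x|^2 on the first term,
    controlled by the moment error at [l], and by 1 on the second, controlled by [cauchy]. *)
Let theta_le N j l : (\int[lam]_x (theta N x * (V j x * V j x))%:E <=
  ((2 * N%:R + 4) * s l + 4 * s j)%:E)%E.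
Proof.
pose A x := \sum_i X i l x * X i l x.
pose B x := (phi l x - phi j x) * (phi l x - phi j x).
have LB : L2 (fun x => phi l x - phi j x) by apply: L2B; exact: testC1_L2.
have A0 x : 0 <= A x by apply: sumr_ge0 => i _; rewrite -expr2 sqr_ge0.
have B0 x : 0 <= B x by rewrite /B -expr2 sqr_ge0.
have mA : measurable_fun setT A by apply: measurable_sum => i; exact: measurable_funM.
have mB : measurable_fun setT B by case: LB => mB _; exact: measurable_funM.
apply: (@le_trans _ _ (\int[lam]_x (2 * N%:R * A x + 2 * B x)%:E)%E).
  apply: ge0_le_integral => //.
  - by apply/measurable_EFinP; apply: measurable_funD; exact: measurable_funM.
  move=> x _; rewrite lee_fin.
  have AE : A x = sqnorm x * V l x ^+ 2.
    by rewrite /A /sqnorm mulr_suml; apply: eq_bigr => i _; rewrite /X /V; ring.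
  have t1 : theta N x <= 1 by rewrite /theta ge_min lexx.
  have tN : theta N x <= N%:R * sqnorm x by rewrite /theta ge_min lexx orbT.
  have VE : V j x = V l x + (phi l x - phi j x) by rewrite /V; ring.
  have tV : theta N x * (2 * V l x ^+ 2) <= 2 * N%:R * (sqnorm x * V l x ^+ 2).
    rewrite [leRHS](_ : _ = N%:R * sqnorm x * (2 * V l x ^+ 2)); last by ring.
    by rewrite ler_wpM2r// mulr_ge0// sqr_ge0.
  rewrite AE /B VE; move: (theta_ge0 N x) t1 tV.
  move: (theta N x) (2 * N%:R * (sqnorm x * V l x ^+ 2)) (V l x) (phi l x - phi j x) => t z v d t0 t1 tz.
  apply: (@le_trans _ _ (t * (2 * v ^+ 2) + t * (2 * d ^+ 2))).
    by rewrite -mulrDr ler_wpM2l//; have := sqr_ge0 (v - d); nra.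
  by apply: lerD => //; rewrite -expr2 ler_piMl// mulr_ge0// sqr_ge0.
have mA' c : measurable_fun setT (fun x => (c * A x)%:E).
  by apply/measurable_EFinP; exact: measurable_funM.
have mB' c : measurable_fun setT (fun x => (c * B x)%:E).
  by apply/measurable_EFinP; exact: measurable_funM.
have A0' x : (0 <= (A x)%:E)%E by rewrite lee_fin.
have B0' x : (0 <= (B x)%:E)%E by rewrite lee_fin.
have mA'' : measurable_fun setT (fun x => (A x)%:E) by apply/measurable_EFinP.
have mB'' : measurable_fun setT (fun x => (B x)%:E) by apply/measurable_EFinP.
have N2 : 0 <= 2 * N%:R :> R by rewrite mulr_ge0.
under eq_integral do rewrite EFinD.
rewrite ge0_integralD//; last 2 first.
- by move=> x _; rewrite lee_fin mulr_ge0// mulr_ge0.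
- by move=> x _; rewrite lee_fin mulr_ge0.
under eq_integral do rewrite EFinM.
rewrite (ge0_integralZl_EFin lam measurableT (fun x _ => A0' x) mA'' N2).
under [X in (_ + X)%E]eq_integral do rewrite EFinM.
rewrite (ge0_integralZl_EFin lam measurableT (fun x _ => B0' x) mB'' (ler0n _ 2)).
rewrite sumsqE// ipE// -!EFinM -EFinD lee_fin.
have h1 : \sum_i ip (X i l) (X i l) <= s l.
  by rewrite lerDr sumr_ge0// => i _; exact: ip_ge0.
have h2 := cauchy l j.
apply: (@le_trans _ _ (2 * N%:R * s l + 2 * (2 * s l + 2 * s j))).
  by apply: lerD; rewrite ler_wpM2l// mulr_ge0.
by rewrite le_eqVlt; apply/orP; left; apply/eqP; ring.
Qed.

Let V_le j : (\int[lam]_x (V j x * V j x)%:E <= (4 * s j)%:E)%E.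
Proof.
have thV N : (\int[lam]_x (theta N x * (V j x * V j x))%:E <= (4 * s j)%:E)%E.
  apply/lee_addgt0Pr => e e0.
  have N0 : 0 < 2 * N%:R + 4 :> R by rewrite ltr_wpDl// mulr_ge0.
  (* The index [l] is chosen after [N], so the factor growing with [N] is harmless and the bound
     [4 * s j] does not depend on [N]. *)
  have [l _ hl] := s_small (divr_gt0 e0 N0).
  apply: le_trans (theta_le N j l) _; rewrite -EFinD lee_fin addrC lerD2l.
  by rewrite mulrC -ler_pdivlMr//; apply: ltW; apply: hl => /=.
have nd x : {homo (fun N => (theta N x * (V j x * V j x))%:E) : a b / (a <= b)%N >-> (a <= b)%E}.
  move=> a b ab; rewrite lee_fin ler_wpM2r// -?expr2 ?sqr_ge0//.
  by rewrite /theta le_min !ge_min lexx/= ler_wpM2r ?sqnorm_ge0 ?orbT// ler_nat.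
have := @cvg_monotone_convergence _ _ _ lam _ measurableT _ (fun N => mthetaV N j)
  (fun N x _ => thetaV_ge0 N j x) (fun x _ => nd x).
rewrite [X in _ --> X](_ : _ = \int[lam]_x (V j x * V j x)%:E)%E; last first.
  apply: eq_integral => x _; apply: lim_near_cst => //.
  have [Dx|Dx] := pselect (D x); last first.
    apply: nearW => N.
    by rewrite /V /U patchE memNset// (testC1_out (tphi j) Dx) subrr !mulr0.
  (* As [k >= 1], the coordinate of index [n - k] is positive on the orthant, so |x| > 0 and the
     truncated weight is eventually 1. *)
  have n0 : (n - k < n)%N by case/andP: hk => k1 kn; rewrite ltn_subrL k1 (leq_trans k1 kn).
  have sq0 : 0 < sqnorm x.
    rewrite /sqnorm (bigD1 (Ordinal n0))//= ltr_pwDl//.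
      by rewrite exprn_gt0//; exact: Dx.
    by apply: sumr_ge0 => i _; exact: sqr_ge0.
  exists (Num.bound (sqnorm x)^-1) => // N /= hN.
  rewrite /theta min_l ?mul1r//.
  rewrite -ler_pdivrMr// mul1r; apply: ltW.
  apply: lt_le_trans (archi_boundP _) _; first by rewrite invr_ge0 ltW.
  by rewrite ler_nat.
move=> cv; apply: (lee_cvg_to cv (cvg_cst (4 * s j)%:E)).
by apply: nearW => N; exact: thV.
Qed.

Let LV j : L2 (V j).
Proof. by split => //; apply: le_lt_trans (V_le j) (ltry _). Qed.

Let ipV_le j : ip (V j) (V j) <= 4 * s j.
Proof. by rewrite -lee_fin -ipE//; exact: V_le. Qed.

Lemma in_S_L2 : L2 U.
Proof.
have := L2D (LV 0%N) (testC1_L2 (tphi 0%N)).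
by under [X in L2 X]eq_fun do rewrite subrK.
Qed.

Lemma in_S_grad_L2 i : L2 (G i).
Proof. exact: LG. Qed.

Lemma in_S_coord_L2 i : L2 (fun x : 'rV[R]_n => x 0 i * U x).
Proof. exact: LxU. Qed.

Let cvg0_le_s (a : nat -> R) (C : R) : 0 < C -> (forall j, 0 <= a j <= C * s j) ->
  a j @[j --> \oo] --> 0.
Proof.
move=> C0 aC; apply/cvgr0Pnorm_lt => e e0.
apply: filterS (s_small (divr_gt0 e0 C0)) => j sj.
have /andP[a0 aj] := aC j.
by rewrite ger0_norm//; apply: le_lt_trans aj _; rewrite mulrC -ltr_pdivlMr.
Qed.

Lemma in_S_cvg : ip (fun x => U x - phi j x) (fun x => U x - phi j x) @[j --> \oo] --> 0.
Proof. by apply: (@cvg0_le_s _ 4) => // j; rewrite ip_ge0 ipV_le. Qed.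

Lemma in_S_cvg_grad i : ip (H i j) (H i j) @[j --> \oo] --> 0.
Proof.
apply: (@cvg0_le_s _ 1) => // j; rewrite ip_ge0 mul1r /s (bigD1 i)//= -addrA lerDl.
by rewrite addr_ge0// sumr_ge0// => *; exact: ip_ge0.
Qed.

Lemma in_S_cvg_coord i : ip (X i j) (X i j) @[j --> \oo] --> 0.
Proof.
apply: (@cvg0_le_s _ 1) => // j; rewrite ip_ge0 mul1r /s [in X in _ + X](bigD1 i)//=.
rewrite addrCA lerDl.
by rewrite addr_ge0// sumr_ge0// => *; exact: ip_ge0.
Qed.

Definition real_deficit : R := \sum_i ip (G i) (G i) +
  \sum_i ip (fun x : 'rV[R]_n => x 0 i * U x) (fun x : 'rV[R]_n => x 0 i * U x) -
  (n + 2 * k)%:R * ip U U.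

Lemma deficitE : deficit k u g = real_deficit%:E.
Proof.
rewrite /deficit grad_intE moment_intE sq_intE !sumsqE// ipE//; exact: in_S_L2.
Qed.

Lemma cvg_energy : energy k (phi j) @[j --> \oo] --> real_deficit.
Proof.
under eq_fun do rewrite energyE// sumE1.
apply: cvgB; first apply: cvgD.
- apply: cvg_big => [|i _]; first by move=> x; exact: add_continuous.
  apply: cvg_ip => //; try exact: in_S_grad_L2; try exact: in_S_cvg_grad.
  + by move=> j; exact: testC1_partial_L2.
  + by move=> j; exact: testC1_partial_L2.
- apply: cvg_big => [|i _]; first by move=> x; exact: add_continuous.
  apply: cvg_ip => //; try exact: in_S_coord_L2; try exact: in_S_cvg_coord.
  + by move=> j; exact: testC1_coord_L2.
  + by move=> j; exact: testC1_coord_L2.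
apply: cvgMr; apply: cvg_ip => //; try exact: in_S_L2; try exact: in_S_cvg.
- by move=> j; exact: testC1_L2.
- by move=> j; exact: testC1_L2.
Qed.

Lemma modes_L2 j : L2 (modes k j).
Proof. exact/dominated_L2/dominated_modes. Qed.

Lemma in_S_cvg_ip f : L2 f -> ip (phi j) f @[j --> \oo] --> ip U f.
Proof.
move=> Lf; apply: (@cvg_ip _ _ _ lam phi (fun=> f) U f) => //.
- by move=> j; exact: testC1_L2.
- exact: in_S_L2.
- exact: in_S_cvg.
exact: cvg_ip_cst.
Qed.

Lemma deficit_gap : 4 * ip U U -
  \sum_j coef j * ((gram k j j)^-1 * ip (modes k j) U ^+ 2) <= real_deficit.
Proof.
have Lphi j : L2 (phi j) by exact: testC1_L2.
apply: (ler_cvg_to _ cvg_energy); last first.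
  by apply: nearW => j; apply: energy_gap; exact: tphi.
apply: cvgB.
  by apply: cvgMr; apply: cvg_ip => //; try exact: in_S_L2; exact: in_S_cvg.
apply: cvg_big => [|i _]; first by move=> x; exact: add_continuous.
have h : ip (modes k i) (phi j) @[j --> \oo] --> ip (modes k i) U.
  rewrite ipC; under eq_fun do rewrite ipC.
  by apply: in_S_cvg_ip; exact: modes_L2.
by apply: cvgMr; apply: cvgMr; exact: (cvgM h h).
Qed.

End in_S.
End closure.

(** * The inequality and its equality case *)

Section projection.
Context {R : realType}.
Variables n k : nat.
Hypothesis hk : (1 <= k <= n)%N.
Notation lam := (@lebesgue_rV R n).
Notation D := (@orthant R n k).
Notation ip := (ip lam).
Notation L2 := (L2 lam).

Lemma prod_gs (x : 'rV[R]_n) : \prod_(i < n) gs (x 0 i) = expR (- (sqnorm x / 2)).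
Proof.
rewrite /gs -expR_sum; congr expR.
by rewrite sumrN /sqnorm mulr_suml.
Qed.

Lemma ground_state_modes x : D x -> ground_state k x = modes k None x.
Proof.
move=> Dx; rewrite /ground_state -prod_gs big_mkcond -big_split/= /modes.
apply: eq_bigr => i _ /=; rewrite /w0; case: ifPn => [ki|_]; last by rewrite mul1r.
by rewrite Dx.
Qed.

Lemma coord_ground_state_modes x (i : 'I_n) : D x ->
  modes k (Some i) x = if (i < n - k)%N then x 0 i * ground_state k x else 0.
Proof.
move=> Dx; rewrite ltnNge; case: ifPn => /= ik; last first.
  by rewrite negbK in ik; rewrite /modes (bigD1 i)//= eqxx/= ik /w1 mul0r.
rewrite (ground_state_modes Dx) /modes (bigD1 i)//= [in RHS](bigD1 i)//= eqxx/=.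
rewrite (negbTE ik) /w1 /w0 mulrA; congr (_ * _).
by apply: eq_bigr => l li; rewrite (inj_eq Some_inj) eq_sym (negbTE li).
Qed.

(** The half-line states were set to 0 on nonpositive arguments; hence pairings with modes over the
    whole space only see the orthant. *)
Lemma modes_out j x : ~ D x -> modes k j x = 0.
Proof.
move=> Dx; have [i ki xi] : exists2 i : 'I_n, (n - k <= i)%N & x 0 i <= 0.
  apply: contra_notP Dx => nx i ki; rewrite ltNge; apply/negP => xi.
  by apply: nx; exists i.
rewrite /modes (bigD1 i)//= ki /ws /w1 /w0.
by case: ifP => _; rewrite ?(ltNge 0) ?xi/= mul0r.
Qed.

Definition comb (c : option 'I_n -> R) (x : 'rV[R]_n) := \sum_j c j * modes k j x.

Definition extremal_coef (b : 'rV[R]_n) (b0 : R) (j : option 'I_n) : R :=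
  if j is Some i then b 0 i else b0.

Lemma extremal_comb b b0 : (extremal k b b0) \_ D = comb (extremal_coef b b0).
Proof.
apply/funext => x; rewrite patchE /comb; case: ifPn => [/[!inE] Dx|/negP Dx]; last first.
  rewrite big1// => j _; rewrite modes_out ?mulr0// => Dx'.
  by apply: Dx; rewrite inE.
rewrite big_option/= -ground_state_modes// /extremal mulrDr addrC mulrC; congr (_ + _).
rewrite mulr_sumr big_mkcond/=; apply: eq_bigr => i _.
by rewrite coord_ground_state_modes//; case: ifP => _; rewrite ?mulr0//; ring.
Qed.

Lemma comb_L2 c : L2 (comb c).
Proof. by apply: L2_sum => j _; apply: L2Z; exact: modes_L2. Qed.

Lemma ip_comb c f : L2 f -> ip (comb c) f = \sum_j c j * ip (modes k j) f.
Proof.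
move=> Lf; rewrite ip_suml//; last by move=> j _; apply: L2Z; exact: modes_L2.
by apply: eq_bigr => j _; rewrite ipZl//; exact: modes_L2.
Qed.

Lemma ip_modes_comb c j : ip (modes k j) (comb c) = c j * gram k j j.
Proof.
rewrite ipC ip_comb; last exact: modes_L2.
rewrite (bigD1 j)//= big1 ?addr0// => i ij.
by rewrite -[ip _ _]/(gram k i j) gram_orth// mulr0.
Qed.

Variable U : 'rV[R]_n -> R.
Hypothesis LU : L2 U.

Let p j := ip (modes k j) U.

Let residual x := U x - comb (fun j => (gram k j j)^-1 * p j) x.

(** Pythagoras for the projection on all modes, zero ones included thanks to [gram_inv]. *)
Lemma ip_residual :
  ip residual residual = ip U U - \sum_j (gram k j j)^-1 * p j ^+ 2.
Proof.
set c := fun j => (gram k j j)^-1 * p j.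
have Lc := comb_L2 c; have Lr := L2B LU Lc.
rewrite {1}/residual (ipBl LU Lc Lr) (ipBr LU Lc LU) (ipBr LU Lc Lc).
rewrite (ipC _ U) !ip_comb// -/p.
have -> : \sum_j c j * ip (modes k j) (comb c) = \sum_j (gram k j j)^-1 * p j ^+ 2.
  apply: eq_bigr => j _; rewrite ip_modes_comb -(gram_inv k j) /c.
  by rewrite !expr2; ring.
have -> : \sum_j c j * ip (modes k j) U = \sum_j (gram k j j)^-1 * p j ^+ 2.
  by apply: eq_bigr => j _; rewrite /c -/(p j) expr2 mulrA.
by rewrite subrr subr0.
Qed.

Lemma residual_ae : ip U U = \sum_j (gram k j j)^-1 * p j ^+ 2 ->
  {ae lam, forall x, U x = comb (fun j => (gram k j j)^-1 * p j) x}.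
Proof.
move=> e; have Lr : L2 residual by apply: L2B => //; exact: comb_L2.
have [mr _] := Lr.
have m2 : measurable_fun setT (fun x => (residual x * residual x)%:E).
  by apply/measurable_EFinP; exact: measurable_funM.
have := ipE Lr; rewrite ip_residual e subrr => i0.
have : ae_eq lam setT (fun x => (residual x * residual x)%:E) (cst 0%E).
  apply/(ae_eq_integral_abs _ measurableT m2); rewrite -[RHS]i0.
  by apply: eq_integral => x _; rewrite gee0_abs// lee_fin -expr2 sqr_ge0.
apply: filterS => x /(_ I)/= [] /eqP.
by rewrite mulf_eq0 orbb subr_eq0 => /eqP.
Qed.

Lemma bessel_L2 : \sum_j (gram k j j)^-1 * p j ^+ 2 <= ip U U.
Proof. by rewrite -subr_ge0 -ip_residual ip_ge0. Qed.

End projection.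

Section distance.
Context {R : realType}.
Variables n k : nat.
Notation lam := (@lebesgue_rV R n).
Notation D := (@orthant R n k).
Notation ip := (ip lam).
Notation L2 := (L2 lam).

(** The squared distance to [c] times the ground state is a quadratic polynomial in [c], minimal at
    the Fourier coefficient [g0^-1 * p0]. *)
Lemma sqdist_groundE (u : 'rV[R]_n -> R) : L2 (u \_ D) ->
  sqdist_ground k u = (ip (u \_ D) (u \_ D) -
    (@gram R k n None None)^-1 * ip (modes k None) (u \_ D) ^+ 2)%:E.
Proof.
set U := u \_ D => LU; have Lm := @modes_L2 R n k None.
set g0 := @gram R k n None None; set p0 := ip (modes k None) U.
have g0_gt : 0 < g0 by exact: gram_gt0.
have sqE c : sq_int k (u \- (c \*: ground_state k)) =
    (ip U U - 2 * c * p0 + c ^+ 2 * g0)%:E.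
  have E : (u \- (c \*: ground_state k)) \_ D = (fun x => U x - c * modes k None x).
    apply/funext => x; rewrite /U !patchE; case: ifPn => [/[!inE] Dx|/negP Dx].
      by rewrite /= -ground_state_modes.
    by rewrite modes_out ?mulr0 ?subr0// => Dx'; apply: Dx; rewrite inE.
  have Lc := L2Z c Lm; have Ls := L2B LU Lc.
  rewrite sq_intE E ipE//; congr EFin.
  rewrite (ipBl LU Lc Ls) (ipBr LU Lc LU) (ipBr LU Lc Lc) (ipC _ U).
  rewrite (ipZl _ Lm LU) (ipZl _ Lm Lc) (ipZr _ Lm Lm).
  by rewrite -/p0 -[ip (modes k None) (modes k None)]/g0; ring.
apply/eqP; rewrite eq_le; apply/andP; split.
  apply: ereal_inf_lbound; exists (g0^-1 * p0) => //.
  rewrite sqE; congr EFin; have : g0^-1 * g0 = 1 by rewrite mulVf// gt_eqF.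
  by move: (g0^-1) => a ag; rewrite exprMn [a ^+ 2]expr2 -(mulrA a a) [X in _ + X](_ : _ = a * p0 ^+ 2 * (a * g0)); [rewrite ag; ring|ring].
apply/ereal_infP => _ [c _ <-]; rewrite sqE lee_fin -subr_ge0.
rewrite (_ : _ - _ = g0 * (c - g0^-1 * p0) ^+ 2); first by rewrite mulr_ge0 ?sqr_ge0 ?ltW.
by field; rewrite gt_eqF.
Qed.

End distance.

Section inequality.
Context {R : realType}.
Variables n k : nat.
Hypothesis hk : (1 <= k <= n)%N.
Notation lam := (@lebesgue_rV R n).
Notation D := (@orthant R n k).
Variables (u : 'rV[R]_n -> R) (g : 'rV[R]_n -> 'rV[R]_n).
Hypothesis Sug : in_S k u g.

Let approx : exists phi : nat -> 'rV[R]_n -> R, [/\ forall j, test_function k (phi j),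
  forall j, testC1 k (phi j) &
  S_norm k (u \- phi j) (g \- gradient (phi j)) @[j --> \oo] --> 0%E].
Proof.
have [_ _ [phi [tphi cphi]]] := Sug; exists phi; split => // j.
exact: test_function_testC1.
Qed.

Let U := u \_ D.
Let p j := ip lam (modes k j) U.

Lemma in_S_restrict_L2 : L2 lam U.
Proof.
have [phi [_ tphi cphi]] := approx; have [mu mg _] := Sug.
exact: (in_S_L2 hk mu mg tphi cphi).
Qed.

Lemma in_S_deficitE : deficit k u g = (real_deficit k u g)%:E.
Proof.
have [phi [_ tphi cphi]] := approx; have [mu mg _] := Sug.
exact: (deficitE hk mu mg tphi cphi).
Qed.

(** A regrouping of the weights 4, 4 and 2 in [deficit_gap]: the first bracket is the squared
    distance to the ground states, the second the squared norm of the residual after removing all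
    modes. *)
Lemma deficit_residual : 2 * (ip lam U U - (@gram R k n None None)^-1 * p None ^+ 2) +
  2 * (ip lam U U - \sum_j (gram k j j)^-1 * p j ^+ 2) <= real_deficit k u g.
Proof.
have [phi [_ tphi cphi]] := approx; have [mu mg _] := Sug.
apply: le_trans (deficit_gap hk mu mg tphi cphi).
rewrite !big_option/= -mulr_sumr.
by move: (\sum_i _) => S; rewrite le_eqVlt; apply/orP; left; apply/eqP; rewrite -/U -/(p None); ring.
Qed.

Lemma deficit_ge : (2%:E * sqdist_ground k u <= deficit k u g)%E.
Proof.
rewrite in_S_deficitE sqdist_groundE; last exact: in_S_restrict_L2.
rewrite -EFinM lee_fin; apply: le_trans deficit_residual.
by rewrite lerDl mulr_ge0// subr_ge0; exact: (bessel_L2 k in_S_restrict_L2).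
Qed.

Lemma deficit_eq_extremal : (deficit k u g = 2%:E * sqdist_ground k u)%E ->
  exists (b : 'rV[R]_n) (b0 : R),
    {ae lam, forall x, D x -> u x = extremal k b b0 x}.
Proof.
rewrite in_S_deficitE sqdist_groundE; last exact: in_S_restrict_L2.
rewrite -EFinM => -[e].
have bes := bessel_L2 k in_S_restrict_L2.
have eq : ip lam U U = \sum_j (gram k j j)^-1 * p j ^+ 2.
  apply/eqP; rewrite eq_le bes andbT -subr_le0.
  have := deficit_residual; rewrite e -/U -/(p None) gerDl.
  by rewrite pmulr_rle0.
pose c j := (gram k j j)^-1 * p j.
exists (\row_i c (Some i)), (c None).
have := residual_ae in_S_restrict_L2 eq; apply: filterS => x.
rewrite {1}/U patchE => h Dx; move: h; rewrite mem_set// => ->.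
have := congr1 (fun f => f x) (@extremal_comb R n k (\row_i c (Some i)) (c None)).
rewrite patchE mem_set// => ->; apply: eq_bigr => -[i|] _ //=.
by rewrite mxE.
Qed.

End inequality.

(** * Integration by parts and products of one-variable functions *)

Section by_parts.
Context {R : realType}.

Lemma C1c_int0 h (u du : R -> R) : C1c h u du -> \int[lebesgue_measure]_t du t = 0.
Proof.
move=> [duE cdu [M M0 hM]].
have u0 t : M < `|t| -> u t = 0.
  move=> Mt; apply/eqP/negP => /negP ut.
  by have [] := hM t; rewrite ?ut// leNgt Mt.
have du0 t : M < `|t| -> du t = 0.
  move=> Mt; apply/eqP/negP => /negP ut.
  by have [] := hM t; rewrite ?ut ?orbT// leNgt Mt.
have M1 : - (M + 1) < M + 1 by lra.
rewrite (@Rintegral_supp _ _ _ (@lebesgue_measure R) `[- (M + 1), M + 1]%classic); last first.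
  move=> t /=; rewrite in_itv/= -ler_norml => /negP; rewrite -ltNge => tM.
  by apply: du0; apply: lt_trans tM; rewrite ltrDl.
rewrite (int_derive M1 (fun t _ => duE t) (fun t _ => cdu t)).
by rewrite !u0 ?subrr// ?normrN gtr0_norm ?ltrDl// addr_gt0.
Qed.

(** Variables are frozen one after the other until the differentiated one comes first; there the
    integral is that of a compactly supported derivative. *)
Lemma int_partial0 k n (F : 'rV[R]_n -> R) i : testC1 k F ->
  \int[lebesgue_rV n]_x partial i F x = 0.
Proof.
elim: n F i => [|n ih] F i tF; first by case: i.
have [_ _ dF _] := tF.
case: (unliftP ord0 i) => [j ->|->].
  rewrite (int_cons (testC1_dominated_partial _ tF)).
  transitivity (\int[@lebesgue_measure R]_t (0 : R)).
    apply: eq_Rintegral => t _; rewrite -(ih _ j (testC1_sect2 t tF)).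
    by rewrite partial_cons2.
  by rewrite Rintegral_cst// mul0r.
rewrite (int_cons' (testC1_dominated_partial _ tF)).
transitivity (\int[lebesgue_rV n]_y (0 : R)).
  by apply: eq_Rintegral => y _; exact: C1c_int0 (testC1_sect1 y tF).
by rewrite Rintegral_cst// mul0r.
Qed.

Lemma continuous_addr (T : topologicalType) (f g : T -> R) :
  continuous f -> continuous g -> continuous (fun x => f x + g x).
Proof. by move=> cf cg x; apply: cvgD; [exact: cf|exact: cg]. Qed.

Variable n : nat.

Definition C1 (f : 'rV[R]_n -> R) := [/\ continuous f,
  forall i, continuous (partial i f) &
  forall i x, derivable f x (delta_mx 0 i)].

Lemma partialM (f h : 'rV[R]_n -> R) i x :
  derivable f x (delta_mx 0 i) -> derivable h x (delta_mx 0 i) ->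
  partial i (fun y => f y * h y) x = f x * partial i h x + partial i f x * h x.
Proof.
by move=> df dh; rewrite /partial (deriveM df dh) /GRing.scale/= [h x * _]mulrC.
Qed.

Lemma testC1M k (f psi : 'rV[R]_n -> R) : C1 f -> testC1 k psi ->
  testC1 k (fun x => f x * psi x).
Proof.
move=> [cf cdf df] [cp cdp dp [M M0 hM]].
have pE i : partial i (fun x => f x * psi x) =
    (fun x => f x * partial i psi x + partial i f x * psi x).
  by apply/funext => x; exact: partialM.
split.
- exact: continuous_mulr.
- move=> i; rewrite pE; apply: continuous_addr; exact: continuous_mulr.
- by move=> i x; exact: derivableM.
- exists M => // x [|[i]]; rewrite ?pE => h; apply: hM.
    by left; apply: contraNneq h => ->; rewrite mulr0.
  have [p0|p0] := eqVneq (psi x) 0; last by left.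
  right; exists i; apply: contraNneq h => ->.
  by rewrite p0 !mulr0 addr0.
Qed.

Lemma by_parts k (f psi : 'rV[R]_n -> R) i : C1 f -> testC1 k psi ->
  \int[lebesgue_rV n]_x (f x * partial i psi x) =
  - \int[lebesgue_rV n]_x (partial i f x * psi x).
Proof.
move=> cf tp; have tM := testC1M cf tp; have e := envelope_envn (R := R) n.
have [cF cdF dF] := cf; have [cp cdp dp [M M0 hM]] := tp.
have d1 : dominated (@envn R n) (fun x => f x * partial i psi x).
  apply: (@dominated_cbox _ _ _ k M); first exact: continuous_mulr.
  move=> x h; apply: hM; right; exists i.
  by apply: contraNneq h => ->; rewrite mulr0.
have d2 : dominated (@envn R n) (fun x => partial i f x * psi x).
  apply: (@dominated_cbox _ _ _ k M); first exact: continuous_mulr.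
  move=> x h; apply: hM; left.
  by apply: contraNneq h => ->; rewrite mulr0.
apply/eqP; rewrite -addr_eq0 -(intD e d1 d2) -[eqbRHS](int_partial0 i tM).
apply/eqP; apply: eq_Rintegral => x _.
by rewrite partialM.
Qed.

Implicit Types (p : 'I_n -> R -> R) (q : R -> R) (x : 'rV[R]_n).

Definition tensor p (x : 'rV[R]_n) := \prod_l p l (x 0 l).

(** Differentiating a tensor in its [i]-th variable replaces its [i]-th factor by the derivative;
    this is that replacement. *)
Definition upd p i q l := if l == i then q else p l.

Lemma tensorD1 p i x : tensor p x = p i (x 0 i) * \prod_(l | l != i) p l (x 0 l).
Proof. by rewrite /tensor (bigD1 i). Qed.

Lemma tensor_updE p i q x :
  tensor (upd p i q) x = q (x 0 i) * \prod_(l | l != i) p l (x 0 l).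
Proof.
rewrite (tensorD1 _ i) /upd eqxx; congr (_ * _).
by apply: eq_bigr => l /negbTE ->.
Qed.

Lemma is_derive_coord (F : 'rV[R]_n -> R) (q : R -> R) i (x : 'rV[R]_n) d :
  (forall h : R, F (h *: delta_mx 0 i + x) = q (h + x 0 i)) ->
  is_derive (x 0 i) 1 q d -> is_derive x (delta_mx 0 i) F d.
Proof.
move=> Fq [dq qd].
have E : (fun h : R => h^-1 *: ((F \o shift x) (h *: delta_mx 0 i) - F x)) =
  (fun h : R => h^-1 *: ((q \o shift (x 0 i)) (h *: 1) - q (x 0 i))).
  apply/funext => h /=; rewrite Fq [h *: 1]mulr1; congr (_ *: (_ - _)).
  by have := Fq 0; rewrite scale0r !add0r.
by split; [rewrite /derivable E|rewrite /derive E -qd].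
Qed.

Lemma is_derive_tensor p i q x : is_derive (x 0 i) 1 (p i) (q (x 0 i)) ->
  is_derive x (delta_mx 0 i) (tensor p) (tensor (upd p i q) x).
Proof.
move=> dp; pose K := \prod_(l | l != i) p l (x 0 l).
apply: (@is_derive_coord _ (fun t => K * p i t)).
  move=> h; rewrite (tensorD1 _ i) !mxE !eqxx mulr1 mulrC; congr (_ * _).
  by apply: eq_bigr => l li; rewrite !mxE (negbTE li) mulr0 add0r.
rewrite tensor_updE mulrC -/K.
exact: (is_deriveZ K dp).
Qed.

Lemma partial_tensor p i q : (forall t : R, is_derive t 1 (p i) (q t)) ->
  partial i (tensor p) = tensor (upd p i q).
Proof.
by move=> dp; apply/funext => x; have [_] := is_derive_tensor (dp (x 0 i)).
Qed.

Lemma derivable_tensor p i x : derivable (p i) (x 0 i) 1 ->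
  derivable (tensor p) x (delta_mx 0 i).
Proof.
move=> dp; have dp' : is_derive (x 0 i) 1 (p i) ('D_1 (p i) (x 0 i)) by [].
by have [] := @is_derive_tensor _ _ (fun=> 'D_1 (p i) (x 0 i)) _ dp'.
Qed.

Lemma continuous_tensor p : (forall i, continuous (p i)) -> continuous (tensor p).
Proof.
move=> cp; apply: continuous_prodr => i x.
apply: (@continuous_comp _ _ _ (fun x : 'rV[R]_n => x 0 i) (p i)).
  exact: continuous_coord.
exact: cp.
Qed.

Lemma continuous_upd p i q : (forall i, continuous (p i)) -> continuous q ->
  forall l, continuous (upd p i q l).
Proof. by move=> cp cq l; rewrite /upd; case: ifP. Qed.

Lemma C1_tensor p p' : (forall i (t : R), is_derive t 1 (p i) (p' i t)) ->
  (forall i, continuous (p' i)) -> C1 (tensor p).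
Proof.
move=> dp cp'.
have cp i : continuous (p i).
  by move=> t; apply/differentiable_continuous/derivable1_diffP; have [] := dp i t.
split.
- exact: continuous_tensor.
- move=> i; rewrite (partial_tensor (dp i)); apply: continuous_tensor.
  exact: continuous_upd.
- by move=> i x; apply: derivable_tensor; have [] := dp i (x 0 i).
Qed.

End by_parts.

(** * The modes as weak eigenfunctions *)

Section eigenfunctions.
Context {R : realType}.

(* Smooth extensions to the line of the functions [ws b h], and their derivatives. *)
Definition wt (b h : bool) (t : R) : R := ((~~ (b || h))%:R + (b (+) h)%:R * t) * gs t.
Definition wt' (b h : bool) (t : R) : R :=
  ((b (+) h)%:R - (~~ (b || h))%:R * t - (b (+) h)%:R * t ^+ 2) * gs t.

Lemma is_derive_wt b h (t : R) : is_derive t 1 (wt b h) (wt' b h t).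
Proof.
rewrite /wt; have := is_derive_gs t => dg.
apply: is_derive_eq; rewrite /GRing.scale/= /wt'.
by case: b; case: h => /=; ring.
Qed.

(** The harmonic oscillator equation with eigenvalue [E1 h + 2 b]; when [b] and [h] are both true,
    [wt] is zero and it is trivial. *)
Lemma is_derive_wt' b h (t : R) :
  is_derive t 1 (wt' b h) ((t ^+ 2 - E1 h - (2 * b)%:R) * wt b h t).
Proof.
rewrite /wt'; have := is_derive_gs t => dg.
apply: is_derive_eq; rewrite /GRing.scale/= /wt /E1.
by case: b; case: h => /=; ring.
Qed.

Lemma continuous_wt b h : continuous (wt b h).
Proof.
by move=> t; apply/differentiable_continuous/derivable1_diffP; have [] := is_derive_wt b h t.
Qed.

Lemma continuous_wt' b h : continuous (wt' b h).
Proof.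
by move=> t; apply/differentiable_continuous/derivable1_diffP; have [] := is_derive_wt' b h t.
Qed.

Lemma ws_wt (b h : bool) (t : R) : (h -> 0 < t) -> ws b h t = wt b h t.
Proof.
rewrite /ws /wt /w0 /w1; case: h => [/(_ isT) t0|_]; case: b => /=; rewrite ?t0; ring.
Qed.

Variables (n k : nat).
Notation lam := (@lebesgue_rV R n).

Definition smodes (j : option 'I_n) : 'rV[R]_n -> R :=
  tensor (fun l => wt (j == Some l) (n - k <= l)%N).

Lemma modes_smodes j x : orthant k x -> modes k j x = smodes j x.
Proof. by move=> Dx; apply: eq_bigr => l _; apply: ws_wt => kl; exact: Dx. Qed.

Lemma partial_smodes j i : partial i (smodes j) =
  tensor (upd (fun l => wt (j == Some l) (n - k <= l)%N) i (wt' (j == Some i) (n - k <= i)%N)).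
Proof. by apply: partial_tensor => t; exact: is_derive_wt. Qed.

Lemma partial2_smodes j i : partial i (partial i (smodes j)) = (fun x =>
  (x 0 i ^+ 2 - E1 (n - k <= i)%N - (2 * (j == Some i))%:R) * smodes j x).
Proof.
rewrite partial_smodes.
have d (t : R) : is_derive t 1 (upd (fun l => wt (j == Some l) (n - k <= l)%N) i
     (wt' (j == Some i) (n - k <= i)%N) i)
   ((t ^+ 2 - E1 (n - k <= i)%N - (2 * (j == Some i))%:R) * wt (j == Some i) (n - k <= i)%N t).
  by rewrite /upd eqxx; exact: is_derive_wt'.
rewrite (partial_tensor d).
apply/funext => x; rewrite tensor_updE [smodes j x](tensorD1 _ i) -mulrA; congr (_ * (_ * _)).
by apply: eq_bigr => l li; rewrite /upd (negbTE li).
Qed.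

Lemma C1_smodes j : C1 (smodes j).
Proof. apply: (C1_tensor (fun i t => is_derive_wt _ _ t)) => i.
exact: continuous_wt'. Qed.

Lemma C1_partial_smodes j i : C1 (partial i (smodes j)).
Proof.
rewrite partial_smodes.
apply: (@C1_tensor _ _ _ (fun l => if l == i then
   (fun t => (t ^+ 2 - E1 (n - k <= l)%N - (2 * (j == Some l))%:R) * wt (j == Some l) (n - k <= l)%N t)
   else wt' (j == Some l) (n - k <= l)%N)) => [l t|l]; rewrite /upd; case: ifPn => [/eqP ->|_].
- exact: is_derive_wt'.
- exact: is_derive_wt.
- apply: continuous_mulr; last exact: continuous_wt.
  by apply: continuous_subr => [|x]; [apply: continuous_subr => x; [exact: exprn_continuous|exact: cvg_cst]|exact: cvg_cst].
- exact: continuous_wt'.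
Qed.

Lemma ip_modes_smodes j f : (forall x, ~ orthant k x -> f x = 0) ->
  ip lam (modes k j) f = \int[lam]_x (smodes j x * f x).
Proof.
move=> f0; apply: eq_Rintegral => x _.
have [Dx|Dx] := pselect (orthant k x); first by rewrite modes_smodes.
by rewrite f0// !mulr0.
Qed.

(** Against a function supported in the orthant a mode can be replaced by its smooth extension. Two
    integrations by parts then leave no boundary term on the faces and move both derivatives onto
    the eigenfunction. *)
Lemma weak_eigen j i phi : test_function k phi ->
  - ip lam (modes k j) (partial i (partial i phi)) +
    ip lam (modes k j) (fun x => x 0 i * (x 0 i * phi x)) -
    E1 (n - k <= i)%N * ip lam (modes k j) phi =
  (2 * (j == Some i))%:R * ip lam (modes k j) phi.
Proof.
move=> tf; have tp := test_function_testC1 tf; have tpi := test_function_partial i tf.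
have [cp _ _ [M M0 hM]] := tp.
have e := envelope_envn (R := R) n.
have out x : ~ orthant k x -> phi x = 0 by exact: testC1_out.
rewrite !ip_modes_smodes//; last 2 first.
- by move=> x Dx; rewrite out// !mulr0.
- by move=> x; exact: testC1_partial_out.
rewrite (by_parts _ (C1_smodes j) tpi) (by_parts _ (C1_partial_smodes j i) tp) !opprK.
rewrite partial2_smodes.
have cs : continuous (smodes j) by have [] := C1_smodes j.
have ds : dominated (@envn R n) (fun x => smodes j x * phi x).
  apply: (@dominated_cbox _ _ _ k M); first exact: continuous_mulr.
  by move=> x; rewrite mulf_eq0 negb_or => /andP[_ ?]; apply: hM; left.
have dx : dominated (@envn R n) (fun x => x 0 i ^+ 2 * (smodes j x * phi x)).
  apply: (@dominated_cbox _ _ _ k M).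
    apply: continuous_mulr; last exact: continuous_mulr.
    rewrite (_ : (fun x => _) = (fun x : 'rV[R]_n => x 0 i * x 0 i)).
      by apply: continuous_mulr; exact: continuous_coord.
    by apply/funext => x; rewrite expr2.
  by move=> x; rewrite !mulf_eq0 !negb_or => /and3P[_ _ ?]; apply: hM; left.
set S := \int[lam]_x (smodes j x * phi x).
have -> : \int[lam]_x ((x 0 i ^+ 2 - E1 (n - k <= i)%N - (2 * (j == Some i))%:R) * smodes j x * phi x) =
   \int[lam]_x (x 0 i ^+ 2 * (smodes j x * phi x)) - (E1 (n - k <= i)%N + (2 * (j == Some i))%:R) * S.
  rewrite -(intZ e _ ds) -(intB e dx (dominatedZ _ ds)).
  by apply: eq_Rintegral => x _; ring.
have -> : \int[lam]_x (smodes j x * (x 0 i * (x 0 i * phi x))) =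
  \int[lam]_x (x 0 i ^+ 2 * (smodes j x * phi x)).
  by apply: eq_Rintegral => x _; ring.
by ring.
Qed.

End eigenfunctions.

(** * The deficit of a combination of modes *)

Section extremal_deficit.
Context {R : realType}.
Variables n k : nat.
Hypothesis hk : (1 <= k <= n)%N.
Notation lam := (@lebesgue_rV R n).
Notation D := (@orthant R n k).
Variables (u : 'rV[R]_n -> R) (g : 'rV[R]_n -> 'rV[R]_n).
Variables (phi : nat -> 'rV[R]_n -> R).
Hypothesis mu : measurable_fun D u.
Hypothesis mg : forall i, measurable_fun D (fun x => g x 0 i).
Hypothesis tphi : forall j, test_function k (phi j).
Hypothesis cphi :
  S_norm k (u \- phi j) (g \- gradient (phi j)) @[j --> \oo] --> 0%E.

Let U := u \_ D.
Let G i := (fun x => g x 0 i) \_ D.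
Let t1 j : testC1 k (phi j). Proof. exact: test_function_testC1. Qed.
Let LU : L2 lam U. Proof. exact: (in_S_L2 hk mu mg t1 cphi). Qed.
Let LG i : L2 lam (G i). Proof. exact: (in_S_grad_L2 mg t1 cphi). Qed.
Let LX i : L2 lam (fun x : 'rV[R]_n => x 0 i * U x).
Proof. exact: (in_S_coord_L2 mu t1 cphi). Qed.

(** The identity for the approximants [phi l] passes to the L^2 limit: [G] is the weak gradient of
    [U]. *)
Lemma grad_by_parts psi i : test_function k psi ->
  ip lam (G i) (partial i psi) = - ip lam U (partial i (partial i psi)).
Proof.
move=> tpsi; have tp := test_function_partial i tpsi.
have Lp : L2 lam (partial i psi) := testC1_L2 tp.
have Lpp : L2 lam (partial i (partial i psi)) := testC1_partial_L2 i tp.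
have c1 : ip lam (partial i (phi l)) (partial i psi) @[l --> \oo] --> ip lam (G i) (partial i psi).
  exact: (@cvg_ip _ _ _ lam (fun l => partial i (phi l)) (fun=> partial i psi)
    (G i) (partial i psi) (fun l => testC1_partial_L2 i (t1 l)) (fun=> Lp) (LG i) Lp
    (in_S_cvg_grad mu mg t1 cphi i) (cvg_ip_cst _)).
have c2 : - ip lam (phi l) (partial i (partial i psi)) @[l --> \oo] -->
    - ip lam U (partial i (partial i psi)).
  by apply: cvgN; exact: (in_S_cvg_ip hk mu mg t1 cphi).
have e : (fun l => ip lam (partial i (phi l)) (partial i psi)) =
    (fun l => - ip lam (phi l) (partial i (partial i psi))).
  apply/funext => l; apply/eqP; rewrite -eqr_oppLR /ip; apply/eqP; apply/esym.
  apply: (@by_parts _ _ k) => //.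
  by have [? ? ? _] := t1 l; split.
by rewrite e in c1; apply: (cvg_unique _ c1 c2).
Qed.

(** The bilinear form of the deficit with [U] in its first place. Only the second argument is
    required to be a test function, and it is then sent to [U] along [phi]. *)
Let B psi : R := \sum_i ip lam (G i) (partial i psi) +
  \sum_i ip lam (fun x : 'rV[R]_n => x 0 i * U x) (fun x => x 0 i * psi x) -
  (n + 2 * k)%:R * ip lam U psi.

Let cvgB_deficit : B (phi j) @[j --> \oo] --> real_deficit k u g.
Proof.
apply: cvgB; first apply: cvgD.
- apply: cvg_big => [|i _]; first by move=> x; exact: add_continuous.
  exact: (@cvg_ip _ _ _ lam (fun=> G i) (fun l => partial i (phi l)) (G i) (G i)
    (fun=> LG i) (fun l => testC1_partial_L2 i (t1 l)) (LG i) (LG i) (cvg_ip_cst _)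
    (in_S_cvg_grad mu mg t1 cphi i)).
- apply: cvg_big => [|i _]; first by move=> x; exact: add_continuous.
  exact: (@cvg_ip _ _ _ lam (fun=> fun x : 'rV[R]_n => x 0 i * U x)
    (fun l x => x 0 i * phi l x) (fun x => x 0 i * U x) (fun x => x 0 i * U x)
    (fun=> LX i) (fun l => testC1_coord_L2 i (t1 l)) (LX i) (LX i) (cvg_ip_cst _)
    (in_S_cvg_coord mu mg t1 cphi i)).
have h : ip lam U (phi l) @[l --> \oo] --> ip lam U U.
  under eq_fun do rewrite ipC.
  exact: (in_S_cvg_ip hk mu mg t1 cphi LU).
by apply: cvgMr; exact: h.
Qed.

Variable c : option 'I_n -> R.
Hypothesis uc : {ae lam, forall x, U x = comb k c x}.

Lemma ip_ae_comb f : L2 lam f -> ip lam U f = ip lam (comb k c) f.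
Proof.
move=> [mf _]; have [mU _] := LU; have [mc _] := @comb_L2 R n k c.
rewrite /ip /Rintegral; congr fine; apply: ae_eq_integral => //.
- by apply/measurable_EFinP; exact: measurable_funM.
- by apply/measurable_EFinP; exact: measurable_funM.
by apply: filterS uc => x /= ->.
Qed.

(** By the weak eigenvalue equations each mode contributes the excess of its level over the ground
    energy: 2 for [Some i] and 0 for [None]. *)
Let B_test psi : test_function k psi ->
  B psi = 2 * \sum_i c (Some i) * ip lam (modes k (Some i)) psi.
Proof.
move=> tpsi; have tp := test_function_testC1 tpsi.
have Lpsi : L2 lam psi := testC1_L2 tp.
rewrite /B -(sumE1 hk) -big_split/= mulr_suml -sumrB.
have Lxx i : L2 lam (fun x : 'rV[R]_n => x 0 i * (x 0 i * psi x)).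
  have [cp _ _ [M M0 hM]] := tp.
  apply: dominated_L2; apply: (@dominated_cbox _ _ _ k M).
    by apply: continuous_mulr; [|apply: continuous_mulr => //]; exact: continuous_coord.
  by move=> x; rewrite !mulf_eq0 !negb_or => /and3P[_ _ ?]; apply: hM; left.
transitivity (\sum_i \sum_j c j * ((2 * (j == Some i))%:R * ip lam (modes k j) psi)).
  apply: eq_bigr => i _; rewrite grad_by_parts//.
  have -> : ip lam (fun x : 'rV[R]_n => x 0 i * U x) (fun x => x 0 i * psi x) =
     ip lam U (fun x => x 0 i * (x 0 i * psi x)).
    by apply: eq_Rintegral => x _; ring.
  rewrite !ip_ae_comb//; last exact: (testC1_partial_L2 i (test_function_partial i tpsi)).
  rewrite !ip_comb//; last exact: (testC1_partial_L2 i (test_function_partial i tpsi)).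
  rewrite -sumrN mulr_sumr -big_split/= -sumrB; apply: eq_bigr => j _.
  by rewrite -(weak_eigen j i tpsi); ring.
rewrite mulr_sumr; apply: eq_bigr => i _.
rewrite (bigD1 (Some i))//= eqxx big1 ?addr0; first by rewrite muln1; ring.
by move=> j /negbTE ->; rewrite muln0 mul0r mulr0.
Qed.

(** The sequence [B (phi j)] has two limits, the deficit and the value predicted by [B_test]; they
    must agree. *)
Lemma extremal_deficit :
  real_deficit k u g = 2 * \sum_i c (Some i) ^+ 2 * @gram R k n (Some i) (Some i).
Proof.
have c1 := cvgB_deficit.
have -> : \sum_i c (Some i) ^+ 2 * @gram R k n (Some i) (Some i) =
    \sum_i c (Some i) * ip lam (modes k (Some i)) U.
  apply: eq_bigr => i _; rewrite ipC ip_ae_comb; last exact: modes_L2.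
  by rewrite ipC ip_modes_comb; ring.
have c2 : 2 * \sum_i c (Some i) * ip lam (modes k (Some i)) (phi j) @[j --> \oo] -->
    2 * \sum_i c (Some i) * ip lam (modes k (Some i)) U.
  apply: cvgMr; apply: cvg_big => [|i _]; first by move=> x; exact: add_continuous.
  apply: cvgMr; rewrite ipC; under eq_fun do rewrite ipC.
  by apply: (in_S_cvg_ip hk mu mg t1 cphi); exact: modes_L2.
have e : (fun j => B (phi j)) =
   (fun j => 2 * \sum_i c (Some i) * ip lam (modes k (Some i)) (phi j)).
  by apply/funext => j; exact: B_test.
by rewrite e in c1; apply: (cvg_unique _ c1 c2).
Qed.

Lemma extremal_dist : ip lam U U -
    (@gram R k n None None)^-1 * ip lam (modes k None) U ^+ 2 =
  \sum_i c (Some i) ^+ 2 * @gram R k n (Some i) (Some i).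
Proof.
have Lc := @comb_L2 R n k c.
rewrite ip_ae_comb// ipC ip_ae_comb// ip_comb//.
rewrite [ip lam (modes k None) U]ipC ip_ae_comb; last exact: modes_L2.
rewrite ipC ip_modes_comb big_option/= ip_modes_comb.
have -> : (@gram R k n None None)^-1 * (c None * @gram R k n None None) ^+ 2 =
   c None * (c None * @gram R k n None None).
  by field; rewrite gt_eqF// gram_gt0.
by rewrite [X in X - _]addrC addrK; apply: eq_bigr => i _; rewrite ip_modes_comb; ring.
Qed.

End extremal_deficit.

Section equality.
Context {R : realType}.
Variables n k : nat.
Hypothesis hk : (1 <= k <= n)%N.
Variables (u : 'rV[R]_n -> R) (g : 'rV[R]_n -> 'rV[R]_n).
Hypothesis Sug : in_S k u g.
Variables (b : 'rV[R]_n) (b0 : R).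
Hypothesis ub : {ae lebesgue_rV n, forall x, orthant k x -> u x = extremal k b b0 x}.

Let uc : {ae lebesgue_rV n, forall x, (u \_ (orthant k)) x = comb k (extremal_coef b b0) x}.
Proof.
apply: filterS ub => x ux; rewrite -extremal_comb !patchE.
by case: ifPn => // /[!inE] /ux.
Qed.

Lemma extremal_sqdist : sqdist_ground k u =
  (\sum_i b 0 i ^+ 2 * @gram R k n (Some i) (Some i))%:E.
Proof.
have [mu mg [phi [tphi cphi]]] := Sug.
rewrite sqdist_groundE; last exact: (in_S_restrict_L2 hk Sug).
by rewrite (extremal_dist hk mu mg tphi cphi uc).
Qed.

Lemma extremal_equality : deficit k u g = (2%:E * sqdist_ground k u)%E.
Proof.
have [mu mg [phi [tphi cphi]]] := Sug.
rewrite extremal_sqdist (in_S_deficitE hk Sug) -EFinM; congr EFin.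
exact: (extremal_deficit hk mu mg tphi cphi uc).
Qed.

End equality.

(** * Approximation of the extremals *)

Section bump.
Context {R : realType}.

(** The flat function exp(-1/s) and its multiples by powers of 1/s. The whole family is needed
    because it is closed, up to linear combinations, under differentiation. *)
Definition bump (m : nat) (s : R) : R :=
  if 0 < s then s^-1 ^+ m * expR (- s^-1) else 0.

Lemma bump_out m s : s <= 0 -> bump m s = 0.
Proof. by rewrite /bump leNgt => /negbTE ->. Qed.

Lemma bump_ge0 m s : 0 <= bump m s.
Proof. by rewrite /bump; case: ifP => // s0; rewrite mulr_ge0 ?expR_ge0// exprn_ge0// invr_ge0 ltW. Qed.

Lemma pow_expR_le (y : R) m : 0 <= y -> y ^+ m * expR (- y) <= m`!%:R.
Proof.
move=> y0; rewrite expRN ler_pdivrMr ?expR_gt0//.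
case: m => [|m].
  rewrite expr0 fact0 mul1r; apply: le_trans (expR_ge1Dx y).
  by rewrite lerDl.
rewrite mulrC -ler_pdivrMr ?ltr0n ?fact_gt0//.
by apply: le_trans (expR_ge1Dxn m y0); rewrite lerDr.
Qed.

Lemma bump_le m s : bump m s <= m`!%:R.
Proof.
rewrite /bump; case: ifP => [s0|_]; last exact: ler0n.
by apply: pow_expR_le; rewrite invr_ge0 ltW.
Qed.

Lemma bumpS m s : 0 < s -> s * bump m.+1 s = bump m s.
Proof. by move=> s0; rewrite /bump s0 exprS !mulrA mulfV ?mul1r// gt_eqF. Qed.

Lemma is_derive_bump m (s : R) : is_derive s 1 (bump m) (bump m.+2 s - m%:R * bump m.+1 s).
Proof.
have [s0|s0|->] := ltgtP s 0.
- have E : \near s, (cst 0 : R -> R) s = bump m s.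
    have : nbhs s [set t : R | t < 0] by apply: open_nbhs_nbhs; split => //; exact: open_lt.
    by apply: filterS => t /= t0; rewrite bump_out// ltW.
  rewrite !bump_out ?ltW// mulr0 subr0; apply: near_eq_is_derive E _.
- have E : \near s, s^-1 ^+ m * expR (- s^-1) = bump m s.
    have : nbhs s [set t : R | 0 < t] by apply: open_nbhs_nbhs; split => //; exact: open_gt.
    by apply: filterS => t /= t0; rewrite /bump t0.
  apply: near_eq_is_derive E _.
  have s1 : s != 0 by rewrite gt_eqF.
  have dV : is_derive s 1 (fun t : R => t^-1) (- s ^- 2).
    have := @is_deriveV R id s 1 1 s1 _; rewrite /GRing.scale/= mulr1; apply.
  have dY : is_derive s^-1 1 (fun y : R => y ^+ m * expR (- y))
      ((m%:R * s^-1 ^+ m.-1 - s^-1 ^+ m) * expR (- s^-1)).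
    have dX : is_derive (s^-1 : R) 1 (fun y : R => y ^+ m) (m%:R * s^-1 ^+ m.-1).
      elim: (m) => [|m' ih].
        rewrite mul0r; have -> : (fun y : R => y ^+ 0) = cst 1.
          by apply/funext => y; rewrite expr0.
        exact: is_derive_cst.
      have -> : (fun y : R => y ^+ m'.+1) = id \* (fun y => y ^+ m').
        by apply/funext => y; rewrite exprS.
      apply: (@is_derive_eq _ _ _ _ _ _ _ _ (is_deriveM (is_derive_id _ _) ih)).
      rewrite /GRing.scale/=; case: (m') => [|p]; first by rewrite !expr0; ring.
      by rewrite [p.+1.-1]/= exprS; ring.
    have dE : is_derive (s^-1 : R) 1 (fun y : R => expR (- y)) (- expR (- s^-1)).
      by apply: is_derive_eq; rewrite /GRing.scale/=; ring.
    have := is_deriveM dX dE; rewrite /GRing.scale/= => d.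
    by apply: is_derive_eq; ring.
  have -> : bump m.+2 s - m%:R * bump m.+1 s =
      (m%:R * s^-1 ^+ m.-1 - s^-1 ^+ m) * expR (- s^-1) * - s ^- 2.
    rewrite /bump s0 -exprVn; case: m {dY} => [|m]; first by rewrite !mul0r; ring.
    by rewrite [m.+1.-1]/= !exprS; ring.
  exact: (is_derive1_comp dY dV).
- rewrite !bump_out// mulr0 subr0.
  (* For h > 0 the quotient [bump m h / h] is [bump m.+1 h], that is [h * bump m.+2 h], at most h
     times the factorial of m + 2. *)
  suff : (fun h : R => h^-1 *: ((bump m \o shift 0) (h *: 1) - bump m 0)) @ 0^' --> (0 : R).
    by move=> h; split; [apply/cvg_ex; exists 0|apply/cvg_lim].
  apply/cvgr0Pnorm_lt => e e0.
  have K0 : 0 < (m.+2)`!%:R :> R by rewrite ltr0n fact_gt0.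
  near=> h.
  have hne : h != 0 by near: h; exact: nbhs_dnbhs_neq.
  rewrite /= /GRing.scale/= mulr1 addr0 [bump m 0]bump_out// subr0.
  have [h0|h0] := leP h 0; first by rewrite bump_out// mulr0 normr0.
  rewrite -(bumpS m h0) mulrA mulVf// mul1r -(bumpS m.+1 h0) ger0_norm; last first.
    by rewrite mulr_ge0 ?bump_ge0// ltW.
  apply: (@le_lt_trans _ _ (h * (m.+2)`!%:R)).
    by rewrite ler_wpM2l ?bump_le// ltW.
  rewrite -ltr_pdivlMr//; apply: le_lt_trans (ler_norm h) _.
  near: h; apply: dnbhs0_lt; exact: divr_gt0.
Unshelve. all: by end_near. Qed.

(** An existential form of N-fold differentiability, which makes stability under products and
    composition a direct induction on [N]. *)
Fixpoint Cn (N : nat) (f : R -> R) : Prop :=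
  if N is N'.+1 then exists2 f', (forall t : R, is_derive t 1 f (f' t)) & Cn N' f'
  else True.

Definition smooth1 f := forall N, Cn N f.

Lemma CnS N f : Cn N.+1 f -> Cn N f.
Proof. by elim: N f => // N ih f [f' df cf']; exists f' => //; exact: ih. Qed.

Lemma Cn_ext N f h : f =1 h -> Cn N f -> Cn N h.
Proof. by move=> /funext ->. Qed.

Lemma Cn_cst N c : Cn N (fun=> c).
Proof.
elim: N c => // N ih c; exists (fun=> 0) => // t; exact: is_derive_cst.
Qed.

Lemma CnD N f h : Cn N f -> Cn N h -> Cn N (fun t => f t + h t).
Proof.
elim: N f h => // N ih f h [f' df cf] [h' dh ch].
by exists (fun t => f' t + h' t); [move=> t; exact: is_deriveD|exact: ih].
Qed.

Lemma CnM N f h : Cn N f -> Cn N h -> Cn N (fun t => f t * h t).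
Proof.
elim: N f h => // N ih f h Cf Ch.
have [f' df cf] := Cf; have [h' dh ch] := Ch.
exists (fun t => f t * h' t + h t * f' t); first by move=> t; exact: is_deriveM.
by apply: CnD; apply: ih => //; exact: CnS.
Qed.

Lemma Cn_id N : Cn N id.
Proof.
by case: N => // N; exists (fun=> 1); [move=> t; exact: is_derive_id|exact: Cn_cst].
Qed.

Lemma Cn_comp N f q : Cn N f -> Cn N q -> Cn N (f \o q).
Proof.
elim: N f q => // N ih f q Cf Cq.
have [f' df cf] := Cf; have [q' dq cq] := Cq.
exists (fun t => f' (q t) * q' t); first by move=> t; exact: is_derive1_comp.
by apply: CnM => //; apply: (ih f' q) => //; exact: CnS.
Qed.

Lemma Cn_gs N : Cn N gs.
Proof.
elim: N => // N ih; exists (fun t => - 1 * t * gs t).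
  by move=> t; rewrite mulN1r; exact: is_derive_gs.
by apply: CnM => //; apply: CnM; [exact: Cn_cst|exact: Cn_id].
Qed.

Lemma Cn_bump N m : Cn N (bump m).
Proof.
elim: N m => // N ih m; exists (fun t => bump m.+2 t + (- m%:R) * bump m.+1 t).
  by move=> t; have := is_derive_bump m t; rewrite mulNr.
by apply: CnD => //; apply: CnM => //; exact: Cn_cst.
Qed.

Lemma smooth1_derive f : smooth1 f ->
  (forall t : R, is_derive t 1 f (f^`()%classic t)) /\ smooth1 (f^`()%classic).
Proof.
move=> sf; have dE f' : (forall t : R, is_derive t 1 f (f' t)) -> f^`()%classic = f'.
  by move=> df; apply/funext => t; rewrite derive1E; have [] := df t.
split; first by have [f' df _] := sf 1%N; rewrite (dE _ df).
by move=> N; have [f' df cf] := sf N.+1; rewrite (dE _ df).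
Qed.

Lemma smooth1_derive1n f m : smooth1 f ->
  smooth1 (f^`(m)%classic) /\ forall t : R, is_derive t 1 (f^`(m)%classic) (f^`(m.+1)%classic t).
Proof.
move=> sf; have h : smooth1 (f^`(m)%classic).
  by elim: m => //= m /smooth1_derive[].
split; first exact: h.
exact: (smooth1_derive h).1.
Qed.

End bump.

(** * One-dimensional cut-offs and their uniform bounds *)

Section cutoff.
Context {R : realType}.
Implicit Types (N t : R) (b h : bool).

(** Its positivity set is the support of the cut-off: t^2 < N on the line, and t + 1/t < N with t >
    0 on the half line, which avoids both 0 and infinity. At each fixed point of the domain [qc]
    grows without bound with [N], so exp(-1/qc) tends to 1. *)
Definition qc N h t : R := (if h then N * t - 1 else N) - t ^+ 2.
Definition dqc N h t : R := (if h then N else 0) - 2 * t.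
Definition cutoff N b h t : R := wt b h t * bump 0 (qc N h t).
Definition dcutoff N b h t : R :=
  wt' b h t * bump 0 (qc N h t) + wt b h t * (bump 2 (qc N h t) * dqc N h t).

Lemma is_derive_qc N h t : is_derive t 1 (qc N h) (dqc N h t).
Proof.
by rewrite /qc /dqc; case: h; apply: is_derive_eq; rewrite /GRing.scale/=; ring.
Qed.

Lemma is_derive_cut N b h t : is_derive t 1 (cutoff N b h) (dcutoff N b h t).
Proof.
have d0 : is_derive t 1 (bump 0 \o qc N h) (bump 2 (qc N h t) * dqc N h t).
  apply: is_derive1_comp; last exact: is_derive_qc.
  by have := is_derive_bump 0 (qc N h t); rewrite mul0r subr0.
have := is_deriveM (is_derive_wt b h t) d0; rewrite /GRing.scale/= => d.
by apply: is_derive_eq; rewrite /dcutoff; ring.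
Qed.

Lemma smooth1_cut N b h : smooth1 (cutoff N b h).
Proof.
move=> M; apply: CnM.
  rewrite /wt; apply: CnM; last exact: Cn_gs.
  by apply: CnD; [exact: Cn_cst|apply: CnM; [exact: Cn_cst|exact: Cn_id]].
apply: (@Cn_comp _ _ (bump 0) (qc N h)); first exact: Cn_bump.
apply: (@Cn_ext _ _ (fun t => (if h then N * t + -1 else N) + -1 * (t * t))).
  by move=> t; rewrite /qc; case: h; ring.
apply: CnD; last by apply: CnM; [exact: Cn_cst|apply: CnM; exact: Cn_id].
case: h; last exact: Cn_cst.
by apply: CnD; [apply: CnM; [exact: Cn_cst|exact: Cn_id]|exact: Cn_cst].
Qed.

Lemma cut_supp N b h t : 0 <= N -> cutoff N b h t != 0 ->
  `|t| <= N + 1 /\ (h -> (N + 1)^-1 <= t).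
Proof.
move=> N0 ct; have q0 : 0 < qc N h t.
  by rewrite ltNge; apply: contraNN ct => q0; rewrite /cutoff bump_out// mulr0.
have N1 : 0 < N + 1 by rewrite ltr_wpDl.
have tN : `|t| <= N + 1.
  rewrite ler_norml; move: q0; rewrite /qc; case: h ct => _ q0; apply/andP; split; nra.
split => // hh; rewrite hh /qc in q0.
rewrite -div1r ler_pdivrMr//.
have := sqr_ge0 t; have [t0|t0] := leP 0 t; nra.
Qed.

(** The left side is [bump 1 q + bump 2 q]. It compensates the growth in [N] of the derivative of
    the half-line cut-off. *)
Lemma bump_sum_le (q : R) : 0 < q -> (q + 1) * bump 2 q <= 3.
Proof.
move=> q0; rewrite mulrDl mul1r bumpS//.
have b1 : bump 1 q <= 1 := bump_le 1 q; have b2 : bump 2 q <= 2 := bump_le 2 q.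
by move: b1 b2; lra.
Qed.

Lemma gs_poly_le t : (1 + t ^+ 2) * gs t <= 4 * env1 t.
Proof.
rewrite gs_env1 mulrA ler_wpM2r ?(ltW (env1_gt0 t))// /env1 expRN ler_pdivrMr ?expR_gt0//.
have := expR_ge1Dx (t ^+ 2 / 4); lra.
Qed.

Lemma abs_le_sqr t : `|t| <= 1 + t ^+ 2.
Proof.
have := sqr_ge0 (`|t| - 1); rewrite -(real_normK (num_real t)).
move: (`|t|) (normr_ge0 t) => a a0; nra.
Qed.

Lemma wt_le b h t : `|wt b h t| <= 8 * env1 t.
Proof.
apply: (@le_trans _ _ (2 * ((1 + t ^+ 2) * gs t))); last by have := gs_poly_le t; lra.
rewrite /wt normrM (gtr0_norm (gs_gt0 t)) mulrA ler_wpM2r ?(ltW (gs_gt0 t))//.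
have := abs_le_sqr t; have := sqr_ge0 t.
by case: b; case: h => /= t2 tt; rewrite ?mul0r ?mul1r ?addr0 ?add0r ?normr0 ?normr1; lra.
Qed.

Lemma wt'_le b h t : `|wt' b h t| <= 8 * env1 t.
Proof.
apply: (@le_trans _ _ (2 * ((1 + t ^+ 2) * gs t))); last by have := gs_poly_le t; lra.
rewrite /wt' normrM (gtr0_norm (gs_gt0 t)) mulrA ler_wpM2r ?(ltW (gs_gt0 t))//.
have := abs_le_sqr t; rewrite ler_norml => /andP[t1 t2]; have := sqr_ge0 t => t3.
by rewrite ler_norml; case: b; case: h => /=; rewrite ?mul0r ?mul1r; apply/andP; split; lra.
Qed.

Lemma bump0_le1 (q : R) : `|bump 0 q| <= 1.
Proof. by rewrite ger0_norm ?bump_ge0//; apply: bump_le. Qed.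

Lemma cut_le N b h t : `|cutoff N b h t| <= 8 * env1 t.
Proof.
rewrite /cutoff normrM; apply: le_trans (wt_le b h t).
by rewrite -[leRHS]mulr1 ler_wpM2l// bump0_le1.
Qed.

(** The bound must not depend on [N], to serve in dominated convergence. On the half line the
    derivative of [qc] is of order [N] near 0, but the state vanishes there. *)
Lemma dcut_le N b h t : `|dcutoff N b h t| <= 24 * env1 t.
Proof.
suff H : `|wt b h t * (bump 2 (qc N h t) * dqc N h t)| <= 4 * ((1 + t ^+ 2) * gs t).
  have H1 : `|wt' b h t * bump 0 (qc N h t)| <= 8 * env1 t.
    rewrite normrM; apply: le_trans (wt'_le b h t).
    by rewrite -[leRHS]mulr1 ler_wpM2l// bump0_le1.
  apply: le_trans (ler_normD _ _) _; have := gs_poly_le t; lra.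
have [q0|q0] := leP (qc N h t) 0.
  by rewrite [bump 2 _]bump_out// mul0r mulr0 normr0 !mulr_ge0 ?(ltW (gs_gt0 t))// addr_ge0 ?sqr_ge0.
have B1 := bump_sum_le q0; have B0 := bump_ge0 2 (qc N h t).
have B2 : bump 2 (qc N h t) <= 2 by exact: bump_le.
rewrite /wt mulrAC normrM (gtr0_norm (gs_gt0 t)) mulrA ler_wpM2r ?(ltW (gs_gt0 t))//.
have t1 := sqr_ge0 t; have := abs_le_sqr t; rewrite ler_norml => /andP[t2 t3].
rewrite ler_norml; move: B1 B0 B2; move: q0; rewrite /qc /dqc.
case: h => q0; set q := (_ - t ^+ 2) in q0 *; move: (bump 2 q) => B B1 B0 B2.
  (* The key identity is t (N - 2 t) = q + 1 - t^2, in which [N] appears only through [q]. *)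
  have -> : ((~~ (b || true))%:R + (b (+) true)%:R * t) * (B * (N - 2 * t)) =
      (b (+) true)%:R * (B * (q + 1) - B * t ^+ 2).
    by rewrite /q orbT/=; ring.
  have h1 : 0 <= B * t ^+ 2 by rewrite mulr_ge0.
  have h2 : 0 <= B * (q + 1) by rewrite mulr_ge0// addr_ge0// ltW.
  have h3 : B * t ^+ 2 <= 2 * t ^+ 2 by rewrite ler_wpM2r.
  by case: b => /=; rewrite ?mul0r ?mul1r; apply/andP; split; lra.
have h1 : `|B * t| <= 2 * (1 + t ^+ 2).
  rewrite normrM (ger0_norm B0); apply: ler_pM => //; exact: abs_le_sqr.
have h2 : 0 <= B * t ^+ 2 <= 2 * t ^+ 2 by rewrite mulr_ge0//= ler_wpM2r.
move: h1 h2; rewrite ler_norml => /andP[h1 h1'] /andP[h2 h3].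
have -> : ((~~ (b || false))%:R + (b (+) false)%:R * t) * (B * (0 - 2 * t)) =
    (~~ b)%:R * (- 2 * (B * t)) - b%:R * (2 * (B * t ^+ 2)).
  by rewrite orbF addbF; ring.
by case: b => /=; rewrite ?mul0r ?mul1r; apply/andP; split; lra.
Qed.

Lemma qc_large h t (e : R) : 0 < e -> (h -> 0 < t) ->
  \forall j \near \oo, e < qc j%:R h t.
Proof.
move=> e0 ht; pose c := if h then t else 1.
have c0 : 0 < c by rewrite /c; case: ifP => // hh; exact: ht.
apply: filterS (nbhs_infty_gtr ((e + 1 + t ^+ 2) / c)) => j.
rewrite ltr_pdivrMr// /c /qc; case: (h); lra.
Qed.

Lemma cvg_inv_qc (a : nat -> R) h t (C : R) : (h -> 0 < t) ->
  (forall j, 1 < qc j%:R h t -> `|a j| * qc j%:R h t <= C) ->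
  a j @[j --> \oo] --> 0.
Proof.
move=> ht aC; apply/cvgr0Pnorm_lt => e e0.
have C1 : 0 < `|C| + 1 by rewrite ltr_wpDl.
have m0 : 0 < 1 + (`|C| + 1) / e by rewrite addr_gt0// divr_gt0.
apply: filterS (qc_large m0 ht) => j qj.
have q1 : 1 < qc j%:R h t by apply: lt_trans qj; rewrite ltrDl divr_gt0.
have q0 : 0 < qc j%:R h t by exact: lt_trans q1.
have := aC j q1; rewrite -ler_pdivlMr// => aj; apply: le_lt_trans aj _.
rewrite ltr_pdivrMr//; apply: (@lt_trans _ _ (`|C| + 1)).
  by apply: le_lt_trans (ler_norm C) _; rewrite ltrDl.
rewrite -ltr_pdivrMl// mulrC; apply: lt_trans qj; rewrite ltrDr//.
Qed.

Lemma cvg_bump_qc h t : (h -> 0 < t) -> bump 0 (qc j%:R h t) @[j --> \oo] --> (1 : R).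
Proof.
move=> ht; rewrite -[X in _ --> X]add0r.
under eq_fun do rewrite -[bump 0 _](subrK 1).
apply: cvgD; last exact: cvg_cst.
apply: (@cvg_inv_qc _ h t 1) => // j q1.
have q0 : 0 < qc j%:R h t by exact: lt_trans q1.
move: q0; move: (qc _ _ _) => q q0; rewrite /bump q0 expr0 mul1r.
have iq : 0 < q^-1 by rewrite invr_gt0.
have e1 : expR (- q^-1) <= 1 by rewrite -[leRHS]expR0 ler_expR oppr_le0 ltW.
have := expR_ge1Dx (- q^-1) => e2.
rewrite ler0_norm ?subr_le0// opprB -ler_pdivlMr// div1r; lra.
Qed.

(** Once q = qc exceeds 1, the derivative of [qc] is at most C q with C depending on [t] only, and
    q^2 [bump 2 q] is [bump 0 q <= 1]. The product is therefore at most C / q. *)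
Lemma cvg_bump2_dqc h t : (h -> 0 < t) ->
  bump 2 (qc j%:R h t) * dqc j%:R h t @[j --> \oo] --> (0 : R).
Proof.
move=> ht; pose C := (if h then (2 + t ^+ 2) / t else 0) + 2 * `|t|.
apply: (@cvg_inv_qc _ h t C) => // j q1.
have q0 : 0 < qc j%:R h t by exact: lt_trans q1.
have dC : `|dqc j%:R h t| <= C * qc j%:R h t.
  apply: (@le_trans _ _ ((if h then j%:R else 0) + 2 * `|t|)).
    rewrite /dqc; apply: le_trans (ler_normB _ _) _.
    rewrite normrM (ger0_norm (ler0n _ 2)) lerD2r.
    by case: h {ht C q1 q0}; rewrite ?normr0// ger0_norm.
  rewrite /C [leRHS]mulrDl; apply: lerD.
    have := ht; rewrite /qc in q0 q1 *; case: h q0 q1 {C ht} => [q0 q1 /(_ isT) t0|]; last by rewrite mul0r.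
    rewrite mulrAC ler_pdivlMr//; have := sqr_ge0 t; nra.
  by rewrite ler_peMr// ?ltW// mulr_ge0.
rewrite normrM (ger0_norm (bump_ge0 _ _)).
move: dC q0; move: (qc _ _ _) (dqc _ _ _) => q d dC q0.
apply: (@le_trans _ _ (C * (bump 2 q * q * q))).
  rewrite mulrAC [leRHS](_ : _ = bump 2 q * q * (C * q)); last by ring.
  by rewrite ler_wpM2l// mulr_ge0 ?bump_ge0// ltW.
have C0 : 0 <= C.
  rewrite /C addr_ge0 ?mulr_ge0//; case: ifP => // hh.
  by rewrite divr_ge0 ?addr_ge0 ?sqr_ge0// ltW// ht.
rewrite -[leRHS]mulr1 ler_wpM2l//.
by rewrite mulrC [bump 2 q * q]mulrC bumpS// bumpS//; exact: (bump_le 0).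
Qed.

Lemma cvg_cut b h t : (h -> 0 < t) -> cutoff j%:R b h t @[j --> \oo] --> wt b h t.
Proof.
move=> ht; rewrite -[X in _ --> X]mulr1.
by apply: cvgMr; exact: cvg_bump_qc.
Qed.

Lemma cvg_dcut b h t : (h -> 0 < t) -> dcutoff j%:R b h t @[j --> \oo] --> wt' b h t.
Proof.
move=> ht; rewrite -[X in _ --> X]addr0 -[X in _ --> X + _]mulr1 -(mulr0 (wt b h t)).
by apply: cvgD; apply: cvgMr; [exact: cvg_bump_qc|exact: cvg_bump2_dqc].
Qed.

End cutoff.

(** * Smoothness and convergence of tensor products *)

Section approximation.
Context {R : realType}.
Variable n : nat.
Implicit Types (p : 'I_n -> R -> R) (x : 'rV[R]_n).

Lemma continuous_cstr (T : topologicalType) (a : R) : continuous (fun _ : T => a).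
Proof. by move=> x; exact: cvg_cst. Qed.

Lemma is_derive_lincomb (I : Type) (r : seq I) (c : I -> R) (F dF : I -> 'rV[R]_n -> R) x v :
  (forall j, is_derive x v (F j) (dF j x)) ->
  is_derive x v (fun y => \sum_(j <- r) c j * F j y) (\sum_(j <- r) c j * dF j x).
Proof.
move=> dF_; elim: r => [|j r ih].
  by rewrite big_nil; under eq_fun do rewrite big_nil; exact: is_derive_cst.
rewrite big_cons; under eq_fun do rewrite big_cons.
by apply: is_deriveD => //; exact: is_deriveZ.
Qed.

Lemma partial_lincomb (I : Type) (r : seq I) (c : I -> R) (F dF : I -> 'rV[R]_n -> R) i :
  (forall j x, is_derive x (delta_mx 0 i) (F j) (dF j x)) ->
  partial i (fun y => \sum_(j <- r) c j * F j y) = (fun x => \sum_(j <- r) c j * dF j x).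
Proof.
move=> d; apply/funext => x.
by have [_] := is_derive_lincomb r c (fun j => d j x).
Qed.

(** In a mixed derivative of a tensor each factor is differentiated as often as its index occurs in
    [s]; smoothness thus reduces to one variable. *)
Lemma iter_partial_lincomb (I : Type) (r : seq I) (c : I -> R) (p : I -> 'I_n -> R -> R) s :
  (forall j l, smooth1 (p j l)) ->
  iter_partial s (fun x => \sum_(j <- r) c j * tensor (p j) x) =
  (fun x => \sum_(j <- r) c j * tensor (fun l => (p j l)^`(count_mem l s)%classic) x).
Proof.
move=> sp; elim: s => [//|i s ih].
rewrite [iter_partial _ _]/(partial i (iter_partial s _)) ih.
apply: partial_lincomb => j x.
rewrite (_ : (fun l => (p j l)^`(count_mem l (i :: s))%classic) =
  upd (fun l => (p j l)^`(count_mem l s)%classic) i ((p j i)^`((count_mem i s).+1)%classic)).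
  by apply: is_derive_tensor; exact: (smooth1_derive1n _ (sp j i)).2.
apply/funext => l; rewrite /upd/= eq_sym; case: eqP => [->|_] //=.
Qed.

Lemma smooth_lincomb (I : Type) (r : seq I) (c : I -> R) (p : I -> 'I_n -> R -> R) :
  (forall j l, smooth1 (p j l)) -> smooth (fun x => \sum_(j <- r) c j * tensor (p j) x).
Proof.
move=> sp s; rewrite iter_partial_lincomb//.
have d j l m (t : R) : derivable ((p j l)^`(m)%classic) t 1.
  by have [] := (smooth1_derive1n m (sp j l)).2 t.
split.
  apply: continuous_sumr => j; apply: continuous_mulr; first exact: continuous_cstr.
  apply: continuous_tensor => l t; apply/differentiable_continuous/derivable1_diffP.
  exact: d.
move=> i x; have h j : is_derive x (delta_mx 0 i)
  (tensor (fun l => (p j l)^`(count_mem l s)%classic))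
  (partial i (tensor (fun l => (p j l)^`(count_mem l s)%classic)) x).
  by split => //; exact: derivable_tensor.
by have [] := @is_derive_lincomb I r c _ (fun j => partial i (tensor (fun l => (p j l)^`(count_mem l s)%classic))) x _ h.
Qed.

Lemma tensor_le p (C : R) x : 0 <= C -> (forall l t, `|p l t| <= C * env1 t) ->
  `|tensor p x| <= C ^+ n * envn x.
Proof.
move=> C0 pC; rewrite /tensor normr_prod.
have -> : C ^+ n * envn x = \prod_(l < n) (C * env1 (x 0 l)).
  rewrite big_split/= prodr_const card_ord /env1 -expR_sum; congr (_ * expR _).
  by rewrite sumrN /sqnorm mulr_suml.
by apply: ler_prod => l _; rewrite normr_ge0 pC.
Qed.

Lemma cvg_tensor (p_ : nat -> 'I_n -> R -> R) p x :
  (forall l, p_ j l (x 0 l) @[j --> \oo] --> p l (x 0 l)) ->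
  tensor (p_ j) x @[j --> \oo] --> tensor p x.
Proof.
by move=> h; apply: cvg_big => [|l _]; [move=> y; exact: mul_continuous|exact: h].
Qed.

Lemma cvg_ip_null (F : nat -> 'rV[R]_n -> R) (K : R) :
  (forall j, measurable_fun setT (F j)) ->
  (forall j x, F j x * F j x <= K * envn x) ->
  (forall x, F j x @[j --> \oo] --> 0) ->
  (forall j, L2 (lebesgue_rV n) (F j)) /\
  ip (lebesgue_rV n) (F j) (F j) @[j --> \oo] --> 0.
Proof.
move=> mF FK F0.
have [me _ ie] := envelope_envn (R := R) n.
have iK : (lebesgue_rV n).-integrable setT (EFin \o (fun x : 'rV[R]_n => K * envn x)).
  by have := integrableZl measurableT K ie; apply: eq_integrable.
have FF j x : 0 <= F j x * F j x by rewrite -expr2 sqr_ge0.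
split => [j|].
  apply: integrable_L2 => //; apply: le_integrable iK => //.
    by apply/measurable_EFinP; exact: measurable_funM.
  by move=> x _; rewrite lee_fin ger0_norm// (le_trans (FK j x))// ler_norm.
rewrite [X in _ --> X](_ : _ = \int[lebesgue_rV n]_x (0 : R)); last first.
  by rewrite Rintegral_cst// mul0r.
apply: (@cvg_int _ _ _ (lebesgue_rV n) (fun j x => F j x * F j x) (fun=> 0) (fun x => K * envn x)) => //.
- by move=> j; exact: measurable_funM.
- by move=> x; rewrite -[X in _ --> X](mul0r 0); exact: (cvgM (F0 x) (F0 x)).
- by move=> j x; rewrite ger0_norm.
Qed.

End approximation.

Section extremal_in_S.
Context {R : realType}.
Variables n k : nat.
Variable c : option 'I_n -> R.
Notation lam := (@lebesgue_rV R n).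
Notation D := (@orthant R n k).

Definition sext (x : 'rV[R]_n) : R := \sum_j c j * smodes k j x.

Definition cutm (N : R) (j : option 'I_n) : 'I_n -> R -> R :=
  fun l => cutoff N (j == Some l) (n - k <= l)%N.

(** The cut-off is placed on every one-variable factor, so the approximants stay linear combinations
    of tensors. *)
Definition cutext (N : R) (x : 'rV[R]_n) : R := \sum_j c j * tensor (cutm N j) x.

Lemma cutext_supp N x : 0 <= N -> cutext N x != 0 -> in_box k (N + 1) x.
Proof.
move=> N0 ex; have [j ej] : exists j, tensor (cutm N j) x != 0.
  apply: contrapT => ne; move: ex; rewrite /cutext big1 ?eqxx// => j _.
  have [->|tj] := eqVneq (tensor (cutm N j) x) 0; first by rewrite mulr0.
  by exfalso; apply: ne; exists j.
move=> l; apply: (@cut_supp _ _ (j == Some l)) => //.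
by apply: contraNneq ej => e0; rewrite (tensorD1 _ l) /cutm e0 mul0r.
Qed.

Lemma test_function_cutext N : 0 <= N -> test_function k (cutext N).
Proof.
move=> N0; have N1 : 0 < N + 1 by rewrite ltr_wpDl.
pose A (i : 'I_n) : set R := `[if (n - k <= i)%N then (N + 1)^-1 else - (N + 1), N + 1]%classic.
pose B := [set x : 'rV[R]_n | forall i, A i (x ord0 i)].
have cB : compact B by apply: rV_compact => i; exact: segment_compact.
have sB : supp (cutext N) `<=` B.
  rewrite (closure_id B).1; last by apply: compact_closed => //; exact: norm_hausdorff.
  apply: closure_subset => x /= /(cutext_supp N0) h i.
  have [] := h i; rewrite ler_norml /A/= in_itv/= => /andP[h1 h2] h3.
  by rewrite h2 andbT; case: ifP => // /h3.
split.
- by apply: smooth_lincomb => j l; exact: smooth1_cut.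
- by apply: subclosed_compact sB => //; rewrite /supp; exact: closed_closure.
- move=> x /sB Bx i ki; have := Bx i; rewrite /A ki/= in_itv/= => /andP[+ _].
  by apply: lt_le_trans; rewrite invr_gt0.
Qed.

Lemma partial_sext i : partial i sext = (fun x => \sum_j c j *
  tensor (upd (fun l => wt (j == Some l) (n - k <= l)%N) i (wt' (j == Some i) (n - k <= i)%N)) x).
Proof. by apply: partial_lincomb => j x; apply: is_derive_tensor; exact: is_derive_wt. Qed.

Lemma partial_cutext N i : partial i (cutext N) = (fun x => \sum_j c j *
  tensor (upd (cutm N j) i (dcutoff N (j == Some i) (n - k <= i)%N)) x).
Proof. by apply: partial_lincomb => j x; apply: is_derive_tensor; exact: is_derive_cut. Qed.

(** The constant 24 is the bound of [dcut_le], the largest of those on the factors, so one constant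
    serves the functions and their derivatives for every [N]. *)
Let K0 : R := (\sum_j `|c j|) * 24 ^+ n.

Let lincomb_le (p : option 'I_n -> 'I_n -> R -> R) x :
  (forall j l t, `|p j l t| <= 24 * env1 t) ->
  `|\sum_j c j * tensor (p j) x| <= K0 * envn x.
Proof.
move=> pC; apply: le_trans (ler_norm_sum _ _ _) _.
rewrite /K0 -mulrA mulr_suml; apply: ler_sum => j _.
by rewrite normrM ler_wpM2l// tensor_le.
Qed.

Let wt24 b h t : `|wt b h t| <= 24 * env1 t :> R.
Proof. by apply: le_trans (wt_le b h t) _; rewrite ler_wpM2r ?ler_nat// ltW// env1_gt0. Qed.

Let wt'24 b h t : `|wt' b h t| <= 24 * env1 t :> R.
Proof. by apply: le_trans (wt'_le b h t) _; rewrite ler_wpM2r ?ler_nat// ltW// env1_gt0. Qed.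

Let cut24 N b h t : `|cutoff N b h t| <= 24 * env1 t :> R.
Proof. by apply: le_trans (cut_le N b h t) _; rewrite ler_wpM2r ?ler_nat// ltW// env1_gt0. Qed.

Let K0_ge0 : 0 <= K0.
Proof. by rewrite mulr_ge0// sumr_ge0. Qed.

Let sqB (a d e : R) : 0 <= e -> `|a| <= K0 * e -> `|d| <= K0 * e -> (a - d) * (a - d) <= 4 * K0 ^+ 2 * e ^+ 2.
Proof.
move=> e0 ha hd; rewrite -expr2 -(real_normK (num_real _)).
rewrite (_ : 4 * K0 ^+ 2 * e ^+ 2 = (K0 * e + K0 * e) ^+ 2); last by ring.
have Ke : 0 <= K0 * e by rewrite mulr_ge0 ?K0_ge0.
rewrite ler_sqr ?nnegrE ?(addr_ge0 Ke Ke)//.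
by apply: le_trans (ler_normB _ _) _; exact: lerD.
Qed.

Let envn_sq (x : 'rV[R]_n) : envn x ^+ 2 <= envn x.
Proof. by rewrite expr2 ler_piMr// ?envn_le1// ltW// envn_gt0. Qed.

Let envn_coord (x : 'rV[R]_n) i : x 0 i ^+ 2 * envn x ^+ 2 <= 4 * envn x.
Proof.
rewrite expr2 mulrA ler_wpM2r// ?(ltW (envn_gt0 x))// /envn expRN ler_pdivrMr ?expR_gt0//.
have h1 := expR_ge1Dx (sqnorm x / 4); have h2 := coord_le_sqnorm x i.
by move: h1 h2; rewrite /=; lra.
Qed.

Let H i (j : nat) : 'rV[R]_n -> R :=
  (fun x => partial i sext x - partial i (cutext j%:R) x) \_ D.
Let X (i : 'I_n) (j : nat) (x : 'rV[R]_n) : R :=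
  x 0 i * ((fun x => sext x - cutext j%:R x) \_ D) x.

Let csext : continuous sext.
Proof.
apply: continuous_sumr => j; apply: continuous_mulr; first exact: continuous_cstr.
by have [] := @C1_smodes R n k j.
Qed.

Let cpsext i : continuous (partial i sext).
Proof.
rewrite partial_sext; apply: continuous_sumr => j.
apply: continuous_mulr; first exact: continuous_cstr.
rewrite -partial_smodes.
by have [] := @C1_smodes R n k j.
Qed.

Let t1 (j : nat) : testC1 k (cutext j%:R).
Proof. exact/test_function_testC1/test_function_cutext. Qed.

Let mH i j : measurable_fun setT (H i j).
Proof.
apply: measurable_restrict_orthant; apply: measurable_funTS.
apply: measurable_funB; apply: continuous_measurable_rV => //.
by have [] := t1 j.
Qed.

Let mX i j : measurable_fun setT (X i j).
Proof.
apply: measurable_funM; first exact: measurable_coord.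
apply: measurable_restrict_orthant; apply: measurable_funTS.
apply: measurable_funB; apply: continuous_measurable_rV => //.
by have [] := t1 j.
Qed.

Let HL i : (forall j, L2 lam (H i j)) /\ ip lam (H i j) (H i j) @[j --> \oo] --> 0.
Proof.
apply: (@cvg_ip_null _ _ _ (4 * K0 ^+ 2)) => [|j x|x]; first exact: mH.
  rewrite /H patchE; case: ifP => _; last first.
    by rewrite mulr0 mulr_ge0 ?(ltW (envn_gt0 x))// mulr_ge0 ?sqr_ge0.
  apply: (@le_trans _ _ (4 * K0 ^+ 2 * envn x ^+ 2)); last first.
    by rewrite ler_wpM2l ?envn_sq// mulr_ge0 ?sqr_ge0.
  rewrite partial_sext partial_cutext; apply: sqB; first exact: ltW (envn_gt0 x).
  - by apply: lincomb_le => l m t; rewrite /upd; case: ifP.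
  - by apply: lincomb_le => l m t; rewrite /upd; case: ifP => _; [exact: dcut_le|exact: cut24].
have [Dx|Dx] := pselect (D x); last first.
  rewrite (_ : (fun j => H i j x) = fun=> 0); first exact: cvg_cst.
  by apply/funext => j; rewrite /H patchE memNset.
rewrite (_ : (fun j => H i j x) = (fun j => partial i sext x - partial i (cutext j%:R) x)); last first.
  by apply/funext => j; rewrite /H patchE mem_set.
rewrite -[X in _ --> X](subrr (partial i sext x)).
apply: cvgB; first exact: cvg_cst.
under eq_fun do rewrite partial_cutext.
rewrite partial_sext; apply: cvg_big => [|j _]; first by move=> y; exact: add_continuous.
apply: cvgMr; apply: (@cvg_tensor _ _ (fun N => upd (cutm N%:R j) i (dcutoff N%:R (j == Some i) (n - k <= i)%N))) => l.
by rewrite /upd; case: ifP => [/eqP ->|_]; [apply: cvg_dcut|apply: cvg_cut] => kl; exact: Dx.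
Qed.

Let XL i : (forall j, L2 lam (X i j)) /\ ip lam (X i j) (X i j) @[j --> \oo] --> 0.
Proof.
(* A factor 4 comes from the square of a difference, another 4 from x_i^2 [envn]^2 <= 4 [envn]. *)
apply: (@cvg_ip_null _ _ _ (16 * K0 ^+ 2)) => [|j x|x]; first exact: mX.
  rewrite /X patchE; case: ifP => _; last first.
    by rewrite !mulr0 mulr_ge0 ?(ltW (envn_gt0 x))// mulr_ge0 ?sqr_ge0.
  rewrite mulrACA -expr2.
  apply: (@le_trans _ _ (x 0 i ^+ 2 * (4 * K0 ^+ 2 * envn x ^+ 2))); last first.
    rewrite [leLHS](_ : _ = 4 * K0 ^+ 2 * (x 0 i ^+ 2 * envn x ^+ 2)); last by ring.
    rewrite [leRHS](_ : _ = 4 * K0 ^+ 2 * (4 * envn x)); last by ring.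
    by rewrite ler_wpM2l ?envn_coord// mulr_ge0 ?sqr_ge0.
  rewrite ler_wpM2l ?sqr_ge0//; apply: sqB; first exact: ltW (envn_gt0 x).
  - exact: lincomb_le.
  - by apply: lincomb_le => l m t; exact: cut24.
have [Dx|Dx] := pselect (D x); last first.
  rewrite (_ : (fun j => X i j x) = fun=> 0); first exact: cvg_cst.
  by apply/funext => j; rewrite /X patchE memNset// mulr0.
rewrite (_ : (fun j => X i j x) = (fun j => x 0 i * (sext x - cutext j%:R x))); last first.
  by apply/funext => j; rewrite /X patchE mem_set.
rewrite -[X in _ --> X](mulr0 (x 0 i)) -(subrr (sext x)).
apply: cvgMr; apply: cvgB; first exact: cvg_cst.
apply: cvg_big => [|j _]; first by move=> y; exact: add_continuous.
apply: cvgMr; apply: (@cvg_tensor _ _ (fun N => cutm N%:R j)) => l.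
by apply: cvg_cut => kl; exact: Dx.
Qed.

(** Dominated convergence, applied to each derivative and each moment, makes the cut-offs converge
    in the norm of S; only values on the orthant enter. *)
Lemma in_S_sext u : (forall x, D x -> u x = sext x) -> in_S k u (gradient sext).
Proof.
move=> uE.
have ein : {in D, sext =1 u} by move=> x /[!inE] /uE.
split.
- apply: (eq_measurable_fun _ ein).
  by apply: measurable_funTS; exact: continuous_measurable_rV.
- move=> i; rewrite (_ : (fun x => _) = partial i sext); last by apply/funext => x; rewrite mxE.
  by apply: measurable_funTS; exact: continuous_measurable_rV.
exists (fun j => cutext j%:R); split; first by move=> j; exact: test_function_cutext.
have gE j : grad_int k (gradient sext \- gradient (cutext j%:R)) =
    (\sum_i ip lam (H i j) (H i j))%:E.
  rewrite -sumsqE; last by move=> i; exact: (HL i).1.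
  rewrite grad_intE; apply: eq_integral => x _; congr EFin; apply: eq_bigr => i _.
  suff -> : ((fun y => (gradient sext \- gradient (cutext j%:R)) y 0 i) \_ D) x = H i j x by [].
  by rewrite /H !patchE; case: ifP => // _; rewrite !mxE.
have mE j : moment_int k (u \- cutext j%:R) = (\sum_i ip lam (X i j) (X i j))%:E.
  rewrite -sumsqE; last by move=> i; exact: (XL i).1.
  rewrite moment_intE; apply: eq_integral => x _; congr EFin; apply: eq_bigr => i _.
  suff -> : ((u \- cutext j%:R) \_ D) x = ((fun x => sext x - cutext j%:R x) \_ D) x by [].
  by rewrite !patchE; case: ifPn => // /[!inE] Dx; rewrite /= uE.
have sE : (fun j => S_norm k (u \- cutext j%:R) (gradient sext \- gradient (cutext j%:R))) =
    EFin \o (fun j => Num.sqrt (\sum_i ip lam (H i j) (H i j)) +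
    Num.sqrt (\sum_i ip lam (X i j) (X i j))).
  by apply/funext => j; rewrite /S_norm gE mE.
rewrite sE; apply: cvg_EFin; first exact: nearW.
rewrite [X in _ --> X](_ : _ = Num.sqrt (\sum_(i < n) 0 : R) + Num.sqrt (\sum_(i < n) 0 : R)); last first.
  by rewrite big1// sqrtr0 addr0.
apply: cvgD; apply: continuous_cvg; try exact: sqrt_continuous.
  by apply: cvg_big => [|i _]; [move=> y; exact: add_continuous|exact: (HL i).2].
by apply: cvg_big => [|i _]; [move=> y; exact: add_continuous|exact: (XL i).2].
Qed.

End extremal_in_S.

Lemma extremal_in_S (R : realType) (n k : nat) (b : 'rV[R]_n) b0 :
  exists g : 'rV[R]_n -> 'rV[R]_n, in_S k (extremal k b b0) g.
Proof.
exists (gradient (sext k (extremal_coef b b0))); apply: in_S_sext => x Dx.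
have := congr1 (fun f => f x) (@extremal_comb R n k b b0).
rewrite patchE mem_set// => ->; apply: eq_bigr => j _.
by rewrite modes_smodes.
Qed.

Theorem theorem5p1 (R : realType) (n k : nat) (hn : (1 <= n)%N)
    (hk : (1 <= k <= n)%N) :
  [/\ forall (u : 'rV[R]_n -> R) (g : 'rV[R]_n -> 'rV[R]_n), in_S k u g ->
        (2%:E * sqdist_ground k u <= deficit k u g)%E,
      (k < n)%N -> forall C : R,
        (forall (u : 'rV[R]_n -> R) (g : 'rV[R]_n -> 'rV[R]_n), in_S k u g ->
          (C%:E * sqdist_ground k u <= deficit k u g)%E) ->
        C <= 2,
      forall (u : 'rV[R]_n -> R) (g : 'rV[R]_n -> 'rV[R]_n), in_S k u g ->
        (deficit k u g = 2%:E * sqdist_ground k u)%E <->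
        exists (b : 'rV[R]_n) (b0 : R),
          {ae lebesgue_rV n, forall x, orthant k x -> u x = extremal k b b0 x} &
      forall (b : 'rV[R]_n) (b0 : R),
        exists g : 'rV[R]_n -> 'rV[R]_n, in_S k (extremal k b b0) g].
Proof.
split.
- by move=> u g; exact: deficit_ge.
- move=> kn C hC; have n0 : (0 < n)%N by exact: leq_trans kn.
  (* As [k < n], the first coordinate is free. Its product with the ground state is orthogonal to
     the ground state and nonzero, so its distance is positive while its deficit is exactly twice
     the squared distance. *)
  pose i0 := Ordinal n0; pose b : 'rV[R]_n := delta_mx 0 i0.
  have [g Sg] := @extremal_in_S R n k b 0.
  have ub : {ae lebesgue_rV n, forall x, orthant k x -> extremal k b 0 x = extremal k b 0 x}.
    exact: aeW.
  have := hC _ _ Sg; rewrite (extremal_equality hk Sg ub) (extremal_sqdist hk Sg ub).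
  rewrite -!EFinM lee_fin ler_pM2r// (bigD1 i0)//= big1 ?addr0.
    rewrite mxE !eqxx expr1n mul1r gram_free ?subn_gt0//.
    by rewrite divr_gt0// gram_gt0.
  by move=> i ii0; rewrite mxE (negbTE ii0) andbF expr0n mul0r.
- move=> u g Sug; split; first exact: deficit_eq_extremal.
  by move=> [b [b0 ub]]; exact: extremal_equality ub.
- by move=> b b0; exact: extremal_in_S.
Qed.
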